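(* Let $\Gamma$ be a countable discrete group. For every point $x$ in the Hamana boundary $\partial_H\Gamma$, the $C^*$-algebra $\pi_x(C^*_r\Gamma)$ is simple.
   Context: A $\Gamma$-operator system is an operator system with a $\Gamma$-action by unital complete order isomorphisms; a $\Gamma$-morphism is a $\Gamma$-equivariant unital completely positive map. A $\Gamma$-operator system $V$ is $\Gamma$-injective if for all $\Gamma$-operator systems $W_0\subset W$ every $\Gamma$-morphism $W_0\to V$ extends to a $\Gamma$-morphism $W\to V$. The Hamana boundary $\partial_H\Gamma$ is the Gelfand spectrum of the $\Gamma$-injective envelope of $\mathbb{C}$ (with trivial action): $C(\partial_H\Gamma)$ is a commutative unital $C^*$-algebra with $\Gamma$-action that is a $\Gamma$-injective operator system and is rigid, i.e. the identity is the only $\Gamma$-morphism $C(\partial_H\Gamma)\to C(\partial_H\Gamma)$. It is a compact Hausdorff space with a $\Gamma$-action. For $x\in\partial_H\Gamma$, $\pi_x$ denotes the representation of the reduced crossed product $C(\partial_H\Gamma)\rtimes_r\Gamma$ on $\ell_2(\Gamma x)$ ($\Gamma x$ being the orbit of $x$) given by $\pi_x(f)\delta_y=f(y)\delta_y$ for $f\in C(\partial_H\Gamma)$ and $\pi_x(\lambda_t)\delta_y=\delta_{ty}$ for $t\in\Gamma$, $y\in\Gamma x$, where $\lambda_t$ are the canonical unitaries. (It is well defined on the reduced crossed product since the stabilizer of $x$ is amenable.) $C^*_r\Gamma\subset C(\partial_H\Gamma)\rtimes_r\Gamma$ is the reduced group $C^*$-algebra, generated by the $\lambda_t$. Simple means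 having no non-trivial closed two-sided ideals. *)

(* Defs.v *)
From HB Require Import structures.
From mathcomp Require Import all_boot all_order all_algebra.
From mathcomp Require Import finmap.
From mathcomp Require Import all_classical all_reals.
From mathcomp Require Import topology normedtype sequences esum.
From mathcomp Require Import complex.
From mathcomp.analysis.showcase Require summability.

Set Implicit Arguments.
Unset Strict Implicit.
Unset Printing Implicit Defensive.
Import Order.TTheory GRing.Theory Num.Theory.
Import numFieldNormedType.Exports.

Local Open Scope classical_set_scope.
Local Open Scope ring_scope.

Section OperatorSystemDefs.
Variables (R : realType) (V : lmodType R[i]).

(* [a^* A a] for a scalar matrix [a] and a [V]-valued matrix [A]. *)
Definition compress m n (a : 'M[R[i]]_(m, n)) (A : 'M[V]_m) : 'M[V]_n :=
  \matrix_(i < n, j < n)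
    \sum_(k < m) \sum_(l < m) ((a k i)^* * a l j)%R *: A k l.

Definition mxstar (star : V -> V) n (A : 'M[V]_n) : 'M[V]_n :=
  \matrix_(i < n, j < n) star (A j i).

Definition mxdiag_const n (v : V) : 'M[V]_n :=
  \matrix_(i < n, j < n) (if i == j then v else 0).

End OperatorSystemDefs.

(* Operator systems in the sense of Choi and Effros: a complex vector space
   with an involution, a proper compatible matrix ordering (the sets [os_pos n]
   of positive n x n matrices) and an Archimedean matrix order unit.
   In [R[i]] the relation [0 < r] means that [r] is real and positive. *)
Record operator_system (R : realType) := OperatorSystem {
  os_sort :> lmodType R[i];
  os_star : os_sort -> os_sort;
  os_one : os_sort;
  os_pos : forall n, set 'M[os_sort]_n;
  os_starK : forall v, os_star (os_star v) = v;
  os_starD : forall v w, os_star (v + w) = os_star v + os_star w;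
  os_starZ : forall (a : R[i]) v, os_star (a *: v) = a^* *: os_star v;
  os_star1 : os_star os_one = os_one;
  os_pos_star : forall n A, @os_pos n A -> mxstar os_star A = A;
  os_pos0 : forall n, @os_pos n 0;
  os_posD : forall n A B, @os_pos n A -> @os_pos n B -> @os_pos n (A + B);
  os_posZ : forall n (r : R[i]) A, 0 <= r -> @os_pos n A ->
    @os_pos n (map_mx (fun v => r *: v) A);
  os_pos_proper : forall n A, @os_pos n A -> @os_pos n (- A) -> A = 0;
  os_pos_compress : forall m n (a : 'M[R[i]]_(m, n)) A,
    @os_pos m A -> @os_pos n (compress a A);
  os_order_unit : forall n A, mxstar os_star A = A ->
    exists2 r : R[i], 0 < r & @os_pos n (mxdiag_const n (r *: os_one) + A);
  os_archimedean : forall n A,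
    (forall r : R[i], 0 < r -> @os_pos n (mxdiag_const n (r *: os_one) + A)) ->
    @os_pos n A
}.

Arguments os_star {R} o v.
Arguments os_one {R} o.
Arguments os_pos {R} o n A.

(* Compatibility with the involutions is not required below, as it is automatic
   for linear maps preserving positivity: self-adjoint elements are differences
   of positive ones. *)
Section Morphisms.
Variables (R : realType) (V W : operator_system R).

Definition unital_completely_positive (f : V -> W) :=
  [/\ linear f, f (os_one V) = os_one W &
      forall n (A : 'M[V]_n), os_pos V n A -> os_pos W n (map_mx f A)].

Definition unital_complete_order_embedding (f : V -> W) :=
  [/\ linear f, f (os_one V) = os_one W &
      forall n (A : 'M[V]_n), os_pos V n A <-> os_pos W n (map_mx f A)].

Definition unital_complete_order_isomorphism (f : V -> W) :=
  bijective f /\ unital_complete_order_embedding f.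

End Morphisms.

Record gamma_operator_system (R : realType) (Gamma : groupType) :=
    GammaOperatorSystem {
  gos_sort :> operator_system R;
  gos_act : Gamma -> gos_sort -> gos_sort;
  gos_act1 : forall v, gos_act 1%g v = v;
  gos_actM : forall s t v, gos_act (s * t)%g v = gos_act s (gos_act t v);
  gos_act_iso : forall t, unital_complete_order_isomorphism (gos_act t)
}.

Arguments gos_act {R Gamma} g t v.

Section GammaMorphisms.
Variables (R : realType) (Gamma : groupType).
Implicit Types V W : gamma_operator_system R Gamma.

Definition equivariant V W (f : V -> W) :=
  forall t v, f (gos_act V t v) = gos_act W t (f v).

Definition gamma_morphism V W (f : V -> W) :=
  unital_completely_positive f /\ equivariant f.

(* An inclusion [W0 `<=` W] of Gamma-operator systems, as the map [W0 -> W]. *)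
Definition gamma_inclusion W0 W (f : W0 -> W) :=
  unital_complete_order_embedding f /\ equivariant f.

Definition gamma_injective V := forall W0 W (iota : W0 -> W) (f : W0 -> V),
  gamma_inclusion iota -> gamma_morphism f ->
  exists2 g : W -> V, gamma_morphism g & forall w, g (iota w) = f w.

Definition gamma_rigid V := forall f : V -> V,
  gamma_morphism f -> forall v, f v = v.

End GammaMorphisms.

Record compact_gamma_space (Gamma : groupType) := CompactGammaSpace {
  cgs_sort :> topologicalType;
  cgs_act : Gamma -> cgs_sort -> cgs_sort;
  cgs_compact : compact [set: cgs_sort];
  cgs_hausdorff : hausdorff_space cgs_sort;
  cgs_act1 : forall x, cgs_act 1%g x = x;
  cgs_actM : forall s t x, cgs_act (s * t)%g x = cgs_act s (cgs_act t x);
  cgs_act_continuous : forall t, continuous (cgs_act t)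
}.

Arguments cgs_act {Gamma} c t x.

(* The regular module [R[i]^o] carries the norm topology of the complex
   numbers. *)
Notation Cfun R X := (continuousType X (R[i]^o : normedModType R[i])).

Section ContinuousFunctions.
Variables (R : realType) (X : topologicalType).
Local Notation CX := (Cfun R X).
Implicit Types f g h : CX.

Lemma cfun_cst_subproof (a : R[i]) : continuous (fun _ : X => a : R[i]^o).
Proof. by move=> x; exact: cvg_cst. Qed.
Lemma cfun_opp_subproof f : continuous (fun x => - f x).
Proof. by move=> x; apply: cvgN; exact: cts_fun. Qed.
Lemma cfun_add_subproof f g : continuous (fun x => f x + g x).
Proof. by move=> x; apply: cvgD; exact: cts_fun. Qed.
Lemma cfun_scale_subproof (a : R[i]) f : continuous (fun x => a *: f x).
Proof. by move=> x; apply: cvgZr; exact: cts_fun. Qed.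
Lemma cfun_conj_subproof f : continuous (fun x => (f x)^* : R[i]^o).
Proof.
move=> x; have /(@cvgrPdist_lt _ R[i]^o) cf := @cts_fun _ _ f x.
apply/(@cvgrPdist_lt _ R[i]^o) => e e0; apply: filterS (cf _ e0) => y.
by rewrite -rmorphB norm_conjC.
Qed.

Definition cfun_cst a : CX := mkcts (@cfun_cst_subproof a).
Definition cfun_opp f : CX := mkcts (@cfun_opp_subproof f).
Definition cfun_add f g : CX := mkcts (@cfun_add_subproof f g).
Definition cfun_scale a f : CX := mkcts (@cfun_scale_subproof a f).
Definition cfun_conj f : CX := mkcts (@cfun_conj_subproof f).

Lemma cfun_addA : associative cfun_add.
Proof. by move=> f g h; apply/continuousEP => x; exact: addrA. Qed.
Lemma cfun_addC : commutative cfun_add.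
Proof. by move=> f g; apply/continuousEP => x; exact: addrC. Qed.
Lemma cfun_add0 : left_id (cfun_cst 0) cfun_add.
Proof. by move=> f; apply/continuousEP => x; exact: add0r. Qed.
Lemma cfun_addN : left_inverse (cfun_cst 0) cfun_opp cfun_add.
Proof. by move=> f; apply/continuousEP => x; exact: addNr. Qed.
HB.instance Definition _ := GRing.isZmodule.Build CX
  cfun_addA cfun_addC cfun_add0 cfun_addN.

Lemma cfun_scaleA a b f : cfun_scale a (cfun_scale b f) = cfun_scale (a * b) f.
Proof. by apply/continuousEP => x; exact: scalerA. Qed.
Lemma cfun_scale1 : left_id 1 cfun_scale.
Proof. by move=> f; apply/continuousEP => x; exact: scale1r. Qed.
Lemma cfun_scaleDr : right_distributive cfun_scale +%R.
Proof. by move=> a f g; apply/continuousEP => x; exact: scalerDr. Qed.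
Lemma cfun_scaleDl f : {morph cfun_scale^~ f : a b / a + b}.
Proof. by move=> a b; apply/continuousEP => x; exact: scalerDl. Qed.
HB.instance Definition _ := GRing.Zmodule_isLmodule.Build R[i] CX
  cfun_scaleA cfun_scale1 cfun_scaleDr cfun_scaleDl.

Lemma cfunDE f g x : (f + g) x = f x + g x. Proof. by []. Qed.
Lemma cfunNE f x : (- f) x = - f x. Proof. by []. Qed.
Lemma cfunZE (a : R[i]) f x : (a *: f) x = a * f x. Proof. by []. Qed.
Lemma cfun_sumE (I : Type) (r : seq I) (P : pred I) (F : I -> CX) x :
  (\sum_(i <- r | P i) F i) x = \sum_(i <- r | P i) F i x.
Proof. by elim/big_rec2: _ => // i y z _ <-. Qed.

(* As [0 <= z] in [R[i]] forces [z] to be real, such a [B] is Hermitian. *)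
Definition psdmx n (B : 'M[R[i]]_n) : Prop :=
  forall v : 'cV[R[i]]_n, 0 <= (map_mx Num.conj v^T *m B *m v) 0 0.

Definition cfun_eval n (A : 'M[CX]_n) (x : X) : 'M[R[i]]_n :=
  \matrix_(i, j) A i j x.

Definition cfun_pos n : set 'M[CX]_n :=
  [set A | forall x, psdmx (cfun_eval A x)].

End ContinuousFunctions.

Section PositiveSemidefinite.
Variable R : realType.
Local Notation C := R[i].

Definition sform n (B : 'M[C]_n) (u v : 'cV[C]_n) : C :=
  (map_mx Num.conj u^T *m B *m v) 0 0.

Lemma sformDl n (B : 'M[C]_n) u u' v :
  sform B (u + u') v = sform B u v + sform B u' v.
Proof. by rewrite /sform linearD map_mxD !mulmxDl mxE. Qed.

Lemma sformDr n (B : 'M[C]_n) u v v' :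
  sform B u (v + v') = sform B u v + sform B u v'.
Proof. by rewrite /sform mulmxDr mxE. Qed.

Lemma sformZl n (B : 'M[C]_n) a u v : sform B (a *: u) v = a^* * sform B u v.
Proof. by rewrite /sform linearZ /= map_mxZ -!scalemxAl mxE. Qed.

Lemma sformZr n (B : 'M[C]_n) a u v : sform B u (a *: v) = a * sform B u v.
Proof. by rewrite /sform -!scalemxAr mxE. Qed.

Lemma sformE n (B : 'M[C]_n) u v :
  sform B u v = \sum_i \sum_j (u i 0)^* * B i j * v j 0.
Proof.
rewrite /sform mxE exchange_big; apply: eq_bigr => j _.
by rewrite mxE big_distrl; apply: eq_bigr => i _; rewrite !mxE.
Qed.

Lemma sform_delta n (B : 'M[C]_n) i j :
  sform B (delta_mx i 0) (delta_mx j 0) = B i j.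
Proof.
rewrite sformE (bigD1 i) //= (bigD1 j) //= !mxE !eqxx conjC1 mul1r mulr1.
rewrite big1 ?addr0 => [|k /negPf kj]; last by rewrite !mxE kj mulr0.
rewrite big1 ?addr0 // => k /negPf ki.
by rewrite big1 // => l _; rewrite !mxE ki conjC0 !mul0r.
Qed.

Lemma sform_eq0 n (B : 'M[C]_n) : (forall v, sform B v v = 0) -> B = 0.
Proof.
move=> B0; have S u v : sform B u v + sform B v u = 0.
  by have := B0 (u + v); rewrite sformDl !sformDr !B0 add0r addr0.
have D u v : sform B u v = 0.
  have := S u (('i : C) *: v); rewrite sformZl sformZr conjCi mulNr -mulrBr.
  move/eqP; rewrite mulf_eq0 (negPf (neq0Ci _)) /= subr_eq0 => /eqP e.
  have := S u v; rewrite -e -mulr2n => /eqP.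
  by rewrite mulrn_eq0 /= => /eqP.
by apply/matrixP => i j; rewrite mxE -sform_delta.
Qed.

Lemma sform_conj n (B : 'M[C]_n) v :
  (sform B v v)^* = sform (map_mx Num.conj B^T) v v.
Proof.
rewrite !sformE exchange_big rmorph_sum; apply: eq_bigr => i _.
rewrite rmorph_sum; apply: eq_bigr => j _.
by rewrite !rmorphM /= conjCK !mxE [in RHS]mulrC mulrA [in RHS]mulrAC mulrAC.
Qed.

Lemma sformB n (A B : 'M[C]_n) u v : sform (A - B) u v = sform A u v - sform B u v.
Proof. by rewrite /sform mulmxBr mulmxBl !mxE. Qed.
Lemma sformD n (A B : 'M[C]_n) u v : sform (A + B) u v = sform A u v + sform B u v.
Proof. by rewrite /sform mulmxDr mulmxDl !mxE. Qed.
Lemma sformN n (A : 'M[C]_n) u v : sform (- A) u v = - sform A u v.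
Proof. by rewrite /sform mulmxN mulNmx !mxE. Qed.
Lemma sformZ n a (A : 'M[C]_n) u v : sform (a *: A) u v = a * sform A u v.
Proof. by rewrite /sform -scalemxAr -scalemxAl !mxE. Qed.

Lemma psdmx_herm n (B : 'M[C]_n) : psdmx B -> map_mx Num.conj B^T = B.
Proof.
move=> B0; apply/eqP; rewrite -subr_eq0; apply/eqP/sform_eq0 => v.
rewrite sformB -sform_conj; apply/eqP; rewrite subr_eq0.
by apply/eqP/CrealP/ger0_real/B0.
Qed.

Definition sqn n (v : 'cV[C]_n) : C := \sum_i `|v i 0| ^+ 2.

Lemma sform1 n (v : 'cV[C]_n) : sform 1%:M v v = sqn v.
Proof.
rewrite /sform mulmx1 mxE; apply: eq_bigr => i _.
by rewrite !mxE mulrC -normCK.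
Qed.

Lemma sqn_ge0 n (v : 'cV[C]_n) : 0 <= sqn v.
Proof. by apply: sumr_ge0 => i _; rewrite exprn_ge0. Qed.

Lemma normr_amgm (a b : C) : `|a| * `|b| <= 2^-1 * (`|a| ^+ 2 + `|b| ^+ 2).
Proof.
have sq0 : 0 <= (`|a| - `|b|) ^+ 2.
  by rewrite real_exprn_even_ge0 // realB // ger0_real.
rewrite [leRHS]mulrC ler_pdivlMr ?ltr0n// -subr_ge0.
by apply: le_trans sq0 _; rewrite sqrrB mulr_natr addrAC.
Qed.

Lemma sform_bound n (B : 'M[C]_n) (M : C) v : 0 <= M ->
  (forall i j, `|B i j| <= M) -> `|sform B v v| <= (M * n%:R) * sqn v.
Proof.
move=> M0 BM; rewrite sformE.
have AG i j : `|(v i 0)^* * B i j * v j 0| <=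
    M * (2^-1 * (`|v i 0| ^+ 2 + `|v j 0| ^+ 2)).
  rewrite !normrM norm_conjC mulrAC mulrC.
  by apply: ler_pM; rewrite ?mulr_ge0 ?normr_amgm.
apply: (@le_trans _ _ (\sum_(i < n) \sum_(j < n)
    M * (2^-1 * (`|v i 0| ^+ 2 + `|v j 0| ^+ 2)))).
  apply: le_trans (ler_norm_sum _ _ _) _; apply: ler_sum => i _.
  by apply: le_trans (ler_norm_sum _ _ _) _; apply: ler_sum.
under eq_bigr do rewrite -mulr_sumr -mulr_sumr.
rewrite -mulr_sumr -mulr_sumr -mulrA ler_wpM2l//.
under eq_bigr do rewrite big_split /= sumr_const card_ord.
rewrite big_split /= sumr_const card_ord sumrMnl -/(sqn v) -mulr2n.
by rewrite -[X in _ * X]mulr_natl mulrA mulVf ?pnatr_eq0// mul1r mulr_natl.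
Qed.

End PositiveSemidefinite.

Section ContinuousFunctionsSystem.
Variables (R : realType) (X : topologicalType) (cptX : compact [set: X]).
Local Notation CX := (Cfun R X).
Local Notation C := R[i].

Lemma cfun_bounded (f : CX) : exists2 M : C, 0 <= M & forall x, `|f x| <= M.
Proof.
pose g x : R := complex.Re `|f x|.
have gE x : (g x)%:C%C = `|f x| by rewrite /g normc_def.
have cg : continuous g.
  move=> x; have /(@cvgrPdist_lt _ R[i]^o) cf := @cts_fun _ _ f x.
  apply/cvgrPdist_lt => e e0.
  have e0' : 0 < e%:C%C :> C by rewrite ltcR.
  apply: filterS (cf _ e0') => y; rewrite -ltcR; apply: le_lt_trans.
  have -> : g x - g y = complex.Re (`|f x| - `|f y|) by rewrite /g raddfB.
  by apply: le_trans (normc_ge_Re _) _; exact: ler_dist_dist.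
have /compact_bounded[M [_ Mg]] :
    compact (g @` [set: X]).
  by apply: continuous_compact => //; exact: continuous_subspaceT.
pose N := Num.max 0 M + 1.
have N0 : 0 <= N by rewrite addr_ge0 // le_max lexx.
exists (N%:C)%C => [|x]; first by rewrite lecR.
rewrite -gE lecR; apply: le_trans (ler_norm _) _; apply: Mg; last by exists x.
by rewrite /N ltr_pwDr // le_max lexx orbT.
Qed.

Lemma cfun_mx_bounded n (A : 'M[CX]_n) :
  exists2 M : C, 0 <= M & forall i j x, `|A i j x| <= M.
Proof.
have /choice[M HM] (p : 'I_n * 'I_n) : exists M : C,
    0 <= M /\ forall x, `|A p.1 p.2 x| <= M.
  by have [M M0 AM] := cfun_bounded (A p.1 p.2); exists M.
exists (\sum_p M p) => [|i j x]; first by apply: sumr_ge0 => p _; case: (HM p).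
apply: le_trans ((HM (i, j)).2 x) _; rewrite (bigD1 (i, j)) //= lerDl.
by apply: sumr_ge0 => p _; case: (HM p).
Qed.

Lemma cfun_conjE (f : CX) x : cfun_conj f x = (f x)^*. Proof. by []. Qed.

Lemma cfun_starK (f : CX) : cfun_conj (cfun_conj f) = f.
Proof. by apply/continuousEP => x; rewrite !cfun_conjE conjCK. Qed.

Lemma cfun_starD (f g : CX) : cfun_conj (f + g) = cfun_conj f + cfun_conj g.
Proof. by apply/continuousEP => x; exact: rmorphD. Qed.

Lemma cfun_starZ a (f : CX) : cfun_conj (a *: f) = a^* *: cfun_conj f.
Proof. by apply/continuousEP => x; exact: rmorphM. Qed.

Lemma cfun_star1 : cfun_conj (cfun_cst X (1 : C)) = cfun_cst X (1 : C).
Proof. by apply/continuousEP => x; exact: conjC1. Qed.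

Lemma cfun_evalD n (A B : 'M[CX]_n) x :
  cfun_eval (A + B) x = cfun_eval A x + cfun_eval B x.
Proof. by apply/matrixP => i j; rewrite !mxE. Qed.

Lemma cfun_evalN n (A : 'M[CX]_n) x : cfun_eval (- A) x = - cfun_eval A x.
Proof. by apply/matrixP => i j; rewrite !mxE. Qed.

Lemma cfun_eval_inj n (A B : 'M[CX]_n) :
  (forall x, cfun_eval A x = cfun_eval B x) -> A = B.
Proof.
move=> AB; apply/matrixP => i j; apply/continuousEP => x.
by have /matrixP/(_ i j) := AB x; rewrite !mxE.
Qed.

Lemma cfun_eval_star n (A : 'M[CX]_n) x :
  cfun_eval (mxstar (@cfun_conj R X) A) x =
  map_mx Num.conj (cfun_eval A x)^T.
Proof. by apply/matrixP => i j; rewrite !mxE. Qed.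

Lemma cfun_eval_diag n r x :
  cfun_eval (mxdiag_const n (r *: cfun_cst X (1 : C))) x = r%:M.
Proof.
apply/matrixP => i j; rewrite !mxE; case: eqP => _ //=.
by rewrite cfunZE mulr1.
Qed.

Lemma cfun_pos_star n (A : 'M[CX]_n) :
  cfun_pos A -> mxstar (@cfun_conj R X) A = A.
Proof.
by move=> A0; apply: cfun_eval_inj => x; rewrite cfun_eval_star psdmx_herm.
Qed.

Lemma cfun_pos0 n : cfun_pos (0 : 'M[CX]_n).
Proof.
move=> x v; rewrite (_ : cfun_eval _ _ = 0) ?mulmx0 ?mul0mx ?mxE//.
by apply/matrixP => i j; rewrite !mxE.
Qed.

Lemma cfun_posD n (A B : 'M[CX]_n) : cfun_pos A -> cfun_pos B -> cfun_pos (A + B).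
Proof.
move=> A0 B0 x v; rewrite cfun_evalD -/(sform _ _ _) sformD.
by apply: addr_ge0; [exact: A0|exact: B0].
Qed.

Lemma cfun_posZ n (r : C) (A : 'M[CX]_n) : 0 <= r -> cfun_pos A ->
  cfun_pos (map_mx (fun v => r *: v) A).
Proof.
move=> r0 A0 x v; rewrite -/(sform _ _ _) (_ : cfun_eval _ _ = r *: cfun_eval A x).
  by rewrite sformZ mulr_ge0 //; exact: A0.
by apply/matrixP => i j; rewrite !mxE.
Qed.

Lemma cfun_pos_proper n (A : 'M[CX]_n) : cfun_pos A -> cfun_pos (- A) -> A = 0.
Proof.
move=> A0 NA0; apply: cfun_eval_inj => x.
rewrite (_ : cfun_eval 0 x = 0); last by apply/matrixP => i j; rewrite !mxE.
apply: sform_eq0 => v; apply/eqP; rewrite eq_le; apply/andP; split.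
  by have := NA0 x v; rewrite cfun_evalN -/(sform _ _ _) sformN oppr_ge0.
exact: A0.
Qed.

Lemma cfun_eval_compress m n (a : 'M[C]_(m, n)) (A : 'M[CX]_m) x :
  cfun_eval (compress a A) x = map_mx Num.conj a^T *m cfun_eval A x *m a.
Proof.
apply/matrixP => i j; rewrite !mxE cfun_sumE.
under [RHS]eq_bigr do rewrite mxE big_distrl.
rewrite [RHS]exchange_big /=; apply: eq_bigr => k _.
rewrite cfun_sumE; apply: eq_bigr => l _.
by rewrite cfunZE !mxE mulrAC.
Qed.

Lemma cfun_pos_compress m n (a : 'M[C]_(m, n)) (A : 'M[CX]_m) :
  cfun_pos A -> cfun_pos (compress a A).
Proof.
move=> A0 x v; rewrite cfun_eval_compress.
by have := A0 x (a *m v); rewrite trmx_mul map_mxM !mulmxA.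
Qed.

Lemma cfun_order_unit n (A : 'M[CX]_n) : mxstar (@cfun_conj R X) A = A ->
  exists2 r : C, 0 < r &
    cfun_pos (mxdiag_const n (r *: cfun_cst X (1 : C)) + A).
Proof.
move=> hA; have [M M0 AM] := cfun_mx_bounded A.
exists (M * n%:R + 1); first by rewrite ltr_wpDl // mulr_ge0.
move=> x v; rewrite -/(sform _ _ _) cfun_evalD cfun_eval_diag sformD.
rewrite -scalemx1 sformZ sform1.
set q := sform _ _ _; have qR : q \is Num.real.
  by apply/CrealP; rewrite /q sform_conj -cfun_eval_star hA.
have : `|q| <= M * n%:R * sqn v.
  by apply: sform_bound => // i j; rewrite mxE.
rewrite real_ler_norml// => /andP[+ _]; rewrite -subr_ge0 opprK => q0.
by rewrite mulrDl mul1r addrAC addr_ge0 ?sqn_ge0 // addrC.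
Qed.

Lemma cfun_archimedean n (A : 'M[CX]_n) :
  (forall r : C, 0 < r ->
    cfun_pos (mxdiag_const n (r *: cfun_cst X (1 : C)) + A)) -> cfun_pos A.
Proof.
move=> A0 x v; rewrite -/(sform _ _ _); set q := sform _ _ _.
have H (r : C) : 0 < r -> 0 <= r * sqn v + q.
  move=> r0; have := A0 r r0 x v; rewrite -/(sform _ _ _).
  by rewrite cfun_evalD cfun_eval_diag sformD -scalemx1 sformZ sform1.
have s0 := sqn_ge0 v.
have qR : q \is Num.real.
  by rewrite -(addKr (1 * sqn v) q) realD ?realN ?ger0_real ?H ?mul1r.
have [//|q0] := real_leP (real0 C) qR.
have s1 : 0 < sqn v + 1 by rewrite ltr_wpDl.
have r0 : 0 < - q / (2 * (sqn v + 1)).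
  by rewrite divr_gt0 ?oppr_gt0 // mulr_gt0.
have := H _ r0; rewrite addrC -mulrA mulNr subr_ge0.
suff : q < q * ((2 * (sqn v + 1))^-1 * sqn v).
  by move=> h1 h2; have := lt_le_trans h1 h2; rewrite ltxx.
rewrite ltr_nMr // mulrC ltr_pdivrMr ?mulr_gt0 // mul1r.
by rewrite mulr_natl mulr2n ltr_wpDr ?ltrDl // ltW.
Qed.

Definition cfun_operator_system : operator_system R := OperatorSystem
  cfun_starK cfun_starD cfun_starZ cfun_star1 cfun_pos_star cfun_pos0
  cfun_posD cfun_posZ cfun_pos_proper cfun_pos_compress cfun_order_unit
  cfun_archimedean.

End ContinuousFunctionsSystem.

Section ContinuousFunctionsAction.
Variables (R : realType) (Gamma : groupType) (X : compact_gamma_space Gamma).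
Local Notation V := (cfun_operator_system R (@cgs_compact _ X)).

Lemma cfun_act_subproof (t : Gamma) (f : Cfun R X) :
  continuous (fun x => f (cgs_act X t^-1%g x)).
Proof.
move=> x; apply: continuous_comp; first exact: cgs_act_continuous.
exact: cts_fun.
Qed.

Definition cfun_act (t : Gamma) (f : V) : V := mkcts (@cfun_act_subproof t f).

Lemma cfun_actE t f x : cfun_act t f x = f (cgs_act X t^-1%g x).
Proof. by []. Qed.

Lemma cfun_act1 f : cfun_act 1%g f = f.
Proof. by apply/continuousEP => x; rewrite cfun_actE invg1 cgs_act1. Qed.

Lemma cfun_actM s t f : cfun_act (s * t)%g f = cfun_act s (cfun_act t f).
Proof. by apply/continuousEP => x; rewrite !cfun_actE invgM cgs_actM. Qed.

Lemma cfun_act_iso t : unital_complete_order_isomorphism (cfun_act t).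
Proof.
split; first by exists (cfun_act t^-1%g) => f;
  rewrite -cfun_actM ?mulVg ?mulgV cfun_act1.
split=> [a f g||n A]; [exact/continuousEP|exact/continuousEP|].
split=> A0 x.
  rewrite (_ : cfun_eval _ _ = cfun_eval A (cgs_act X t^-1%g x)); first exact: A0.
  by apply/matrixP => i j; rewrite !mxE.
rewrite (_ : cfun_eval _ _ = cfun_eval (map_mx (cfun_act t) A) (cgs_act X t x)).
  exact: A0.
by apply/matrixP => i j; rewrite !mxE cfun_actE -cgs_actM mulVg cgs_act1.
Qed.

Definition cfun_gamma_operator_system : gamma_operator_system R Gamma :=
  GammaOperatorSystem cfun_act1 cfun_actM cfun_act_iso.

End ContinuousFunctionsAction.

(* Every Gamma-morphism is unital, hence extends the identity of the copy of
   [C] spanned by the unit: being Gamma-injective and rigid says exactly that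
   [C(X)] is the Gamma-injective envelope of [C]. *)
Definition hamana_boundary (R : realType) (Gamma : groupType)
    (X : compact_gamma_space Gamma) : Prop :=
  gamma_injective (cfun_gamma_operator_system R X) /\
  gamma_rigid (cfun_gamma_operator_system R X).

Section SquareSummable.
Variables (R : realType) (T : choiceType).
Local Notation C := R[i].
Implicit Types f g : T -> C.

Definition sqnorm (z : C) : R := complex.Re `|z| ^+ 2.

Definition sqsum f : \bar R := (\esum_(i in [set: T]) (sqnorm (f i))%:E)%E.

Definition sq_summable : {pred T -> C} := fun f => `[< (sqsum f < +oo)%E >].

Lemma sqnormE z : (sqnorm z)%:C%C = `|z| ^+ 2.
Proof. by rewrite /sqnorm rmorphXn normc_def. Qed.

Lemma sqnorm_ge0 z : 0 <= sqnorm z.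
Proof. exact: sqr_ge0. Qed.

Lemma esum_dom (a b : T -> R) (M : R) :
    (forall i, 0 <= a i) -> (forall i, b i <= M * a i) ->
  (\esum_(i in [set: T]) (a i)%:E < +oo)%E ->
  (\esum_(i in [set: T]) (b i)%:E < +oo)%E.
Proof.
move=> a0 bMa afin.
have N0 n : (\esum_(i in [set: T]) (n%:R * a i)%:E < +oo)%E.
  elim: n => [|n IH].
    by rewrite esum1 ?ltry // => i _; rewrite mul0r.
  rewrite (@eq_esum _ _ _ _ (fun i => (n%:R * a i)%:E + (a i)%:E)%E); last first.
    by move=> i _; rewrite -natr1 mulrDl mul1r EFinD.
  by rewrite esumD ?lte_add_pinfty // => i _; rewrite lee_fin ?mulr_ge0.
apply: le_lt_trans (N0 (Num.bound M)); apply: le_esum => i _; rewrite lee_fin.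
apply: le_trans (bMa i) _; rewrite ler_wpM2r //.
have [M0|/ltW M0] := leP 0 M; first by rewrite ltW // archi_boundP.
by apply: le_trans M0 _; rewrite ler0n.
Qed.

Lemma sq_summable_dom f g (M : R) :
    (forall i, sqnorm (g i) <= M * sqnorm (f i)) ->
  f \in sq_summable -> g \in sq_summable.
Proof.
move=> gMf /asboolP f0; apply/asboolP; apply: esum_dom f0 => //.
by move=> i; exact: sqnorm_ge0.
Qed.

Lemma sqnormD a b : sqnorm (a + b) <= 2 * (sqnorm a + sqnorm b).
Proof.
rewrite -lecR !sqnormE [leRHS]rmorphM /= rmorph_nat [in leRHS]rmorphD /= !sqnormE.
apply: (@le_trans _ _ ((`|a| + `|b|) ^+ 2)).
  by rewrite lerXn2r ?nnegrE ?addr_ge0 // ler_normD.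
rewrite sqrrD mulr_natl mulr2n addrAC lerD2l.
have := normr_amgm a b; rewrite [leRHS]mulrC ler_pdivlMr ?ltr0n //.
by rewrite mulr_natr.
Qed.

Lemma sqnormM a b : sqnorm (a * b) = sqnorm a * sqnorm b.
Proof.
by apply: (@complexI R); rewrite [RHS]rmorphM /= !sqnormE normrM exprMn.
Qed.

Lemma sq_summable_submod : submod_closed sq_summable.
Proof.
split=> [|a f g /asboolP fs /asboolP gs].
  apply/asboolP; rewrite /sqsum esum1 ?ltry // => i _.
  by rewrite /sqnorm normr0 expr0n.
apply/asboolP; pose s := (sqnorm a + 1); have s0 : 0 <= s.
  by rewrite addr_ge0 ?sqnorm_ge0.
apply: (@esum_dom (fun i => sqnorm (f i) + sqnorm (g i)) _ (2 * s)).
- by move=> i; rewrite addr_ge0 ?sqnorm_ge0.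
- move=> i; apply: le_trans (sqnormD _ _) _.
  rewrite -mulrA ler_wpM2l // sqnormM mulrDr lerD // /s mulrDl mul1r.
    by rewrite lerDl sqnorm_ge0.
  by rewrite lerDr mulr_ge0 ?sqnorm_ge0.
rewrite (@eq_esum _ _ _ _ (fun i => (sqnorm (f i))%:E + (sqnorm (g i))%:E)%E) //.
by rewrite esumD ?lte_add_pinfty // => i _; rewrite lee_fin ?sqnorm_ge0.
Qed.

HB.instance Definition _ :=
  GRing.isSubmodClosed.Build C (T -> C) sq_summable sq_summable_submod.

End SquareSummable.

Record l2 (R : realType) (T : choiceType) := L2 {
  l2_fun :> T -> R[i];
  l2_summable : l2_fun \in @sq_summable R T
}.

HB.instance Definition _ (R : realType) (T : choiceType) :=
  [isSub for @l2_fun R T].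
HB.instance Definition _ (R : realType) (T : choiceType) :=
  [Choice of l2 R T by <:].
HB.instance Definition _ (R : realType) (T : choiceType) :=
  [SubChoice_isSubLmodule of l2 R T by <:].

Section Operators.
Variables (R : realType) (T : choiceType).
Local Notation C := R[i].
Local Notation H := (l2 R T).
Implicit Types (xi eta : H) (f g : H -> H) (A I : set (H -> H)).

Definition l2_norm xi : R := Num.sqrt (fine (sqsum xi)).

(* [summability.sum] is the limit of the net of finite partial sums. *)
Definition l2_inner xi eta : C :=
  summability.sum (fun i => xi i * (eta i)^* : (R[i]^o : normedModType R[i])).

Lemma l2_delta_subproof (j : T) : (fun i : T => (i == j)%:R) \in @sq_summable R T.
Proof.
apply/asboolP; rewrite /sqsum.
rewrite (@eq_esum _ _ _ _
  (fun i => if i \in [set j] then (1%:E : \bar R) else 0%E)).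
  by rewrite -esum_mkcond esum_set1 ?lee_fin // ltry.
move=> i _; rewrite /sqnorm; case: eqVneq => [->|ij].
  by rewrite normr1 expr1n mem_set.
by rewrite normr0 expr0n memNset // => /eqP; rewrite (negPf ij).
Qed.

Definition l2_delta (j : T) : H := L2 (l2_delta_subproof j).

Definition bounded_operator f : Prop :=
  linear f /\ exists M : R, forall xi, l2_norm (f xi) <= M * l2_norm xi.

Definition is_adjoint f g : Prop :=
  forall xi eta, l2_inner (f xi) eta = l2_inner xi (g eta).

Definition norm_closure A : set (H -> H) :=
  [set f | bounded_operator f /\ forall e : R, 0 < e ->
     exists2 g, A g & forall xi, l2_norm (f xi - g xi) <= e * l2_norm xi].

Definition operator_subspace A : Prop :=
  [/\ A 0, forall f g, A f -> A g -> A (f + g) &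
      forall (a : C) f, A f -> A (a *: f)].

Definition cstar_subalgebra A : Prop :=
  [/\ A `<=` bounded_operator,
      operator_subspace A,
      forall f g, A f -> A g -> A (f \o g),
      forall f g, A f -> is_adjoint f g -> A g &
      norm_closure A `<=` A].

Definition cstar_generated (S : set (H -> H)) : set (H -> H) :=
  smallest cstar_subalgebra S.

Definition closed_ideal A I : Prop :=
  [/\ I `<=` A,
      operator_subspace I,
      forall a f, A a -> I f -> I (a \o f),
      forall a f, A a -> I f -> I (f \o a) &
      A `&` norm_closure I `<=` I].

Definition simple_algebra A : Prop :=
  forall I, closed_ideal A I -> I = [set 0] \/ I = A.

End Operators.

(* [A] is a *-algebra of operators on [l2 R T]; only the values of [pi] on [A]
   matter. *)
Definition star_representation (R : realType) (T U : choiceType)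
    (A : set (l2 R T -> l2 R T))
    (pi : (l2 R T -> l2 R T) -> (l2 R U -> l2 R U)) : Prop :=
  [/\ forall f, A f -> bounded_operator (pi f),
      forall f g, A f -> A g -> pi (f + g) = pi f + pi g,
      forall (a : R[i]) f, A f -> pi (a *: f) = a *: pi f,
      forall f g, A f -> A g -> pi (f \o g) = pi f \o pi g &
      forall f g, A f -> is_adjoint f g -> is_adjoint (pi f) (pi g)].

Section CrossedProduct.
Variables (R : realType) (Gamma : groupType) (X : compact_gamma_space Gamma).
Local Notation C := R[i].
Local Notation K := (l2 R (Gamma * X)%type).

Lemma cross_fun_subproof (f : Cfun R X) (xi : K) :
  (fun p => f (cgs_act X p.1 p.2) * xi p) \in @sq_summable R (Gamma * X)%type.
Proof.
have [M M0 fM] := cfun_bounded (@cgs_compact _ X) f.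
apply: (@sq_summable_dom _ _ xi _ (sqnorm M)); last exact: l2_summable.
move=> p; rewrite sqnormM ler_wpM2r ?sqnorm_ge0 // -lecR !sqnormE.
by rewrite lerXn2r ?nnegrE // (ger0_norm M0).
Qed.

Lemma cross_shift_subproof (s : Gamma) (xi : K) :
  (fun p => xi (s^-1 * p.1, p.2)%g) \in @sq_summable R (Gamma * X)%type.
Proof.
have /asboolP := l2_summable xi; rewrite /sqsum => xiP; apply/asboolP.
rewrite /sqsum; move: xiP.
rewrite (reindex_esum [set: Gamma * X]%type [set: Gamma * X]%type
   (fun p => (s^-1 * p.1, p.2)%g)) //.
split=> // [[a y] [b z] _ _ /= [/mulgI -> ->]//|[a y] _].
by exists (s * a, y)%g => //=; rewrite mulKg.
Qed.

(* The reduced crossed product is realized on [l2(Gamma x X)], the regular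
   representation induced by the faithful representation of [C(X)] on [l2(X)]
   by multiplication:
     f delta_(t, y) = f(t y) delta_(t, y),
     lambda_s delta_(t, y) = delta_(s t, y). *)
Definition cross_fun (f : Cfun R X) (xi : K) : K := L2 (cross_fun_subproof f xi).

Definition cross_shift (s : Gamma) (xi : K) : K := L2 (cross_shift_subproof s xi).

Definition reduced_crossed_product : set (K -> K) :=
  cstar_generated (range cross_fun `|` range cross_shift).

Definition reduced_group_algebra : set (K -> K) :=
  cstar_generated (range cross_shift).

Definition cgs_orbit (x : X) : set X := range (fun t => cgs_act X t x).

Lemma orbit_act_subproof (x : X) (t : Gamma) (y : cgs_orbit x) :
  cgs_act X t (\val y) \in cgs_orbit x.
Proof.
have /set_mem[s _ sy] := valP y.
by apply/mem_set; exists (t * s)%g => //; rewrite cgs_actM sy.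
Qed.

Definition orbit_act (x : X) (t : Gamma) (y : cgs_orbit x) : cgs_orbit x :=
  SigSub (orbit_act_subproof t y).

Definition is_orbit_representation (x : X)
    (pi : (K -> K) -> (l2 R (cgs_orbit x) -> l2 R (cgs_orbit x))) : Prop :=
  [/\ star_representation reduced_crossed_product pi,
      forall (f : Cfun R X) (y : cgs_orbit x),
        pi (cross_fun f) (l2_delta R y) = f (\val y) *: l2_delta R y &
      forall (t : Gamma) (y : cgs_orbit x),
        pi (cross_shift t) (l2_delta R y) = l2_delta R (orbit_act t y)].

End CrossedProduct.

Arguments reduced_group_algebra R {Gamma} X.
Arguments reduced_crossed_product R {Gamma} X.
Arguments is_orbit_representation {R Gamma X} x pi.

(* Main.v *)
Require Import Defs.
From HB Require Import structures.
From mathcomp Require Import all_boot all_order all_algebra.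
From mathcomp Require Import finmap.
From mathcomp Require Import all_classical all_reals.
From mathcomp Require Import ereal topology normedtype sequences esum ring lra.
From mathcomp Require Import complex.
From mathcomp.analysis.showcase Require summability.

(** Let [I] be a closed ideal of the algebra [A], the image of the reduced group
    algebra on the square-summable functions on the orbit of [x], and suppose
    that [I] does not contain the identity. Let [J] be the set of the elements
    of [I] whose adjoint lies in [I] too. The operators [c + b], with [c] a
    scalar and [b] in [J], form an operator system stable under conjugation by
    the group, and [c + b |-> c] is a Gamma-morphism on it: were [c + b] positive
    and [c] not, a multiple of [b] would be coercive and a Neumann series would
    put the identity in [I] ([ideal_coercive], [coef_morphism]). As [C(X)] is
    Gamma-injective, this map extends to a Gamma-morphism [Phi] from all bounded
    operators to [C(X)], and [Phi] vanishes on [J] ([ideal_annihilator]).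

    By rigidity, [Phi] sends the operator of multiplication by [f] in [C(X)] to
    [f]. Hence, by the Cauchy-Schwarz inequality, the state [v |-> Phi v y] does
    not change when [v] is multiplied on either side by a continuous function
    equal to 1 at [y]. Applied to the translation operator of [t], this gives 0
    if [t] moves [y] ([at_point_shift_moved]), and 1 if [t] fixes a neighbourhood
    of [y] ([at_point_shift_fixed]). No other case occurs, because the fixed
    points of [t] in [X] form an open set ([fixed_open]). Indeed, injectivity also
    gives a Gamma-morphism from the bounded operators on the square-summable
    functions on [X] back to [C(X)]; it sends the projection attached to an open
    set to the indicator function of the closure of this set, so that closures
    of open sets are open ([closure_open]), and Frolik's theorem applies
    ([fixed_points_open]).

    So [v |-> Phi v y] and the vector state of the basis vector at [y] take the
    same values on translation operators. Composed with the representation,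
    both are positive functionals on the reduced group algebra. Positive
    functionals on a C*-algebra are bounded ([positive_functional_bounded]): if
    [b] is self-adjoint and small, [1 - b] is the square of a self-adjoint
    element, found as a norm limit ([cstar_sqrt]). Therefore both states agree on
    [A] ([image_state]). For [a] in [I], the operator [a^* a] lies in [J], so the
    squared norm of [a] at every basis vector is a value of [Phi (a^* a) = 0],
    and [a = 0]. *)

Set Implicit Arguments.
Unset Strict Implicit.
Unset Printing Implicit Defensive.
Import Order.TTheory GRing.Theory Num.Theory.
Import numFieldNormedType.Exports.

Local Open Scope classical_set_scope.
Local Open Scope ring_scope.

#[local] Existing Instance summability.totally_filter.

(** * Scalar products of square-summable functions *)

(** The modulus of a complex number as an element of [R], for estimates mixing
    it with [l2_norm]. *)
Definition abs_re (R : realType) (z : R[i]) : R := complex.Re `|z|.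

Arguments abs_re : simpl never.

Lemma abs_reE (R : realType) (z : R[i]) : (abs_re z)%:C%C = `|z|.
Proof. by rewrite /abs_re RRe_real// ger0_real. Qed.

Lemma abs_re_ge0 (R : realType) (z : R[i]) : 0 <= abs_re z.
Proof. by rewrite -lecR abs_reE; exact: normr_ge0. Qed.

Lemma abs_re_real (R : realType) (r : R) : 0 <= r -> abs_re r%:C%C = r.
Proof.
move=> r0; apply: (@complexI R); rewrite abs_reE ger0_norm// lecR.
by [].
Qed.

Section SquareSums.
Variables (R : realType) (T : choiceType).
Local Notation C := R[i].
Local Notation H := (l2 R T).
Implicit Types (xi eta : H) (A B : {fset T}).

Definition nsq xi : R := fine (sqsum xi).

Lemma sqsum_fin xi : sqsum xi \is a fin_num.
Proof.
have /asboolP h := l2_summable xi; rewrite ge0_fin_numE//.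
by apply: esum_ge0 => i _; rewrite lee_fin sqnorm_ge0.
Qed.

Lemma sqsumE xi : sqsum xi = (nsq xi)%:E.
Proof. by rewrite /nsq fineK ?sqsum_fin. Qed.

Lemma fsbig_fset (a : T -> R) (A : {fset T}) :
  (\sum_(i \in [set` A]) (a i)%:E)%E = (\sum_(i <- A) a i)%:E.
Proof. by rewrite fsbig_finite ?set_fsetK -?sumEFin//; exact: finite_fset. Qed.

Lemma esum_le (a : T -> R) (c : R) :
  (forall A, \sum_(i <- A) a i <= c) ->
  (\esum_(i in [set: T]) (a i)%:E <= c%:E)%E.
Proof.
move=> h; apply: ge_ereal_sup => /= _ [X [finX _] <-].
by rewrite -(fset_setK finX) fsbig_fset lee_fin.
Qed.

Lemma nsq_partial xi A : \sum_(i <- A) sqnorm (xi i) <= nsq xi.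
Proof.
rewrite -lee_fin -sqsumE; apply: esum_ge; exists [set` A].
  by split=> //; exact: finite_fset.
by rewrite fsbig_fset.
Qed.

Lemma nsq_approx xi (e : R) : 0 < e -> exists A, forall B, (A `<=` B)%fset ->
  nsq xi - e < \sum_(i <- B) sqnorm (xi i).
Proof.
move=> e0; have : ((nsq xi - e)%:E < sqsum xi)%E.
  by rewrite sqsumE lte_fin ltrBlDr ltrDl.
move=> /ereal_sup_gt[_ [X [finX _]] <-].
rewrite -(fset_setK finX) fsbig_fset lte_fin => h; exists (fset_set X) => B AB.
apply: lt_le_trans h _; rewrite (big_fsetID _ (mem (fset_set X)) B)/=.
have -> : [fset x | x in B & x \in fset_set X]%fset = fset_set X.
  apply/fsetP => x; rewrite !inE/=; apply/andP/idP => [[]//|xA].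
  by split=> //; move/fsubsetP: AB; apply.
by rewrite lerDl sumr_ge0// => i _; exact: sqnorm_ge0.
Qed.

Lemma nsq_le xi (c : R) : (forall A, \sum_(i <- A) sqnorm (xi i) <= c) ->
  nsq xi <= c.
Proof. by move=> h; rewrite -lee_fin -sqsumE; exact: esum_le. Qed.

Lemma sq_summable_le (f : T -> C) (c : R) :
  (forall A, \sum_(i <- A) sqnorm (f i) <= c) -> f \in @sq_summable R T.
Proof. by move=> h; apply/asboolP; apply: le_lt_trans (esum_le h) _;
  rewrite ltry. Qed.

Lemma nsq_ge0 xi : 0 <= nsq xi.
Proof. by have := nsq_partial xi fset0; rewrite big_seq_fset0. Qed.

Lemma l2_norm_ge0 xi : 0 <= l2_norm xi. Proof. exact: sqrtr_ge0. Qed.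

Lemma l2_norm_sq xi : l2_norm xi ^+ 2 = nsq xi.
Proof. by rewrite sqr_sqrtr// nsq_ge0. Qed.

Lemma coord_nsq xi i : sqnorm (xi i) <= nsq xi.
Proof. by have := nsq_partial xi [fset i]%fset; rewrite big_seq_fset1. Qed.

Lemma sqnorm_eq0 (z : C) : sqnorm z = 0 -> z = 0.
Proof.
move=> z0; apply/eqP; rewrite -normr_eq0 -sqrf_eq0.
by rewrite -sqnormE z0.
Qed.

Lemma nsq_eq0 xi : nsq xi = 0 -> xi = 0.
Proof.
move=> n0; apply/val_inj/funext => i; apply: sqnorm_eq0.
by apply/eqP; rewrite eq_le sqnorm_ge0 -n0 coord_nsq.
Qed.

Lemma partial_sumE (V : zmodType) (u : T -> V) A :
  summability.partial_sum u A = \sum_(i <- A) u i.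
Proof. by rewrite /summability.partial_sum big_seq_fsetE. Qed.

Lemma nsq_cvg xi :
  summability.partial_sum (fun i => xi i * (xi i)^* : (C^o : normedModType C))
    @ summability.totally --> ((nsq xi)%:C%C : (C^o : normedModType C)).
Proof.
apply/(@cvgrPdist_lt _ C^o) => e e0.
have eE : e = (complex.Re e)%:C%C by rewrite RRe_real// ger0_real// ltW.
have e0' : 0 < complex.Re e by rewrite -ltcR -eE.
have [A hA] := nsq_approx xi e0'.
exists A => // B /= AB; rewrite partial_sumE.
under eq_bigr do rewrite -normCK -sqnormE.
rewrite -rmorph_sum -rmorphB/= normc_def/= expr0n/= addr0 sqrtr_sqr eE ltcR.
rewrite ger0_norm ?subr_ge0 ?nsq_partial//.
by rewrite ltrBlDr -ltrBlDl hA.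
Qed.

(** Reduces the convergence of the series of a scalar product to that of four
    series of squares, whose partial sums are monotone. *)
Lemma polarization (a b : C) :
  a * b^* = 4^-1 * (((a + b) * (a + b)^* - (a - b) * (a - b)^*)
      + 'i * ((a + 'i * b) * (a + 'i * b)^* - (a - 'i * b) * (a - 'i * b)^*)).
Proof.
apply: (mulfI (_ : 4 != 0 :> C)); first by rewrite pnatr_eq0.
rewrite mulVKf ?pnatr_eq0//.
have ii : 'i * 'i = -1 :> C by rewrite -expr2 sqrCi.
rewrite !(rmorphD, rmorphB, rmorphM, rmorphN)/= conjCi.
set x := a^*; set y := b^*; move: x y => x y.
have -> : 4 * (a * y) = 2 * (a * y) - ('i * 'i) * (2 * (a * y)) +
  (2 * (b * x) + ('i * 'i) * (2 * (b * x))).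
  by rewrite ii; ring.
by ring.
Qed.

Lemma l2DE xi eta i : (xi + eta) i = xi i + eta i. Proof. by []. Qed.
Lemma l2BE xi eta i : (xi - eta) i = xi i - eta i. Proof. by []. Qed.
Lemma l2ZE (a : C) xi i : (a *: xi) i = a * xi i. Proof. by []. Qed.
Lemma l2P xi eta : (forall i, xi i = eta i) -> xi = eta.
Proof. by move=> h; apply/val_inj/funext. Qed.

Local Notation partial_prod xi eta :=
  (summability.partial_sum (fun i => xi i * (eta i)^* : (C^o : normedModType C))).

Lemma inner_cvg xi eta :
  partial_prod xi eta @ summability.totally
    --> (l2_inner xi eta : (C^o : normedModType C)).
Proof.
suff [l hl] : exists l : C^o, partial_prod xi eta @ summability.totally --> l.
  rewrite (_ : l2_inner xi eta = l)//; apply: (@cvg_lim C^o); last exact: hl.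
  exact: norm_hausdorff.
pose s (v : H) := partial_prod v v.
have -> : partial_prod xi eta = (fun A => (4^-1 : C) *:
  ((s (xi + eta) A - s (xi - eta) A)
   + ('i : C) *: (s (xi + 'i *: eta) A - s (xi - 'i *: eta) A))).
  apply/funext => A; rewrite /s !partial_sumE -!sumrB scaler_sumr -big_split/=
    scaler_sumr.
  by apply: eq_bigr => i _; rewrite polarization.
eexists; apply: cvgZr; apply: cvgD; first by apply: cvgB; exact: nsq_cvg.
by apply: cvgZr; apply: cvgB; exact: nsq_cvg.
Qed.

Lemma cvg_inner xi eta (l : C) :
  partial_prod xi eta @ summability.totally --> (l : (C^o : normedModType C)) ->
  l2_inner xi eta = l.
Proof. by move=> h; apply: (@cvg_lim C^o) => //; exact: norm_hausdorff. Qed.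

Lemma inner_nsq xi : l2_inner xi xi = (nsq xi)%:C%C.
Proof. by apply: cvg_inner; exact: nsq_cvg. Qed.

Lemma innerDl xi xi' eta :
  l2_inner (xi + xi') eta = l2_inner xi eta + l2_inner xi' eta.
Proof.
apply: cvg_inner; rewrite (_ : partial_prod _ _ =
  (fun A => partial_prod xi eta A + partial_prod xi' eta A)).
  by apply: cvgD; exact: inner_cvg.
apply/funext => A; rewrite !partial_sumE -big_split/=.
by apply: eq_bigr => i _; rewrite mulrDl.
Qed.

Lemma innerZl (a : C) xi eta : l2_inner (a *: xi) eta = a * l2_inner xi eta.
Proof.
apply: cvg_inner; rewrite (_ : partial_prod _ _ =
  (fun A => a *: partial_prod xi eta A)).
  by apply: cvgZr; exact: inner_cvg.
apply/funext => A; rewrite !partial_sumE scaler_sumr.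
by apply: eq_bigr => i _; rewrite l2ZE -mulrA.
Qed.

Lemma inner_conj xi eta : (l2_inner xi eta)^* = l2_inner eta xi.
Proof.
apply/esym/cvg_inner.
have /(@cvgrPdist_lt _ C^o) h := @inner_cvg xi eta.
apply/(@cvgrPdist_lt _ C^o) => e e0; apply: filterS (h _ e0) => A.
rewrite !partial_sumE -norm_conjC rmorphB rmorph_sum.
rewrite (eq_bigr (fun i => eta i * (xi i)^*))// => i _.
by rewrite rmorphM/= conjCK mulrC.
Qed.

Lemma innerDr xi eta eta' :
  l2_inner xi (eta + eta') = l2_inner xi eta + l2_inner xi eta'.
Proof. by rewrite -inner_conj innerDl rmorphD/= !inner_conj. Qed.

Lemma innerZr (a : C) xi eta : l2_inner xi (a *: eta) = a^* * l2_inner xi eta.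
Proof. by rewrite -inner_conj innerZl rmorphM/= inner_conj. Qed.

Lemma innerNl xi eta : l2_inner (- xi) eta = - l2_inner xi eta.
Proof. by rewrite -scaleN1r innerZl mulN1r. Qed.
Lemma innerNr xi eta : l2_inner xi (- eta) = - l2_inner xi eta.
Proof. by rewrite -scaleN1r innerZr rmorphN1 mulN1r. Qed.
Lemma innerBl xi xi' eta :
  l2_inner (xi - xi') eta = l2_inner xi eta - l2_inner xi' eta.
Proof. by rewrite innerDl innerNl. Qed.
Lemma innerBr xi eta eta' :
  l2_inner xi (eta - eta') = l2_inner xi eta - l2_inner xi eta'.
Proof. by rewrite innerDr innerNr. Qed.
Lemma inner0l eta : l2_inner 0 eta = 0.
Proof. by rewrite -(scale0r (0 : H)) innerZl mul0r. Qed.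
Lemma inner0r xi : l2_inner xi 0 = 0.
Proof. by rewrite -inner_conj inner0l rmorph0. Qed.

Lemma inner_suml (I : Type) (r : seq I) (P : pred I) (F : I -> H) eta :
  l2_inner (\sum_(k <- r | P k) F k) eta = \sum_(k <- r | P k) l2_inner (F k) eta.
Proof. by apply: (big_morph (fun v => l2_inner v eta)) => [u v|];
  [exact: innerDl|exact: inner0l]. Qed.
Lemma inner_sumr (I : Type) (r : seq I) (P : pred I) (F : I -> H) xi :
  l2_inner xi (\sum_(k <- r | P k) F k) = \sum_(k <- r | P k) l2_inner xi (F k).
Proof. by apply: (big_morph (fun v => l2_inner xi v)) => [u v|];
  [exact: innerDr|exact: inner0r]. Qed.

Lemma inner_ge0 xi : 0 <= l2_inner xi xi.
Proof. by rewrite inner_nsq lecR nsq_ge0. Qed.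

Lemma inner_eq0 xi : l2_inner xi xi = 0 -> xi = 0.
Proof. by rewrite inner_nsq => /(@complexI R) /nsq_eq0. Qed.

Lemma inner_inj xi eta : (forall z, l2_inner xi z = l2_inner eta z) -> xi = eta.
Proof.
by move=> h; apply/eqP; rewrite -subr_eq0; apply/eqP/inner_eq0;
  rewrite innerBl h subrr.
Qed.

Lemma inner_delta xi j : l2_inner xi (l2_delta R j) = xi j.
Proof.
apply: cvg_inner; apply/(@cvgrPdist_lt _ C^o) => e e0.
exists [fset j]%fset => // A /= /fsubsetP /(_ j); rewrite inE eqxx => /(_ isT) jA.
rewrite partial_sumE (big_fsetD1 j)//= eqxx conjC1 mulr1 big1_seq ?addr0 ?subrr
  ?normr0//.
by move=> i; rewrite !inE => /andP[_ /andP[/negPf -> _]]; rewrite conjC0 mulr0.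
Qed.

Lemma cauchy_schwarz xi eta :
  `|l2_inner xi eta| <= (l2_norm xi * l2_norm eta)%:C%C.
Proof.
have [e0|e0] := eqVneq (nsq eta) 0.
  by rewrite (nsq_eq0 e0) inner0r normr0 lecR mulr_ge0 ?l2_norm_ge0.
have ep : 0 < nsq eta by rewrite lt_neqAle eq_sym e0 nsq_ge0.
set w := l2_inner xi eta.
have : 0 <= (nsq eta)%:C%C * l2_inner (xi - (w / (nsq eta)%:C%C) *: eta)
  (xi - (w / (nsq eta)%:C%C) *: eta).
  by rewrite mulr_ge0 ?inner_ge0// lecR nsq_ge0.
rewrite innerBl !innerBr !innerZl !innerZr -/w -[l2_inner eta xi]inner_conj -/w
  !inner_nsq.
have n0 : (nsq eta)%:C%C != 0 :> C by rewrite (inj_eq (@complexI R)).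
have nc : ((nsq eta)%:C%C : C)^* = (nsq eta)%:C%C by apply/CrealP/ger0_real;
  rewrite lecR nsq_ge0.
rewrite rmorphM fmorphV/= nc.
have -> : (nsq eta)%:C%C * ((nsq xi)%:C%C - w^* / (nsq eta)%:C%C * w -
  (w / (nsq eta)%:C%C * w^* - w / (nsq eta)%:C%C *
    (w^* / (nsq eta)%:C%C * (nsq eta)%:C%C)))
  = (nsq xi * nsq eta)%:C%C - w * w^* :> C.
  by rewrite [in RHS]rmorphM/=; field.
rewrite subr_ge0 -normCK => h.
rewrite -(@ler_pXn2r _ 2) ?nnegrE ?normr_ge0//;
  last by rewrite lecR mulr_ge0 ?l2_norm_ge0.
by rewrite -[leRHS]rmorphXn exprMn !l2_norm_sq.
Qed.

Lemma l2_normE xi : ((l2_norm xi)%:C%C : C) ^+ 2 = l2_inner xi xi.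
Proof. by rewrite -rmorphXn/= l2_norm_sq inner_nsq. Qed.

Lemma l2_normD xi eta : l2_norm (xi + eta) <= l2_norm xi + l2_norm eta.
Proof.
rewrite -(@ler_pXn2r _ 2)// ?nnegrE ?addr_ge0 ?l2_norm_ge0//.
rewrite -lecR !rmorphXn rmorphD/= l2_normE innerDl !innerDr.
have := cauchy_schwarz xi eta; have := cauchy_schwarz eta xi.
rewrite sqrrD !l2_normE !rmorphM/= => h1 h2.
have r : l2_inner xi eta + l2_inner eta xi \is Num.real.
  by rewrite -[l2_inner eta xi]inner_conj; apply/CrealP;
    rewrite rmorphD/= conjCK addrC.
have h : l2_inner xi eta + l2_inner eta xi
  <= (l2_norm xi)%:C%C * (l2_norm eta)%:C%C *+ 2.
  apply: le_trans (real_ler_norm r) _; apply: le_trans (ler_normD _ _) _.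
  by rewrite mulr2n; apply: lerD => //; rewrite [leRHS]mulrC.
by rewrite -!addrA lerD2l !addrA lerD2r.
Qed.

Lemma l2_normZ (a : C) xi : ((l2_norm (a *: xi))%:C%C : C)
  = `|a| * (l2_norm xi)%:C%C.
Proof.
apply/eqP; rewrite -(@eqrXn2 _ 2) ?mulr_ge0 ?normr_ge0 ?lecR ?l2_norm_ge0//.
by rewrite exprMn !l2_normE innerZl innerZr mulrA normCK.
Qed.

Lemma l2_normN xi : l2_norm (- xi) = l2_norm xi.
Proof. by apply: (@complexI R); rewrite -scaleN1r l2_normZ normrN1 mul1r. Qed.

Lemma l2_norm0 : l2_norm (0 : H) = 0.
Proof. by apply: (@complexI R); rewrite -(scale0r (0 : H)) l2_normZ normr0
  mul0r. Qed.

Lemma l2_norm_eq0 xi : l2_norm xi = 0 -> xi = 0.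
Proof. by move=> h; apply: nsq_eq0; rewrite -l2_norm_sq h expr0n. Qed.

Lemma coord_norm xi i : `|xi i| <= (l2_norm xi)%:C%C.
Proof.
rewrite -(@ler_pXn2r _ 2) ?nnegrE ?normr_ge0//; last by rewrite lecR l2_norm_ge0.
by rewrite -sqnormE -[leRHS]rmorphXn l2_norm_sq lecR coord_nsq.
Qed.
End SquareSums.

(** * Bounded operators and their adjoints *)

Section LinearMaps.
Variables (R : realType) (U V : lmodType R[i]) (f : U -> V).
Hypothesis lf : linear f.
Lemma linD u v : f (u + v) = f u + f v.
Proof. by have := lf 1 u v; rewrite !scale1r. Qed.
Lemma lin0 : f 0 = 0.
Proof. by apply: (addrI (f 0)); rewrite -linD !addr0. Qed.
Lemma linZ a u : f (a *: u) = a *: f u.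
Proof. by have := lf a u 0; rewrite lin0 !addr0. Qed.
Lemma linN u : f (- u) = - f u.
Proof. by rewrite -scaleN1r linZ scaleN1r. Qed.
Lemma linB u v : f (u - v) = f u - f v.
Proof. by rewrite linD linN. Qed.
Lemma lin_sum (I : Type) (r : seq I) (P : pred I) (F : I -> U) :
  f (\sum_(k <- r | P k) F k) = \sum_(k <- r | P k) f (F k).
Proof. by apply: (big_morph f) => [u v|]; [exact: linD|exact: lin0]. Qed.
End LinearMaps.

Section BoundedOperators.
Variables (R : realType) (T : choiceType).
Local Notation C := R[i].
Local Notation H := (l2 R T).
Implicit Types (xi eta : H) (A B : {fset T}) (f g : H -> H).

Definition truncation (u : T -> C) A : H := \sum_(i <- A) u i *: l2_delta R i.

Lemma truncationE u A j : truncation u A j = if j \in A then u j else 0.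
Proof.
rewrite -inner_delta inner_suml.
rewrite (eq_bigr (fun i => if i == j then u i else 0)); last first.
  move=> i _; rewrite innerZl inner_delta/= eq_sym; case: eqP => _;
    first by rewrite mulr1.
  by rewrite mulr0.
case: ifPn => jA.
  rewrite (big_fsetD1 j)//= eqxx big1_seq ?addr0// => i /=.
  by rewrite !inE => /andP[/negPf ->].
by rewrite big1_seq// => i /= iA; case: eqP => // ij; rewrite -ij iA in jA.
Qed.

Lemma inner_truncation xi u A :
  l2_inner xi (truncation u A) = \sum_(i <- A) xi i * (u i)^*.
Proof.
rewrite inner_sumr; apply: eq_bigr => i _.
by rewrite innerZr inner_delta mulrC.
Qed.

Lemma nsq_truncation u A : nsq (truncation u A) = \sum_(i <- A) sqnorm (u i).
Proof.
apply: (@complexI R); rewrite -inner_nsq inner_truncation rmorph_sum/=.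
rewrite big_seq [RHS]big_seq; apply: eq_bigr => i iA.
by rewrite truncationE iA -normCK sqnormE.
Qed.

Lemma nsq_sub_truncation xi A :
  nsq (xi - truncation xi A) = nsq xi - \sum_(i <- A) sqnorm (xi i).
Proof.
apply: (@complexI R); rewrite -inner_nsq innerBl !innerBr.
rewrite -[l2_inner (truncation xi A) xi]inner_conj !inner_nsq nsq_truncation.
rewrite inner_truncation.
rewrite (eq_bigr (fun i => (sqnorm (xi i))%:C%C)) => [|i _]; last first.
  by rewrite sqnormE -normCK.
rewrite -rmorph_sum/= -rmorphB/=.
set s := \sum_(i <- A) _.
have -> : ((s%:C%C : C)^*)%R = s%:C%C.
  by apply/CrealP/ger0_real; rewrite lecR sumr_ge0// => i _; exact: sqnorm_ge0.
by rewrite subrr subr0 rmorphB.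
Qed.

Definition norm_le f (M : R) : Prop := forall xi, l2_norm (f xi)
  <= M * l2_norm xi.

Lemma norm_le_trans f M N : M <= N -> norm_le f M -> norm_le f N.
Proof.
move=> MN fM xi; apply: le_trans (fM xi) _.
by rewrite ler_wpM2r ?l2_norm_ge0.
Qed.

Lemma bounded_norm_le f : bounded_operator f -> exists2 M, 0 <= M & norm_le f M.
Proof.
move=> [_ [M fM]]; exists (Num.max 0 M); first by rewrite le_max lexx.
by apply: norm_le_trans fM; rewrite le_max lexx orbT.
Qed.

Lemma norm_le_bounded f M : linear f -> norm_le f M -> bounded_operator f.
Proof. by move=> lf fM; split=> //; exists M. Qed.

Lemma norm_le_id : norm_le id 1. Proof. by move=> xi; rewrite mul1r. Qed.

Lemma norm_le0 : norm_le 0 0. Proof. by move=> xi; rewrite l2_norm0 mul0r. Qed.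

Lemma norm_leD f g M N : norm_le f M -> norm_le g N -> norm_le (f + g) (M + N).
Proof.
move=> fM gN xi; apply: le_trans (l2_normD _ _) _.
by rewrite mulrDl lerD.
Qed.

Lemma norm_leZ (a : C) f M : norm_le f M -> norm_le (a *: f) (abs_re a * M).
Proof.
move=> fM xi; rewrite -lecR l2_normZ -mulrA rmorphM/= abs_reE.
by rewrite ler_wpM2l// lecR.
Qed.

Lemma norm_le_comp f g M N : 0 <= M -> norm_le f M -> norm_le g N ->
  norm_le (f \o g) (M * N).
Proof.
move=> M0 fM gN xi; apply: le_trans (fM _) _.
by rewrite -mulrA ler_wpM2l.
Qed.

Lemma bounded_id : bounded_operator (id : H -> H).
Proof. by apply: norm_le_bounded norm_le_id. Qed.

Lemma bounded0 : bounded_operator (0 : H -> H).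
Proof.
apply: norm_le_bounded norm_le0; move=> a u v /=.
by rewrite scaler0 addr0.
Qed.

Lemma boundedD f g : bounded_operator f -> bounded_operator g ->
  bounded_operator (f + g).
Proof.
move=> [lf [M fM]] [lg [N gN]]; apply: (@norm_le_bounded _ (M + N)).
  by move=> a u v; rewrite !fctE lf lg scalerDr addrACA.
exact: norm_leD.
Qed.

Lemma boundedZ a f : bounded_operator f -> bounded_operator (a *: f).
Proof.
move=> [lf [M fM]]; apply: norm_le_bounded (norm_leZ a fM).
by move=> b u v; rewrite !fctE lf scalerDr !scalerA mulrC.
Qed.

Lemma bounded_comp f g : bounded_operator f -> bounded_operator g ->
  bounded_operator (f \o g).
Proof.
move=> bf; have [M M0 fM] := bounded_norm_le bf; case: bf => lf _ [lg [N gN]].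
apply: norm_le_bounded (norm_le_comp M0 fM gN).
by move=> a u v; rewrite /= lg lf.
Qed.

Lemma adjoint_sym f g : is_adjoint f g -> is_adjoint g f.
Proof. by move=> fg xi eta; rewrite -inner_conj -fg inner_conj. Qed.

Lemma adjoint_uniq f g g' : is_adjoint f g -> is_adjoint f g' -> g = g'.
Proof.
move=> fg fg'; apply/funext => eta; apply: inner_inj => z.
by rewrite -[LHS]inner_conj -fg fg' inner_conj.
Qed.

Lemma adjoint_linear f g : is_adjoint f g -> linear g.
Proof.
move=> fg a u v; apply: inner_inj => z.
rewrite innerDl innerZl -[LHS]inner_conj -fg innerDr innerZr rmorphD rmorphM/=.
by rewrite conjCK !fg !inner_conj.
Qed.

Lemma adjoint_norm_le f g M : 0 <= M -> norm_le f M -> is_adjoint f g ->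
  norm_le g M.
Proof.
move=> M0 fM fg eta; have [g0|g0] := eqVneq (l2_norm (g eta)) 0.
  by rewrite g0 mulr_ge0 ?l2_norm_ge0.
have gp : 0 < l2_norm (g eta) by rewrite lt_neqAle eq_sym g0 l2_norm_ge0.
rewrite -(ler_pM2l gp) -lecR.
have := cauchy_schwarz (f (g eta)) eta.
rewrite fg -l2_normE -rmorphXn/= -abs_reE abs_re_real ?sqr_ge0// lecR -expr2
  lecR => h.
apply: le_trans h _.
by rewrite mulrCA mulrA ler_wpM2r ?l2_norm_ge0.
Qed.

Lemma adjoint_bounded f g : bounded_operator f -> is_adjoint f g ->
  bounded_operator g.
Proof.
move=> /bounded_norm_le[M M0 fM] fg.
exact: norm_le_bounded (adjoint_linear fg) (adjoint_norm_le M0 fM fg).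
Qed.

Lemma adjointD f g f' g' : is_adjoint f f' -> is_adjoint g g' ->
  is_adjoint (f + g) (f' + g').
Proof. by move=> ff gg xi eta; rewrite innerDl innerDr ff gg. Qed.

Lemma adjointZ a f f' : is_adjoint f f' -> is_adjoint (a *: f) (a^* *: f').
Proof. by move=> ff xi eta; rewrite innerZl innerZr ff conjCK. Qed.

Lemma adjointN f f' : is_adjoint f f' -> is_adjoint (- f) (- f').
Proof. by move=> ff xi eta; rewrite innerNl innerNr ff. Qed.

Lemma adjoint_comp f g f' g' : is_adjoint f f' -> is_adjoint g g' ->
  is_adjoint (f \o g) (g' \o f').
Proof. by move=> ff gg xi eta; rewrite /= ff gg. Qed.

Lemma adjoint_id : is_adjoint (id : H -> H) id. Proof. by []. Qed.

Lemma adjoint0 : is_adjoint (0 : H -> H) 0.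
Proof. by move=> xi eta; rewrite inner0l inner0r. Qed.

(** The coordinates of the adjoint at [eta] can only be the scalar products of
    [eta] with the images of the basis vectors. Testing [f] on the truncations of
    this family bounds its partial sums of squares. *)
Lemma adjoint_exists f : bounded_operator f -> exists g, is_adjoint f g.
Proof.
move=> bf; have [M M0 fM] := bounded_norm_le bf; have [lf _] := bf.
suff /choice[g hg] eta : exists u : H, forall xi,
    l2_inner (f xi) eta = l2_inner xi u by exists g => xi eta; exact: hg.
pose u i : C := l2_inner eta (f (l2_delta R i)).
have fu (v : T -> C) A : l2_inner (f (truncation v A)) eta
  = \sum_(i <- A) v i * (u i)^*.
  rewrite lin_sum// inner_suml; apply: eq_bigr => i _.
  by rewrite linZ// innerZl inner_conj.
have us : u \in @sq_summable R T.
  apply: (@sq_summable_le _ _ _ ((M * l2_norm eta) ^+ 2)) => A.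
  set s := \sum_(i <- A) _.
  have s0 : 0 <= s by apply: sumr_ge0 => i _; exact: sqnorm_ge0.
  have : `|l2_inner (f (truncation u A)) eta|
    <= (M * Num.sqrt s * l2_norm eta)%:C%C.
    apply: le_trans (cauchy_schwarz _ _) _; rewrite lecR.
    rewrite ler_wpM2r ?l2_norm_ge0//; apply: le_trans (fM _) _.
    by rewrite /l2_norm -/(nsq _) nsq_truncation.
  rewrite fu (eq_bigr (fun i => (sqnorm (u i))%:C%C)); last first.
    by move=> i _; rewrite sqnormE -normCK.
  rewrite -rmorph_sum/= -/s -abs_reE abs_re_real// lecR.
  rewrite mulrAC -{1}(sqr_sqrtr s0) expr2 -{4}(sqr_sqrtr s0) => h.
  have [r0|r0] := eqVneq (Num.sqrt s) 0; first by rewrite r0 expr0n sqr_ge0.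
  have rp : 0 < Num.sqrt s by rewrite lt_neqAle eq_sym r0 sqrtr_ge0.
  rewrite ler_pXn2r ?nnegrE ?mulr_ge0 ?l2_norm_ge0 ?sqrtr_ge0//.
  by rewrite -(ler_pM2r rp).
exists (L2 us) => xi; apply/esym/cvg_inner; apply/(@cvgrPdist_lt _ C^o) => e e0.
have eE : e = (complex.Re e)%:C%C by rewrite RRe_real// ger0_real// ltW.
set d := complex.Re e; have d0 : 0 < d by rewrite -ltcR -eE.
pose N := M * l2_norm eta + 1.
have N0 : 0 < N by rewrite ltr_wpDl// mulr_ge0 ?l2_norm_ge0.
have [A hA] := @nsq_approx _ _ xi ((d / N) ^+ 2) (exprn_gt0 _ (divr_gt0 d0 N0)).
exists A => // B /= /hA; rewrite ltrBlDl -ltrBlDr -nsq_sub_truncation => hB.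
rewrite partial_sumE -fu -innerBl -linB//.
apply: le_lt_trans (cauchy_schwarz _ _) _; rewrite eE ltcR -/d.
apply: (@le_lt_trans _ _ (M * (d / N) * l2_norm eta)).
  rewrite ler_wpM2r ?l2_norm_ge0//; apply: le_trans (fM _) _.
  rewrite ler_wpM2l// ltW// -(@ltr_pXn2r _ 2) ?nnegrE ?l2_norm_ge0//.
    by rewrite l2_norm_sq.
  by rewrite ltW// divr_gt0.
have -> : M * (d / N) * l2_norm eta = d * (M * l2_norm eta / N) by ring.
by rewrite -[ltRHS]mulr1 ltr_pM2l// ltr_pdivrMr// mul1r ltrDl.
Qed.

(** The values on basis vectors are the coordinates of the adjoint, which in
    turn determines the operator. *)
Lemma bounded_delta f g : bounded_operator f -> bounded_operator g ->
  (forall j, f (l2_delta R j) = g (l2_delta R j)) -> f = g.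
Proof.
move=> bf bg fg; have [f' ff'] := adjoint_exists bf;
  have [g' gg'] := adjoint_exists bg.
have e : f' = g'.
  apply/funext => eta; apply/l2P => j; rewrite -!inner_delta.
  by rewrite -[LHS]inner_conj -[RHS]inner_conj -ff' -gg' fg.
by rewrite e in ff'; exact: adjoint_uniq (adjoint_sym ff') (adjoint_sym gg').
Qed.

Definition adj f : H -> H := xget 0 [set g | is_adjoint f g].

Lemma adjP f : bounded_operator f -> is_adjoint f (adj f).
Proof. by move=> /adjoint_exists h; exact: (xgetPex 0 h). Qed.

Lemma adjE f g : is_adjoint f g -> adj f = g.
Proof.
move=> fg; have h : exists g, is_adjoint f g by exists g.
exact: adjoint_uniq (xgetPex 0 h) fg.
Qed.

End BoundedOperators.

(** * Completeness *)

Section Completeness.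
Variables (R : realType) (T : choiceType).
Local Notation C := R[i].
Local Notation H := (l2 R T).

(** Used to discard error terms bounded by multiples of [2 ^- m]. *)
Lemma le_geometric (K x y : R) : (forall m, x <= K * 2 ^- m + y) -> x <= y.
Proof.
move=> h; rewrite leNgt; apply/negP => yx.
have d0 : 0 < x - y by rewrite subr_gt0.
have [K0|K0] := leP K 0.
  by have := h 0%N; rewrite expr0 invr1 mulr1; lra.
pose m := Num.bound (K / (x - y)).
have : K / (x - y) < 2 ^+ m.
  apply: lt_trans (archi_boundP _) _; first by rewrite divr_ge0// ltW.
  by rewrite -natrX ltr_nat ltn_expl.
rewrite ltr_pdivrMr// mulrC -ltr_pdivrMr ?exprn_gt0// => hm.
by have := h m; lra.
Qed.

Lemma real_geometric_limit (a : nat -> R) (c : R) :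
  (forall n, `|a n.+1 - a n| <= c * 2 ^- n) ->
  exists l, forall n, `|l - a n| <= 2 * c * 2 ^- n.
Proof.
(* [a - d] increases and [a + d] decreases, so the limit is a supremum. *)
move=> h; pose d n := 2 * c * 2 ^- n.
have dS n : d n = d n.+1 + c * 2 ^- n by rewrite /d exprS invfM; field;
  rewrite expf_neq0.
have d0 n : 0 <= d n.
  have := le_trans (normr_ge0 _) (h n) => h0.
  by rewrite /d -mulrA mulr_ge0.
have up m n : (m <= n)%N -> a m - d m <= a n - d n.
  elim: n => [|n IH]; first by rewrite leqn0 => /eqP ->.
  rewrite leq_eqVlt => /orP[/eqP -> //|]; rewrite ltnS => /IH /le_trans; apply.
  have := dS n; have := h n; rewrite ler_norml => /andP[] *; lra.
have dn m n : (m <= n)%N -> a n + d n <= a m + d m.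
  elim: n => [|n IH]; first by rewrite leqn0 => /eqP ->.
  rewrite leq_eqVlt => /orP[/eqP -> //|]; rewrite ltnS => /IH; apply: le_trans.
  by have := dS n; have := h n; rewrite ler_norml => /andP[] *; lra.
pose E := range (fun n => a n - d n).
have ub n : ubound E (a n + d n).
  move=> _ [m _ <-]; have [mn|/ltnW nm] := leqP m n.
    by apply: le_trans (up _ _ mn) _; have := d0 n; lra.
  by apply: le_trans (dn _ _ nm); have := d0 m; lra.
have E0 : E !=set0 by exists (a 0%N - d 0%N); exists 0%N.
exists (sup E) => n; rewrite -/(d n).
have h1 : a n - d n <= sup E.
  by apply: ub_le_sup; [exists (a 0%N + d 0%N); exact: ub|exists n].
have h2 : sup E <= a n + d n by apply: ge_sup.
by rewrite ler_norml; apply/andP; split; lra.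
Qed.

Lemma normc_ge_Im (z : C) : `|complex.Im z|%:C%C <= `|z|.
Proof.
by rewrite normc_def lecR -sqrtr_sqr ler_wsqrtr// lerDr sqr_ge0.
Qed.

Lemma complex_geometric_limit (a : nat -> C) (c : R) :
  (forall n, `|a n.+1 - a n| <= (c * 2 ^- n)%:C%C) ->
  exists l, forall n, `|l - a n| <= (4 * c * 2 ^- n)%:C%C.
Proof.
move=> h.
have [n|lr hr] := @real_geometric_limit (fun n => complex.Re (a n)) c.
  rewrite -lecR; apply: le_trans (h n).
  by rewrite -raddfB; exact: normc_ge_Re.
have [n|li hi] := @real_geometric_limit (fun n => complex.Im (a n)) c.
  rewrite -lecR; apply: le_trans (h n).
  by rewrite -raddfB; exact: normc_ge_Im.
exists (lr +i* li)%C => n.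
have -> : (lr +i* li)%C - a n = (lr - complex.Re (a n))%:C%C + 'i *
  (li - complex.Im (a n))%:C%C.
  by case: (a n) => x y; rewrite -complexiE; simpc.
apply: le_trans (ler_normD _ _) _; rewrite normrM normCi mul1r.
rewrite (_ : 4 * c = 2 * c + 2 * c); last by ring.
rewrite mulrDl [leRHS]rmorphD/=; apply: lerD; rewrite -abs_reE lecR /abs_re.
- by rewrite normc_def/= expr0n addr0 sqrtr_sqr.
- by rewrite normc_def/= expr0n addr0 sqrtr_sqr.
Qed.

Lemma l2_norm_sum (I : Type) (r : seq I) (F : I -> H) :
  l2_norm (\sum_(k <- r) F k) <= \sum_(k <- r) l2_norm (F k).
Proof.
elim/big_rec2: _ => [|k x y _ h]; first by rewrite l2_norm0.
by apply: le_trans (l2_normD _ _) _; rewrite lerD2l.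
Qed.

Lemma l2_norm_delta j : l2_norm (l2_delta R j : H) = 1.
Proof.
apply/eqP; rewrite -(@eqrXn2 _ 2)// ?l2_norm_ge0// l2_norm_sq; apply/eqP.
by apply: (@complexI R); rewrite -inner_nsq inner_delta /= eqxx expr1n.
Qed.

Lemma l2_norm_truncation (u : T -> C) (c : R) A : (forall i, `|u i| <= c%:C%C) ->
  l2_norm (truncation u A) <= (size A)%:R * c.
Proof.
move=> uc; apply: le_trans (l2_norm_sum _ _) _.
apply: (@le_trans _ _ (\sum_(i <- A) c)).
  apply: ler_sum => i _; rewrite -lecR l2_normZ l2_norm_delta mulr1.
  exact: uc.
by rewrite big_const_seq count_predT iter_addr_0 mulr_natl.
Qed.

Lemma l2_geometric (u : nat -> H) (c : R) :
  (forall n, l2_norm (u n.+1 - u n) <= c * 2 ^- n) ->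
  forall n m, (n <= m)%N -> l2_norm (u m - u n)
    <= 2 * c * 2 ^- n - 2 * c * 2 ^- m.
Proof.
move=> h n; elim=> [|m IH]; first by rewrite leqn0 => /eqP ->;
  rewrite !subrr l2_norm0.
rewrite leq_eqVlt => /orP[/eqP <-|]; first by rewrite !subrr l2_norm0.
rewrite ltnS => /IH nm; rewrite -(subrKA (u m)).
apply: le_trans (l2_normD _ _) _; apply: le_trans (lerD (h m) nm) _.
rewrite le_eqVlt; apply/orP; left; apply/eqP.
by rewrite exprS invfM; field; rewrite !expf_neq0.
Qed.

(** The limit is taken coordinate by coordinate. A truncation of the error has
    finitely many coordinates: comparing with a late enough term of the sequence
    bounds it uniformly in the truncation. *)
Lemma l2_complete (u : nat -> H) (c : R) :
  (forall n, l2_norm (u n.+1 - u n) <= c * 2 ^- n) ->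
  exists v : H, forall n, l2_norm (v - u n) <= 2 * c * 2 ^- n.
Proof.
move=> h; have c0 : 0 <= c.
  by have := le_trans (l2_norm_ge0 _) (h 0%N); rewrite expr0 invr1 mulr1.
have h4 i : exists l, forall n, `|l - u n i| <= (4 * c * 2 ^- n)%:C%C.
  apply: complex_geometric_limit => n; rewrite -l2BE.
  by apply: le_trans (coord_norm _ _) _; rewrite lecR.
have {h4}[v hv] := choice h4.
have key n A : l2_norm (truncation (fun i => v i - u n i) A) <= 2 * c * 2 ^- n.
  apply: (@le_geometric ((size A)%:R * (4 * c))) => m.
  pose k := (maxn n m).
  have nk : (n <= k)%N by rewrite leq_maxl.
  have mk : (m <= k)%N by rewrite leq_maxr.
  have -> : truncation (fun i => v i - u n i) A =
     truncation (fun i => v i - u k i) A + truncation (u k - u n) A.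
    by apply/l2P => i; rewrite l2DE !truncationE; case: ifP;
      rewrite ?addr0// l2BE addrA subrK.
  apply: le_trans (l2_normD _ _) _; apply: lerD.
    apply: le_trans (l2_norm_truncation _ (fun i => hv i k)) _.
    rewrite -[leRHS]mulrA; apply: ler_wpM2l => //; rewrite ler_wpM2l ?mulr_ge0//.
    by rewrite lef_pV2 ?posrE ?exprn_gt0// ler_eXn2l// ltr1n.
  apply: (@le_trans _ _ (l2_norm (u k - u n))).
    rewrite -(@ler_pXn2r _ 2) ?nnegrE ?l2_norm_ge0// !l2_norm_sq nsq_truncation.
    exact: nsq_partial.
  apply: le_trans (l2_geometric h nk) _; rewrite lerBlDr lerDl.
  by rewrite !mulr_ge0.
have key2 n (A : {fset T}) : \sum_(i <- A) sqnorm (v i - u n i)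
  <= (2 * c * 2 ^- n) ^+ 2.
  have := key n A; rewrite -(@ler_pXn2r _ 2) ?nnegrE ?l2_norm_ge0 ?mulr_ge0//
    l2_norm_sq.
  by rewrite nsq_truncation.
pose w n : H := L2 (sq_summable_le (key2 n)).
exists (w 0%N + u 0%N) => n.
have -> : w 0%N + u 0%N - u n = w n.
  by apply/l2P => i; rewrite l2BE l2DE /= subrK.
rewrite -(@ler_pXn2r _ 2) ?nnegrE ?l2_norm_ge0 ?mulr_ge0// l2_norm_sq.
by apply: nsq_le => A; exact: key2.
Qed.

Lemma operator_limit (x : nat -> H -> H) (c : R) :
  (forall n, linear (x n)) -> (forall n, norm_le (x n.+1 - x n) (c * 2 ^- n)) ->
  exists2 y, linear y & forall n, norm_le (y - x n) (2 * c * 2 ^- n).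
Proof.
move=> lx hx.
have h xi : exists v, forall n, l2_norm (v - x n xi)
  <= 2 * (c * l2_norm xi) * 2 ^- n.
  by apply: l2_complete => n; rewrite mulrAC; exact: hx.
have [y hy] := choice h.
exists y => [a v w|n xi]; last first.
  by apply: le_trans (hy xi n) _; rewrite mulrA mulrAC.
apply/eqP; rewrite -subr_eq0; apply/eqP/l2_norm_eq0/eqP.
rewrite eq_le l2_norm_ge0 andbT.
apply: (@le_geometric (2 * (c * l2_norm (a *: v + w))
   + (abs_re a * (2 * (c * l2_norm v))) + 2 * (c * l2_norm w))) => n.
have -> : y (a *: v + w) - (a *: y v + y w) =
   (y (a *: v + w) - x n (a *: v + w)) - a *: (y v - x n v) - (y w - x n w).
  apply/l2P => i; rewrite lx !(l2BE, l2DE, l2ZE).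
  move: (y _ i) (y v i) (y w i) (x n v i) (x n w i) => p q r s t; ring.
apply: le_trans (l2_normD _ _) _; rewrite l2_normN addr0 [leRHS]mulrDl;
  apply: lerD; last exact: hy.
apply: le_trans (l2_normD _ _) _; rewrite l2_normN [leRHS]mulrDl; apply: lerD;
  first exact: hy.
rewrite -mulrA -lecR l2_normZ rmorphM/= abs_reE ler_wpM2l// lecR.
exact: hy.
Qed.

End Completeness.

(** * Square roots and positive functionals in C*-algebras *)

Lemma adjointZ_real (R : realType) (T : choiceType) (a : R[i])
  (f f' : l2 R T -> l2 R T) :
  0 <= a -> is_adjoint f f' -> is_adjoint (a *: f) (a *: f').
Proof.
move=> a0 ff xi eta; rewrite innerZl innerZr ff conj_Creal//.
exact: ger0_real.
Qed.

Section CstarAlgebras.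
Variables (R : realType) (T : choiceType).
Local Notation C := R[i].
Local Notation H := (l2 R T).
Implicit Types (f g h : H -> H).
Variables (A : set (H -> H)) (cA : cstar_subalgebra A).

Lemma cstar_bounded f : A f -> bounded_operator f.
Proof. by case: cA => + _ _ _ _; apply. Qed.
Lemma cstar_linear f : A f -> linear f.
Proof. by move=> /cstar_bounded[]. Qed.
Lemma cstar0 : A 0. Proof. by case: cA => _ [? _ _] _ _ _. Qed.
Lemma cstarD f g : A f -> A g -> A (f + g).
Proof. by case: cA => _ [_ + _] _ _ _; exact. Qed.
Lemma cstarZ a f : A f -> A (a *: f).
Proof. by case: cA => _ [_ _ +] _ _ _; exact. Qed.
Lemma cstarN f : A f -> A (- f).
Proof. by rewrite -scaleN1r; exact: cstarZ. Qed.
Lemma cstarB f g : A f -> A g -> A (f - g).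
Proof. by move=> Af Ag; apply: cstarD => //; exact: cstarN. Qed.
Lemma cstarM f g : A f -> A g -> A (f \o g).
Proof. by case: cA => _ _ + _ _; exact. Qed.
Lemma cstar_adjoint f g : A f -> is_adjoint f g -> A g.
Proof. by case: cA => _ _ _ + _; exact. Qed.
Lemma cstar_closed f : norm_closure A f -> A f.
Proof. by case: cA => _ _ _ _; exact. Qed.

Hypothesis A1 : A id.

Lemma geometric_small (K e : R) : 0 < e -> exists n, K * 2 ^- n <= e.
Proof.
move=> e0; apply/not_existsP => h.
have : e / 2 + e / 2 <= e / 2.
  apply: (@le_geometric _ (K / 2)) => n.
  have /negP := h n; rewrite -ltNge => hn.
  have -> : K / 2 / 2 ^+ n = (K / 2 ^+ n) / 2 by rewrite mulrAC.
  lra.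
lra.
Qed.

(** The map [x |-> (b + x^2) / 2] contracts the ball of radius 1/4 of the
    algebra, and a fixed point satisfies [(1 - x)^2 = 1 - b]. *)
Lemma cstar_sqrt b : A b -> is_adjoint b b -> norm_le b 4^-1 ->
  exists h, [/\ A h, is_adjoint h h & h \o h = id - b].
Proof.
move=> Ab bb b4.
have [X [X0 XS]] : exists X : nat -> H -> H, X 0%N = 0 /\
    forall n, X n.+1 = 2^-1 *: (b + (X n \o X n)).
  by exists (fix X n : H -> H := if n is m.+1 then 2^-1 *: (b + (X m \o X m))
    else 0).
have AX n : A (X n).
  by elim: n => [|n IH]; [rewrite X0; exact: cstar0|rewrite XS; apply: cstarZ;
    apply: cstarD => //; exact: cstarM].
have lX n : linear (X n) by exact: cstar_linear.
have aX n : is_adjoint (X n) (X n).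
  elim: n => [|n IH]; first by rewrite X0; exact: adjoint0.
  rewrite XS; apply: adjointZ_real; first by rewrite invr_ge0.
  apply: adjointD => //.
  exact: (adjoint_comp IH IH).
have c2 : abs_re (2^-1 : C) = 2^-1.
  by apply: (@complexI R); rewrite abs_reE ger0_norm// fmorphV rmorph_nat.
have bX n : norm_le (X n) 4^-1.
  elim: n => [|n IH]; first by rewrite X0; apply: norm_le_trans (@norm_le0 _ _).
  rewrite XS; apply: norm_le_trans (norm_leZ _
    (norm_leD b4 (norm_le_comp _ IH IH))) => //.
  by rewrite c2; lra.
have dX n : norm_le (X n.+1 - X n) (4^-1 * 2 ^- n).
  elim: n => [|n IH].
    rewrite XS X0 expr0 invr1 mulr1 (_ : 2^-1 *: _ - _ = 2^-1 *: b).
      by apply: norm_le_trans (norm_leZ _ b4); rewrite c2; lra.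
    by apply/funext => xi; rewrite /= !fctE /= addr0 subr0.
  rewrite XS [X n.+1 in X in _ - X]XS.
  have -> : 2^-1 *: (b + (X n.+1 \o X n.+1)) - 2^-1 *: (b + (X n \o X n)) =
     2^-1 *: ((X n.+1 \o (X n.+1 - X n)) + ((X n.+1 - X n) \o X n)).
    apply/funext => xi; rewrite !fctE /= (linB (lX n.+1)); apply/l2P => i.
    rewrite !(l2BE, l2DE, l2ZE).
    by move: (b xi i) (X n.+1 _ i) (X n.+1 _ i) (X n _ i) => p q r t; ring.
  apply: norm_le_trans (norm_leZ _ (norm_leD (norm_le_comp _ (bX n.+1) IH)
    (norm_le_comp _ IH (bX n)))) => //.
    rewrite c2 exprS invfM.
    have : 0 <= 2 ^- n :> R by rewrite invr_ge0 exprn_ge0.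
    by set q := 2 ^- n; lra.
have [y ly hy] := operator_limit lX dX.
have y1 : norm_le y 1.
  have := hy 0%N; rewrite X0 subr0 expr0 invr1 mulr1; apply: norm_le_trans; lra.
have Ay : A y.
  apply: cstar_closed; split; first exact: norm_le_bounded ly y1.
  move=> e e0; have [n hn] := @geometric_small (2 * 4^-1) e e0.
  by exists (X n) => // xi; apply: le_trans (hy n xi) _;
    rewrite ler_wpM2r ?l2_norm_ge0.
have ay : is_adjoint y y.
  move=> xi eta; apply/eqP; rewrite -subr_eq0 -normr_eq0 -abs_reE.
  rewrite (inj_eq (@complexI R)) eq_le abs_re_ge0 andbT.
  apply: (@le_geometric _ (2 * (2 * 4^-1) * l2_norm xi * l2_norm eta)) => n.
  rewrite addr0 -lecR abs_reE.
  have -> : l2_inner (y xi) eta - l2_inner xi (y eta) =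
     l2_inner ((y - X n) xi) eta - l2_inner xi ((y - X n) eta).
    by rewrite innerBl innerBr aX; ring.
  apply: le_trans (ler_normB _ _) _.
  apply: le_trans (lerD (cauchy_schwarz _ _) (cauchy_schwarz _ _)) _.
  rewrite -rmorphD lecR.
  apply: le_trans (lerD (ler_wpM2r _ (hy n xi)) (ler_wpM2l _ (hy n eta))) _;
    rewrite ?l2_norm_ge0//.
  by rewrite le_eqVlt; apply/orP; left; apply/eqP; ring.
have yE : y = 2^-1 *: (b + (y \o y)).
  apply/funext => xi; apply/eqP; rewrite -subr_eq0; apply/eqP/l2_norm_eq0/eqP.
  rewrite eq_le l2_norm_ge0 andbT.
  apply: (@le_geometric _ (2 * l2_norm xi)) => n; rewrite addr0.
  have -> : y xi - (2^-1 *: (b + (y \o y))) xi = (y - X n.+1) xi -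
     (2^-1 : C) *: (y ((y - X n) xi) + (y - X n) (X n xi)).
    rewrite XS !fctE /= (linB ly); apply/l2P => i; rewrite !(l2BE, l2DE, l2ZE).
    by move: (y xi i) (b xi i) (y (y xi) i) (X n (X n xi) i) (y (X n xi) i) => p
      q r s t; ring.
  have q0 : 0 <= 2 ^- n :> R by rewrite invr_ge0 exprn_ge0.
  apply: le_trans (l2_normD _ _) _; rewrite l2_normN.
  have h1 := hy n.+1 xi.
  have h2 : norm_le (2^-1 *: ((y \o (y - X n)) + ((y - X n) \o X n)))
      (2^-1 * (1 * (2 * 4^-1 * 2 ^- n) + 2 * 4^-1 * 2 ^- n * 4^-1)).
    rewrite -c2; apply: norm_leZ; apply: norm_leD.
      exact: (norm_le_comp ler01 y1 (hy n)).
    by apply: (norm_le_comp _ (hy n) (bX n)); rewrite !mulr_ge0.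
  apply: le_trans (lerD h1 (h2 xi)) _; rewrite -mulrDl [leRHS]mulrAC.
  rewrite ler_wpM2r ?l2_norm_ge0// exprS invfM.
  by move: q0; set q := 2 ^- n; lra.
exists (id - y); split.
- exact: cstarB.
- by apply: adjointD => //; exact: adjointN.
- apply/funext => xi; rewrite !fctE /= (linB ly).
  have := congr1 (fun f => f xi) yE; rewrite /= !fctE /= => e.
  have {}e : b xi = y xi + y xi - y (y xi).
    by rewrite [in y xi + _]e -scalerDl -[2^-1]mul1r -splitr scale1r addrK.
  by apply/l2P => i; rewrite e !(l2BE, l2DE); ring.
Qed.

(** If [f] has norm at most 2, then [1 - f^* f / 16] is the square of a
    self-adjoint element, so positivity bounds [om (f^* f)] by [16 om 1]. By
    polarization every element is a combination of four such products. *)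
Lemma positive_functional_bounded (om : (H -> H) -> C) :
    (forall f g, A f -> A g -> om (f + g) = om f + om g) ->
    (forall a f, A f -> om (a *: f) = a * om f) ->
    (forall f g, A f -> is_adjoint f g -> 0 <= om (g \o f)) ->
  exists2 K, 0 <= K & forall f e, A f -> 0 < e -> norm_le f e -> `|om f|
    <= (K * e)%:C%C.
Proof.
move=> omD omZ om0.
have om1 : 0 <= om id by have := om0 id id A1 (@adjoint_id _ _).
have omN f : A f -> om (- f) = - om f.
  by move=> Af; rewrite -scaleN1r omZ// mulN1r.
have sq f g : A f -> is_adjoint f g -> norm_le f 2 -> `|om (g \o f)|
  <= 16 * om id.
  move=> Af fg f2; have Ag := cstar_adjoint Af fg.
  have g2 : norm_le g 2 := adjoint_norm_le (ler0n _ 2) f2 fg.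
  have c16 : abs_re (16^-1 : C) = 16^-1.
    by apply: (@complexI R); rewrite abs_reE ger0_norm// fmorphV rmorph_nat.
  have Agf : A (g \o f) by exact: cstarM.
  have Ab : A (16^-1 *: (g \o f)) by exact: cstarZ.
  have bb : is_adjoint (16^-1 *: (g \o f)) (16^-1 *: (g \o f)).
    apply: adjointZ_real; first by rewrite invr_ge0.
    apply: adjoint_comp => //; exact: adjoint_sym.
  have b4 : norm_le (16^-1 *: (g \o f)) 4^-1.
    apply: norm_le_trans (norm_leZ _ (norm_le_comp _ g2 f2)) => //.
    by rewrite c16; lra.
  have [h [Ah hh hE]] := cstar_sqrt Ab bb b4.
  have := om0 h h Ah hh; rewrite hE omD//; last exact: cstarN.
  rewrite omN// omZ// subr_ge0 ger0_norm; last exact: om0.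
  by rewrite mulrC ler_pdivrMr// mulrC.
exists (16 * abs_re (om id)) => [|f e Af e0 fe].
  by rewrite mulr_ge0// abs_re_ge0.
wlog : f e Af e0 fe / e = 1 => [hw|e1].
  have ee : e^-1 * e = 1 by rewrite mulVf// gt_eqF.
  have ce : abs_re (e^-1%:C%C : C) = e^-1 by rewrite abs_re_real// invr_ge0 ltW.
  have fe1 : norm_le (e^-1%:C%C *: f) 1 by have := norm_leZ e^-1%:C%C fe;
    rewrite ce ee.
  have := hw _ 1 (cstarZ _ Af) ltr01 fe1 erefl.
  rewrite omZ// normrM -(abs_reE (e^-1)%:C%C) ce mulr1 mulrC
    [X in _ -> _ <= X]rmorphM/=.
  by rewrite fmorphV ler_pdivrMr ?ltcR.
rewrite {}e1 in fe *.
have [g fg] := adjoint_exists (cstar_bounded Af).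
have Ag := cstar_adjoint Af fg.
pose P (z : C) : H -> H := f + z *: id.
pose Q (z : C) : H -> H := g + z^* *: id.
have AP z : A (P z) by apply: cstarD => //; exact: cstarZ.
have AQ z : A (Q z) by apply: cstarD => //; exact: cstarZ.
have PQ z : is_adjoint (P z) (Q z) by apply: adjointD => //; exact: adjointZ.
have P2 z : abs_re z = 1 -> norm_le (P z) 2.
  move=> z1; rewrite (_ : 2 = 1 + 1)//; apply: norm_leD => //.
  by have := norm_leZ z (@norm_le_id R T); rewrite z1 mulr1.
(* Polarization of [f = f o 1], summed over the four powers of [i]. *)
have e4 : 4 *: f = ((Q 1 \o P 1) - (Q (-1) \o P (-1)))
      + 'i *: ((Q 'i \o P 'i) - (Q (- 'i) \o P (- 'i))) :> (H -> H).
  have lf := cstar_linear Af; have lg := cstar_linear Ag.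
  apply/funext => xi; rewrite /P /Q !fctE /= !rmorphN /= !conjCi !conjC1.
  rewrite ![g (_ + _)](linD lg) ![g (_ *: _)](linZ lg); apply/l2P => i;
    rewrite !(l2BE, l2DE, l2ZE).
  have ii : 'i * 'i = -1 :> C by rewrite -expr2 sqrCi.
  move: (g (f xi) i) (f xi i) (g xi i) (xi i) => p q r s.
  have -> : 4 * q = 2 * q - ('i * 'i) * (2 * q) +
    (2 * r + ('i * 'i) * (2 * r)) + ('i * 'i + 1) * 0.
    by rewrite ii; ring.
  by ring.
have n1 : abs_re (1 : C) = 1 by apply: (@complexI R); rewrite abs_reE normr1.
have n2 : abs_re (-1 : C) = 1 by apply: (@complexI R);
  rewrite abs_reE normrN normr1.
have n3 : abs_re ('i : C) = 1 by apply: (@complexI R); rewrite abs_reE normCi.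
have n4 : abs_re (- 'i : C) = 1 by apply: (@complexI R);
  rewrite abs_reE normrN normCi.
have om4 : 4 * om f = (om (Q 1 \o P 1) - om (Q (-1) \o P (-1)))
      + 'i * (om (Q 'i \o P 'i) - om (Q (- 'i) \o P (- 'i))).
  have AQP z : A (Q z \o P z) by exact: cstarM.
  have omB z w : om ((Q z \o P z) - (Q w \o P w))
    = om (Q z \o P z) - om (Q w \o P w).
    by rewrite omD ?omN//; exact: cstarN.
  by rewrite -omZ// e4 omD ?omZ ?omB//; try apply: cstarZ; exact: cstarB.
have sQ z : abs_re z = 1 -> `|om (Q z \o P z)| <= 16 * om id.
  by move=> z1; apply: sq => //; exact: P2.
have : `|4 * om f| <= (16 * om id + 16 * om id) + (16 * om id + 16 * om id).
  rewrite om4; apply: le_trans (ler_normD _ _) _; rewrite normrM normCi mul1r.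
  by apply: lerD; apply: le_trans (ler_normB _ _) _; apply: lerD; apply: sQ.
rewrite normrM (ger0_norm (ler0n _ 4)) mulr1 rmorphM rmorph_nat/= abs_reE
  (ger0_norm om1) => h4.
rewrite -(@ler_pM2l _ 4)//; apply: le_trans h4 _.
by rewrite le_eqVlt; apply/orP; left; apply/eqP; ring.
Qed.

End CstarAlgebras.

(** * Norm closures and translation operators *)

Section NormClosure.
Variables (R : realType) (T : choiceType).
Local Notation C := R[i].
Local Notation H := (l2 R T).
Implicit Types (f g h : H -> H) (S : set (H -> H)).

Lemma norm_closure_cstar S :
    S `<=` @bounded_operator R T -> operator_subspace S ->
    (forall f g, S f -> S g -> S (f \o g)) ->
    (forall f, S f -> exists2 g, S g & is_adjoint f g) ->
  cstar_subalgebra (norm_closure S).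
Proof.
move=> Sb [S0 SD SZ] SM Sadj; split.
- by move=> f [].
- split=> [|f g [bf hf] [bg hg]|a f [bf hf]].
  + split=> [|e e0]; first exact: bounded0.
    by exists 0 => // xi; rewrite subrr l2_norm0 mulr_ge0 ?l2_norm_ge0 ?(ltW e0).
  + split=> [|e e0]; first exact: boundedD.
    have e2 : 0 < e / 2 by rewrite divr_gt0.
    have [f0 Sf0 ff0] := hf _ e2; have [g0 Sg0 gg0] := hg _ e2.
    exists (f0 + g0) => [|xi]; first exact: SD.
    rewrite !fctE opprD addrACA; apply: le_trans (l2_normD _ _) _.
    by rewrite [in leRHS](splitr e) mulrDl lerD.
  + split=> [|e e0]; first exact: boundedZ.
    have c1 : 0 < abs_re a + 1 by rewrite ltr_wpDl ?abs_re_ge0.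
    have [f0 Sf0 ff0] := hf _ (divr_gt0 e0 c1).
    exists (a *: f0) => [|xi]; first exact: SZ.
    rewrite !fctE -scalerBr; apply: le_trans (norm_leZ a ff0 xi) _.
    rewrite ler_wpM2r ?l2_norm_ge0// mulrCA ger_pMr// ler_pdivrMr// mul1r.
    by rewrite lerDl.
- move=> f g [bf hf] [bg hg]; split=> [|e e0]; first exact: bounded_comp.
  have [M M0 fM] := bounded_norm_le bf; have [lf _] := bf.
  have e2 : 0 < e / 2 by rewrite divr_gt0.
  have M1 : 0 < M + 1 by rewrite ltr_wpDl.
  (* [g0] comes first: its norm fixes the precision required of [f0]. *)
  have [g0 Sg0 gg0] := hg _ (divr_gt0 e2 M1).
  have [N N0 g0N] := bounded_norm_le (Sb _ Sg0).
  have N1 : 0 < N + 1 by rewrite ltr_wpDl.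
  have [f0 Sf0 ff0] := hf _ (divr_gt0 e2 N1).
  exists (f0 \o g0) => [|xi]; first exact: SM.
  have -> : (f \o g) xi - (f0 \o g0) xi = f (g xi - g0 xi) +
    (f (g0 xi) - f0 (g0 xi)).
    by rewrite (linB lf) /= addrA subrK.
  apply: le_trans (l2_normD _ _) _; rewrite (splitr e) mulrDl; apply: lerD.
    apply: le_trans (fM _) _; apply: le_trans (ler_wpM2l M0 (gg0 xi)) _.
    rewrite mulrA ler_wpM2r ?l2_norm_ge0// mulrCA ger_pMr// ler_pdivrMr// mul1r.
    by rewrite lerDl.
  apply: le_trans (ff0 _) _.
  apply: (@le_trans _ _ (e / 2 / (N + 1) * (N * l2_norm xi))).
    by rewrite ler_wpM2l// divr_ge0// ltW.
  rewrite mulrA ler_wpM2r ?l2_norm_ge0// -mulrA ger_pMr// mulrC ler_pdivrMr//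
    mul1r.
  by rewrite lerDl.
- move=> f g [bf hf] fg; split=> [|e e0]; first exact: adjoint_bounded fg.
  have [f0 Sf0 ff0] := hf _ e0; have [g0 Sg0 fg0] := Sadj _ Sf0.
  exists g0 => //; apply: (@adjoint_norm_le _ _ (f - f0)) => //; first exact: ltW.
  by apply: adjointD => //; exact: adjointN.
- move=> f [bf hf]; split=> // e e0.
  have e2 : 0 < e / 2 by rewrite divr_gt0.
  have [g [_ hg] fg] := hf _ e2; have [g0 Sg0 gg0] := hg _ e2.
  exists g0 => // xi; rewrite -(subrKA (g xi)) addrC.
  by apply: le_trans (l2_normD _ _) _; rewrite [in leRHS](splitr e) mulrDl addrC
    lerD.
Qed.

Lemma bounded_cstar : cstar_subalgebra (@bounded_operator R T).
Proof.
split=> //.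
- by split=> [|f g|a f]; [exact: bounded0|exact: boundedD|exact: boundedZ].
- exact: bounded_comp.
- by move=> f g; exact: adjoint_bounded.
- by move=> f [].
Qed.

Lemma cstar_generated_sub S A : cstar_subalgebra A -> S `<=` A ->
  cstar_generated S `<=` A.
Proof. by move=> cA SA; exact: smallest_sub. Qed.

Lemma cstar_generated_cstar S : S `<=` @bounded_operator R T ->
  cstar_subalgebra (cstar_generated S).
Proof.
move=> Sb; split.
- exact: cstar_generated_sub bounded_cstar Sb.
- split=> [A [cA _]|f g hf hg A [cA SA]|a f hf A [cA SA]].
  + exact: cstar0.
  + by apply: (cstarD cA); [exact: hf|exact: hg].
  + by apply: (cstarZ cA); exact: hf.
- by move=> f g hf hg A [cA SA]; apply: (cstarM cA); [exact: hf|exact: hg].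
- by move=> f g hf fg A [cA SA]; apply: (cstar_adjoint cA) fg; exact: hf.
- move=> f [bf hf] A [cA SA]; apply: (cstar_closed cA); split=> // e /hf[g hg fg].
  by exists g => //; exact: hg.
Qed.

End NormClosure.

(** Bundled so that the translation operators on [X], on an orbit and on the
    product of the group with [X] are instances of a single construction. *)
Record gset (Gamma : groupType) := Gset {
  gs_sort :> choiceType;
  gs_act : Gamma -> gs_sort -> gs_sort;
  gs_act1 : forall y, gs_act 1%g y = y;
  gs_actM : forall s t y, gs_act (s * t)%g y = gs_act s (gs_act t y)
}.

Arguments gs_act {Gamma} g t y.

Section Shifts.
Variables (R : realType) (Gamma : groupType) (T : gset Gamma).
Local Notation C := R[i].
Local Notation H := (l2 R T).
Implicit Types (t : Gamma) (xi : H).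

Lemma gs_actK t : cancel (gs_act T t) (gs_act T t^-1%g).
Proof. by move=> y; rewrite -gs_actM mulVg gs_act1. Qed.

Lemma gs_actKV t : cancel (gs_act T t^-1%g) (gs_act T t).
Proof. by move=> y; rewrite -gs_actM mulgV gs_act1. Qed.

Lemma sqsum_shift t xi :
  sqsum (fun y => xi (gs_act T t^-1%g y)) = sqsum xi.
Proof.
rewrite /sqsum [RHS](reindex_esum [set: T] [set: T] (gs_act T t^-1%g))//.
split=> // [y z _ _ /(can_inj (gs_actKV t)) //|y _].
by exists (gs_act T t y) => //; rewrite gs_actK.
Qed.

Lemma shift_subproof t xi : (fun y => xi (gs_act T t^-1%g y)) \in @sq_summable R
  T.
Proof. by apply/asboolP; rewrite sqsum_shift; apply/asboolP/l2_summable. Qed.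

Definition shift t xi : H := L2 (shift_subproof t xi).

Lemma shiftE t xi y : shift t xi y = xi (gs_act T t^-1%g y). Proof. by []. Qed.

Lemma shift_bounded t : bounded_operator (shift t).
Proof.
apply: (@norm_le_bounded _ _ _ 1) => [a u v|xi]; first exact/l2P.
by rewrite mul1r /l2_norm sqsum_shift.
Qed.

Lemma shift1 : shift 1%g = id.
Proof. by apply/funext => xi; apply/l2P => y; rewrite shiftE invg1 gs_act1. Qed.

Lemma shiftM s t : shift (s * t)%g = shift s \o shift t.
Proof.
by apply/funext => xi; apply/l2P => y; rewrite /= invgM gs_actM.
Qed.

Lemma shift_delta t y : shift t (l2_delta R y) = l2_delta R (gs_act T t y).
Proof.
apply/l2P => z; rewrite shiftE /=; congr (_%:R); congr nat_of_bool.
by rewrite (can2_eq (gs_actKV t) (gs_actK t)).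
Qed.

Lemma shift_adjoint t : is_adjoint (shift t) (shift t^-1%g).
Proof.
have [g hg] := adjoint_exists (shift_bounded t).
rewrite (_ : shift _^-1%g = g)//; apply: bounded_delta.
- exact: shift_bounded.
- exact: adjoint_bounded (shift_bounded t) hg.
move=> j; apply: inner_inj => z; rewrite -inner_conj -[RHS]inner_conj;
  congr (_^*).
by rewrite -hg shift_delta !inner_delta shiftE.
Qed.

Inductive shift_span : set (H -> H) :=
| shift_span0 : shift_span 0
| shift_spanD (c : C) t f : shift_span f -> shift_span (c *: shift t + f).

Lemma shift_span_cstar : cstar_subalgebra (norm_closure shift_span).
Proof.
have SD f g : shift_span f -> shift_span g -> shift_span (f + g).
  move=> Sf Sg; elim: Sf => [|c t h _ IH]; first by rewrite add0r.
  by rewrite -addrA; exact: shift_spanD.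
have SZ (a : C) f : shift_span f -> shift_span (a *: f).
  elim=> [|c t h _ IH]; first by rewrite scaler0; exact: shift_span0.
  by rewrite scalerDr scalerA; exact: shift_spanD.
have Sb : shift_span `<=` @bounded_operator R T.
  move=> f; elim=> [|c t h _ IH]; first exact: bounded0.
  by apply: boundedD => //; apply: boundedZ; exact: shift_bounded.
apply: norm_closure_cstar => //.
- by split=> //; exact: shift_span0.
- move=> f g Sf; elim: Sf g => [|c t h _ IH] g Sg.
    by rewrite (_ : 0 \o g = 0)//; exact: shift_span0.
  rewrite (_ : _ \o g = (c *: (shift t \o g)) + (h \o g)); last by [].
  apply: SD; last exact: IH.
  apply: SZ; elim: Sg => [|d s k _ IHk].
    rewrite (_ : _ \o _ = 0); first exact: shift_span0.
    by apply/funext => xi; rewrite /= (lin0 (shift_bounded t).1).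
  rewrite (_ : shift t \o _ = d *: shift (t * s)%g + (shift t \o k)).
    exact: shift_spanD.
  apply/funext => xi; rewrite shiftM /= !fctE /=.
  by rewrite (linD (shift_bounded t).1) (linZ (shift_bounded t).1).
- move=> f; elim=> [|c t h _ [g Sg hg]].
    by exists 0; [exact: shift_span0|exact: adjoint0].
  exists (c^* *: shift t^-1%g + g); first exact: shift_spanD.
  by apply: adjointD => //; apply: adjointZ; exact: shift_adjoint.
Qed.

(** The norm closure of the linear span is already a C*-algebra, since the
    translations form a group of unitaries. *)
Lemma shift_generated : cstar_generated (range shift) `<=` norm_closure
  shift_span.
Proof.
apply: cstar_generated_sub; first exact: shift_span_cstar.
move=> _ [t _ <-]; split=> [|e e0]; first exact: shift_bounded.
exists (1 *: shift t + 0); first by apply: shift_spanD; exact: shift_span0.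
by move=> xi; rewrite scale1r addr0 subrr l2_norm0 mulr_ge0 ?l2_norm_ge0
  ?(ltW e0).
Qed.

End Shifts.

Arguments shift {R Gamma T} t xi.

(** * Operator systems of bounded operators *)

Section OperatorMatrices.
Variables (R : realType) (T : choiceType) (n : nat).
Local Notation C := R[i].
Local Notation H := (l2 R T).
Implicit Types (F G : 'I_n -> 'I_n -> H -> H) (xi eta : 'I_n -> H).

Definition mxform F xi eta : C :=
  \sum_i \sum_j l2_inner (F i j (xi j)) (eta i).

Definition mxpsd F : Prop := forall xi, 0 <= mxform F xi xi.

Definition linear_entries F := forall i j, linear (F i j).

Lemma eq_mxform F G xi eta : (forall i j, F i j = G i j) ->
  mxform F xi eta = mxform G xi eta.
Proof.
by move=> FG; apply: eq_bigr => i _; apply: eq_bigr => j _; rewrite FG.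
Qed.

Lemma mxformDl F xi xi' eta : linear_entries F ->
  mxform F (xi + xi') eta = mxform F xi eta + mxform F xi' eta.
Proof.
move=> lF; rewrite /mxform -big_split; apply: eq_bigr => i _ /=.
rewrite -big_split; apply: eq_bigr => j _ /=.
by rewrite !fctE (linD (lF i j)) innerDl.
Qed.

Lemma mxformDr F xi eta eta' :
  mxform F xi (eta + eta') = mxform F xi eta + mxform F xi eta'.
Proof.
rewrite /mxform -big_split; apply: eq_bigr => i _ /=.
by rewrite -big_split; apply: eq_bigr => j _ /=; rewrite innerDr.
Qed.

Lemma mxformZl F (a : C) xi eta : linear_entries F ->
  mxform F (a *: xi) eta = a * mxform F xi eta.
Proof.
move=> lF; rewrite /mxform mulr_sumr; apply: eq_bigr => i _.
rewrite mulr_sumr; apply: eq_bigr => j _.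
by rewrite !fctE (linZ (lF i j)) innerZl.
Qed.

Lemma mxformZr F (a : C) xi eta :
  mxform F xi (a *: eta) = a^* * mxform F xi eta.
Proof.
rewrite /mxform mulr_sumr; apply: eq_bigr => i _.
by rewrite mulr_sumr; apply: eq_bigr => j _; rewrite innerZr.
Qed.

Lemma mxform_addl F G xi eta :
  mxform (fun i j => F i j + G i j) xi eta = mxform F xi eta + mxform G xi eta.
Proof.
rewrite /mxform -big_split; apply: eq_bigr => i _ /=.
by rewrite -big_split; apply: eq_bigr => j _ /=; rewrite innerDl.
Qed.

Lemma mxform_scalel (a : C) F xi eta :
  mxform (fun i j => a *: F i j) xi eta = a * mxform F xi eta.
Proof.
rewrite /mxform mulr_sumr; apply: eq_bigr => i _.
by rewrite mulr_sumr; apply: eq_bigr => j _; rewrite innerZl.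
Qed.

Lemma mxform_oppl F xi eta :
  mxform (fun i j => - F i j) xi eta = - mxform F xi eta.
Proof.
rewrite /mxform -sumrN; apply: eq_bigr => i _.
by rewrite -sumrN; apply: eq_bigr => j _; rewrite innerNl.
Qed.

Lemma mxform_adj F G xi eta : (forall i j, is_adjoint (F j i) (G i j)) ->
  mxform G xi eta = (mxform F eta xi)^*.
Proof.
move=> FG; rewrite /mxform rmorph_sum exchange_big; apply: eq_bigr => i _ /=.
by rewrite rmorph_sum; apply: eq_bigr => j _ /=; rewrite FG inner_conj.
Qed.

Definition single (j : 'I_n) (u : H) : 'I_n -> H :=
  fun k => if k == j then u else 0.

Lemma mxform_single F i j u v : linear_entries F ->
  mxform F (single j u) (single i v) = l2_inner (F i j u) v.
Proof.
move=> lF; rewrite /mxform (bigD1 i)//= (bigD1 j)//= /single !eqxx.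
rewrite big1 ?addr0 => [|k /negPf ->]; last by rewrite (lin0 (lF _ _)) inner0l.
rewrite big1 ?addr0// => k /negPf ->.
by rewrite big1// => l _; rewrite inner0r.
Qed.

(** Over the complex numbers the polarized form vanishes with the quadratic
    form. *)
Lemma mxform_eq0 F : linear_entries F -> (forall xi, mxform F xi xi = 0) ->
  forall i j, F i j = 0.
Proof.
move=> lF F0; have S u v : mxform F u v + mxform F v u = 0.
  by have := F0 (u + v); rewrite mxformDl// !mxformDr !F0 add0r addr0.
have D u v : mxform F u v = 0.
  have := S u (('i : C) *: v); rewrite mxformZl// mxformZr conjCi mulNr addrC
    -mulrBr.
  move/eqP; rewrite mulf_eq0 (negPf (neq0Ci _)) /= subr_eq0 => /eqP e.
  have := S u v; rewrite e -mulr2n => /eqP.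
  by rewrite mulrn_eq0 /= => /eqP.
move=> i j; apply/funext => u; apply: inner_inj => z.
by rewrite inner0l -(@mxform_single F) // D.
Qed.

Definition nsqs xi : C := \sum_i l2_inner (xi i) (xi i).

Lemma nsqs_ge0 xi : 0 <= nsqs xi.
Proof. by apply: sumr_ge0 => i _; exact: inner_ge0. Qed.

Lemma norm_le_nsqs xi i : ((l2_norm (xi i))%:C%C : C) ^+ 2 <= nsqs xi.
Proof.
rewrite l2_normE /nsqs (bigD1 i)//= lerDl.
by apply: sumr_ge0 => k _; exact: inner_ge0.
Qed.

Lemma mxform_bound F : (forall i j, bounded_operator (F i j)) ->
  exists2 M : C, 0 <= M & forall xi, `|mxform F xi xi| <= M * nsqs xi.
Proof.
move=> bF; have /choice[M hM] (p : 'I_n * 'I_n) : exists M : R, 0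
  <= M /\ norm_le (F p.1 p.2) M.
  by have [M M0 FM] := bounded_norm_le (bF p.1 p.2); exists M.
exists (\sum_i \sum_j (M (i, j))%:C%C) => [|xi].
  by apply: sumr_ge0 => i _; apply: sumr_ge0 => j _; rewrite lecR;
    case: (hM (i, j)).
rewrite /mxform mulr_suml; apply: le_trans (ler_norm_sum _ _ _) _.
apply: ler_sum => i _; rewrite mulr_suml; apply: le_trans (ler_norm_sum _ _ _) _.
apply: ler_sum => j _; have [M0 FM] := hM (i, j).
apply: le_trans (cauchy_schwarz _ _) _.
apply: (@le_trans _ _ ((M (i, j) * l2_norm (xi j) * l2_norm (xi i))%:C%C)).
  by rewrite lecR ler_wpM2r ?l2_norm_ge0//; exact: FM.
rewrite -mulrA [leLHS]rmorphM/= ler_wpM2l ?lecR// rmorphM/=.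
have a0 : 0 <= (l2_norm (xi j))%:C%C :> C by rewrite lecR l2_norm_ge0.
have b0 : 0 <= (l2_norm (xi i))%:C%C :> C by rewrite lecR l2_norm_ge0.
have := normr_amgm (l2_norm (xi j))%:C%C (l2_norm (xi i))%:C%C.
rewrite !ger0_norm// => h; apply: le_trans h _.
rewrite mulrC ler_pdivrMr ?ltr0n// mulr_natr mulr2n.
by apply: lerD; exact: norm_le_nsqs.
Qed.

Lemma mxform_diag (a : C) xi :
  mxform (fun i j => if i == j then a *: id else 0) xi xi = a * nsqs xi.
Proof.
rewrite /mxform /nsqs mulr_sumr; apply: eq_bigr => i _.
rewrite (bigD1 i)//= eqxx big1 ?addr0 => [|j /negPf ji]; first by rewrite innerZl.
by rewrite eq_sym ji inner0l.
Qed.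

End OperatorMatrices.

(** A concrete Gamma-operator system. The bounded operators, and the scalars plus
    part of an ideal, are both presented in this way. *)
Record gamma_star_space (R : realType) (Gamma : groupType) (T : gset Gamma) :=
    GammaStarSpace {
  gss_set : set (l2 R T -> l2 R T);
  gss_bounded : gss_set `<=` @bounded_operator R T;
  gss_subspace : operator_subspace gss_set;
  gss1 : gss_set id;
  gss_adj : forall f g, gss_set f -> is_adjoint f g -> gss_set g;
  gss_conj : forall t f, gss_set f -> gss_set (shift t \o f \o shift t^-1%g)
}.

Section ConcreteSystem.
Variables (R : realType) (Gamma : groupType) (T : gset Gamma).
Local Notation C := R[i].
Local Notation H := (l2 R T).

Definition gss_pred (S : gamma_star_space R T) : {pred (H -> H)} :=
  fun f => `[< gss_set S f >].

Lemma gss_submod S : submod_closed (gss_pred S).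
Proof.
case: (gss_subspace S) => S0 SD SZ; split=> [|a f g /asboolP Sf /asboolP Sg].
  exact/asboolP.
by apply/asboolP; apply: SD => //; exact: SZ.
Qed.

HB.instance Definition _ (S : gamma_star_space R T) :=
  GRing.isSubmodClosed.Build C (H -> H) (gss_pred S) (gss_submod S).

Record gss_elt (S : gamma_star_space R T) := GssElt {
  gss_fun :> H -> H;
  gss_mem : gss_fun \in gss_pred S
}.

HB.instance Definition _ (S : gamma_star_space R T) := [isSub for @gss_fun S].
HB.instance Definition _ (S : gamma_star_space R T) :=
  [Choice of gss_elt S by <:].
HB.instance Definition _ (S : gamma_star_space R T) :=
  [SubChoice_isSubLmodule of gss_elt S by <:].

Variable S : gamma_star_space R T.
Local Notation V := (gss_elt S).
Implicit Types (v w : V).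

Lemma gssP v : gss_set S v. Proof. by apply/asboolP; exact: gss_mem. Qed.
Lemma gss_boundedP v : bounded_operator v.
Proof. by apply: gss_bounded; exact: gssP. Qed.
Lemma gss_linear v : linear v. Proof. by have [] := gss_boundedP v. Qed.

Lemma gss_eqP v w : gss_fun v = gss_fun w -> v = w.
Proof. exact: val_inj. Qed.

Definition gss_mk f (Sf : gss_set S f) : V := GssElt (asboolT Sf).

Lemma gssDE v w : gss_fun (v + w) = gss_fun v + gss_fun w. Proof. by []. Qed.
Lemma gssZE (a : C) v : gss_fun (a *: v) = a *: gss_fun v. Proof. by []. Qed.
Lemma gss_sumE (I : Type) (r : seq I) (P : pred I) (F : I -> V) :
  gss_fun (\sum_(k <- r | P k) F k) = \sum_(k <- r | P k) gss_fun (F k).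
Proof. by apply: (big_morph (fun v => gss_fun v)). Qed.

Definition gss_star v : V := gss_mk (gss_adj (gssP v) (adjP (gss_boundedP v))).
Definition gss_one : V := gss_mk (gss1 S).

Lemma gss_starP v : is_adjoint v (gss_star v).
Proof. exact: adjP (gss_boundedP v). Qed.

Lemma gss_starE v w : is_adjoint v w -> gss_star v = w.
Proof. by move=> vw; apply: gss_eqP; exact: adjE. Qed.

Lemma gss_starK v : gss_star (gss_star v) = v.
Proof. by apply: gss_starE; apply: adjoint_sym; exact: gss_starP. Qed.
Lemma gss_starD v w : gss_star (v + w) = gss_star v + gss_star w.
Proof. by apply: gss_starE; apply: adjointD; exact: gss_starP. Qed.
Lemma gss_starZ (a : C) v : gss_star (a *: v) = a^* *: gss_star v.
Proof. by apply: gss_starE; apply: adjointZ; exact: gss_starP. Qed.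
Lemma gss_star1 : gss_star gss_one = gss_one.
Proof. exact: gss_starE. Qed.

Definition entries n (A : 'M[V]_n) : 'I_n -> 'I_n -> H -> H := fun i j => A i j.

Definition gss_pos n : set 'M[V]_n := [set A | mxpsd (entries A)].

Lemma entries_linear n (A : 'M[V]_n) : linear_entries (entries A).
Proof. by move=> i j; exact: gss_linear. Qed.

Lemma mxform_entriesD n (A B : 'M[V]_n) xi eta :
  mxform (entries (A + B)) xi eta = mxform (entries A) xi eta +
    mxform (entries B) xi eta.
Proof.
rewrite -mxform_addl; apply: eq_mxform => i j.
by rewrite /entries mxE.
Qed.

Lemma mxform_entriesN n (A : 'M[V]_n) xi eta :
  mxform (entries (- A)) xi eta = - mxform (entries A) xi eta.
Proof.
rewrite -mxform_oppl; apply: eq_mxform => i j.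
by rewrite /entries mxE.
Qed.

Lemma entries_eq0 n (A : 'M[V]_n) :
  (forall xi, mxform (entries A) xi xi = 0) -> A = 0.
Proof.
move=> /(mxform_eq0 (@entries_linear _ A)) A0; apply/matrixP => i j.
by apply: gss_eqP; rewrite mxE; exact: A0.
Qed.

Lemma mxform_star n (A : 'M[V]_n) xi :
  mxform (entries (mxstar gss_star A)) xi xi = (mxform (entries A) xi xi)^*.
Proof.
apply: mxform_adj => i j; rewrite /entries mxE; exact: gss_starP.
Qed.

Lemma gss_pos_star n (A : 'M[V]_n) : gss_pos A -> mxstar gss_star A = A.
Proof.
move=> A0; apply/eqP; rewrite -subr_eq0; apply/eqP/entries_eq0 => xi.
rewrite mxform_entriesD mxform_entriesN mxform_star conj_Creal ?subrr//.
exact/ger0_real/A0.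
Qed.

Lemma gss_pos0 n : gss_pos (0 : 'M[V]_n).
Proof.
move=> xi; rewrite /mxform big1// => i _; rewrite big1// => j _.
by rewrite /entries mxE inner0l.
Qed.

Lemma gss_posD n (A B : 'M[V]_n) : gss_pos A -> gss_pos B -> gss_pos (A + B).
Proof.
by move=> A0 B0 xi; rewrite mxform_entriesD; apply: addr_ge0;
  [exact: A0|exact: B0].
Qed.

Lemma gss_posZ n (r : C) (A : 'M[V]_n) : 0 <= r -> gss_pos A ->
  gss_pos (map_mx (fun v => r *: v) A).
Proof.
move=> r0 A0 xi.
rewrite (_ : entries _ = fun i j => r *: entries A i j); last first.
  by apply/funext => i; apply/funext => j; rewrite /entries mxE.
by rewrite mxform_scalel mulr_ge0//; exact: A0.
Qed.

Lemma gss_pos_proper n (A : 'M[V]_n) : gss_pos A -> gss_pos (- A) -> A = 0.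
Proof.
move=> A0 NA0; apply: entries_eq0 => xi; apply/eqP; rewrite eq_le.
by have := NA0 xi; rewrite mxform_entriesN oppr_ge0 => ->; exact: A0.
Qed.

Lemma sum4_exchange (m n : nat) (G : 'I_m -> 'I_m -> 'I_n -> 'I_n -> C) :
  \sum_k \sum_l \sum_i \sum_j G k l i j = \sum_i \sum_j \sum_k \sum_l G k l i j.
Proof.
rewrite pair_bigA [RHS]pair_bigA /=.
under eq_bigr do rewrite pair_bigA /=.
under [RHS]eq_bigr do rewrite pair_bigA /=.
exact: exchange_big.
Qed.

(** The form of [compress a A] at [xi] is the form of [A] at [a xi]. *)
Lemma gss_pos_compress m n (a : 'M[C]_(m, n)) (A : 'M[V]_m) :
  gss_pos A -> gss_pos (compress a A).
Proof.
move=> A0 xi; have := A0 (fun k => \sum_j a k j *: xi j).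
rewrite (_ : mxform _ _ _ = mxform (entries (compress a A)) xi xi)//.
rewrite /mxform.
transitivity (\sum_k \sum_l \sum_i \sum_j
    (a k i)^* * a l j * l2_inner (A k l (xi j)) (xi i)).
  apply: eq_bigr => k _; apply: eq_bigr => l _; rewrite inner_sumr.
  apply: eq_bigr => i _; rewrite /entries (lin_sum (gss_linear _)) inner_suml.
  apply: eq_bigr => j _; rewrite (linZ (gss_linear _)) innerZl innerZr.
  by rewrite mulrA [a l j * _]mulrC.
rewrite sum4_exchange; apply: eq_bigr => i _; apply: eq_bigr => j _.
rewrite /entries mxE gss_sumE fct_sumE inner_suml; apply: eq_bigr => k _.
rewrite gss_sumE fct_sumE inner_suml; apply: eq_bigr => l _.
by rewrite gssZE innerZl.
Qed.

Lemma mxform_one n (r : C) xi :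
  mxform (entries (mxdiag_const n (r *: gss_one))) xi xi = r * nsqs xi.
Proof.
rewrite -mxform_diag; apply: eq_mxform => i j.
by rewrite /entries mxE; case: eqP.
Qed.

Lemma gss_order_unit n (A : 'M[V]_n) : mxstar gss_star A = A ->
  exists2 r : C, 0 < r & gss_pos (mxdiag_const n (r *: gss_one) + A).
Proof.
move=> hA; have [M M0 AM] := mxform_bound (fun i j => gss_boundedP (A i j)).
exists (M + 1); first by rewrite ltr_wpDl.
move=> xi; rewrite mxform_entriesD mxform_one.
set q := mxform _ _ _; have qR : q \is Num.real.
  by apply/CrealP; rewrite /q -mxform_star hA.
have := AM xi; rewrite -/q real_ler_norml// => /andP[+ _].
rewrite -subr_ge0 opprK => q0.
by rewrite mulrDl mul1r addrAC addr_ge0 ?nsqs_ge0// addrC.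
Qed.

Lemma real_archimedean (s q : C) : 0 <= s ->
  (forall r : C, 0 < r -> 0 <= r * s + q) -> 0 <= q.
Proof.
move=> s0 H; have qR : q \is Num.real.
  by rewrite -(addKr (1 * s) q) realD ?realN ?ger0_real ?H ?mul1r.
have [//|q0] := real_leP (real0 C) qR.
have s1 : 0 < s + 1 by rewrite ltr_wpDl.
have r0 : 0 < - q / (2 * (s + 1)).
  by rewrite divr_gt0 ?oppr_gt0 // mulr_gt0.
have := H _ r0; rewrite addrC -mulrA mulNr subr_ge0.
suff : q < q * ((2 * (s + 1))^-1 * s).
  by move=> h1 h2; have := lt_le_trans h1 h2; rewrite ltxx.
rewrite ltr_nMr // mulrC ltr_pdivrMr ?mulr_gt0 // mul1r.
by rewrite mulr_natl mulr2n ltr_wpDr ?ltrDl // ltW.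
Qed.

Lemma gss_archimedean n (A : 'M[V]_n) :
  (forall r : C, 0 < r -> gss_pos (mxdiag_const n (r *: gss_one) + A)) ->
    gss_pos A.
Proof.
move=> A0 xi; apply: (@real_archimedean (nsqs xi)); first exact: nsqs_ge0.
by move=> r r0; rewrite -mxform_one -mxform_entriesD; exact: A0.
Qed.

Definition gss_operator_system : operator_system R := OperatorSystem
  gss_starK gss_starD gss_starZ gss_star1 gss_pos_star gss_pos0
  gss_posD gss_posZ gss_pos_proper gss_pos_compress gss_order_unit
  gss_archimedean.

Definition gss_act (t : Gamma) (v : gss_operator_system) : gss_operator_system :=
  gss_mk (gss_conj t (gssP v)).

Lemma gss_actE t v xi : gss_act t v xi = shift t (v (shift t^-1%g xi)).
Proof. by []. Qed.

Lemma gss_act1 v : gss_act 1%g v = v.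
Proof. by apply: gss_eqP; apply/funext => xi; rewrite gss_actE invg1 !shift1. Qed.

Lemma gss_actM s t v : gss_act (s * t)%g v = gss_act s (gss_act t v).
Proof.
by apply: gss_eqP; apply/funext => xi; rewrite !gss_actE invgM !shiftM.
Qed.

Lemma gss_act_pos t n (A : 'M[gss_operator_system]_n) :
  gss_pos A -> gss_pos (map_mx (gss_act t) A).
Proof.
move=> A0 xi; rewrite (_ : mxform _ _ _ =
    mxform (entries A) (fun i => shift t^-1%g (xi i))
      (fun i => shift t^-1%g (xi i))).
  exact: A0.
apply: eq_bigr => i _; apply: eq_bigr => j _.
by rewrite /entries mxE gss_actE shift_adjoint.
Qed.

Lemma gss_act_iso t : unital_complete_order_isomorphism (gss_act t).
Proof.
have K s : cancel (gss_act s) (gss_act s^-1%g).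
  by move=> v; rewrite -gss_actM mulVg gss_act1.
have K' s : cancel (gss_act s^-1%g) (gss_act s).
  by move=> v; rewrite -gss_actM mulgV gss_act1.
split; first by exists (gss_act t^-1%g).
split=> [a f g||n A].
- apply: gss_eqP; apply/funext => xi.
  exact: ((shift_bounded R T t).1 a (f (shift t^-1%g xi)) (g (shift t^-1%g xi))).
- by apply: gss_eqP; apply/funext => xi; rewrite gss_actE /=
  -[LHS]/((shift t \o shift t^-1%g) xi)
    -shiftM mulgV shift1.
split; first exact: gss_act_pos.
move=> /(@gss_act_pos t^-1%g); rewrite (_ : map_mx _ (map_mx _ A) = A)//.
by apply/matrixP => i j; rewrite !mxE K.
Qed.

Definition gss_system : gamma_operator_system R Gamma :=
  @GammaOperatorSystem R Gamma gss_operator_system gss_act gss_act1 gss_actM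
    gss_act_iso.

End ConcreteSystem.

(** * Multiplication operators *)

Section Multiplication.
Variables (R : realType) (Gamma : groupType) (T : gset Gamma).
Local Notation C := R[i].
Local Notation H := (l2 R T).

Lemma full_conj t (f : H -> H) :
  bounded_operator f -> bounded_operator (shift t \o f \o shift t^-1%g).
Proof.
move=> bf; apply: bounded_comp; last exact: shift_bounded.
by apply: bounded_comp => //; exact: shift_bounded.
Qed.

Definition full_space : gamma_star_space R T :=
  GammaStarSpace (fun f bf => bf)
    (let: And5 _ s _ _ _ := @bounded_cstar R T in s)
    (@bounded_id R T) (@adjoint_bounded R T) full_conj.

Definition bounded_fun (u : T -> C) := exists M : C, 0 <= M /\ forall y, `|u y|
  <= M.

Lemma mulop_subproof u (bu : bounded_fun u) (xi : H) :
  (fun y => u y * xi y) \in @sq_summable R T.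
Proof.
case: bu => M [M0 uM].
apply: (@sq_summable_dom _ _ xi _ (sqnorm M)); last exact: l2_summable.
move=> y; rewrite sqnormM ler_wpM2r ?sqnorm_ge0 // -lecR !sqnormE.
by rewrite lerXn2r ?nnegrE // (ger0_norm M0).
Qed.

Definition mulop u (bu : bounded_fun u) (xi : H) : H := L2 (mulop_subproof bu xi).

Lemma mulopE u (bu : bounded_fun u) xi y : mulop bu xi y = u y * xi y.
Proof. by []. Qed.

Lemma mulop_bounded u (bu : bounded_fun u) : bounded_operator (mulop bu).
Proof.
have [M [M0 uM]] := bu; apply: (@norm_le_bounded _ _ _ (abs_re M)) => [a v w|xi].
  by apply/l2P => y; rewrite l2DE l2ZE !mulopE l2DE l2ZE; ring.
rewrite -(@ler_pXn2r _ 2) ?nnegrE ?l2_norm_ge0 ?mulr_ge0 ?abs_re_ge0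
  ?l2_norm_ge0//.
rewrite exprMn !l2_norm_sq; apply: nsq_le => A.
apply: (@le_trans _ _ (\sum_(y <- A) abs_re M ^+ 2 * sqnorm (xi y))).
  apply: ler_sum => y _; rewrite mulopE sqnormM ler_wpM2r ?sqnorm_ge0//.
  rewrite /sqnorm ler_pXn2r ?nnegrE ?abs_re_ge0//.
  by rewrite -lecR !abs_reE (ger0_norm M0).
by rewrite -mulr_sumr ler_wpM2l ?exprn_ge0 ?abs_re_ge0// nsq_partial.
Qed.

Lemma sum_inner_cvg (I : Type) (r : seq I) (F G : I -> H) :
  (fun A => \sum_(k <- r) summability.partial_sum
     (fun i => F k i * (G k i)^* : (C^o : normedModType C)) A)
  @ summability.totally --> (\sum_(k <- r) l2_inner (F k) (G k) :
    (C^o : normedModType C)).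
Proof.
elim: r => [|k r IH].
  rewrite big_nil; under eq_fun do rewrite big_nil.
  exact: cvg_cst.
rewrite big_cons; under eq_fun do rewrite big_cons.
by apply: cvgD; [exact: inner_cvg|exact: IH].
Qed.

Lemma nonneg_limit (L : C) :
  (forall e : C, 0 < e -> exists s : C, 0 <= s /\ `|L - s| < e) -> 0 <= L.
Proof.
move=> near; rewrite lecE; apply/andP; split.
  rewrite /= -normr_eq0 eq_le normr_ge0 andbT.
  rewrite leNgt; apply/negP => i0; have i0' :
    0 < `|complex.Im L|%:C%C :> C by rewrite ltcR.
  have [s []] := near _ i0'; rewrite lecE => /andP[/eqP ims _] hs.
  have e : complex.Im L = complex.Im (L - s) by rewrite raddfB/= ims subr0.
  by have := normc_ge_Im (L - s); rewrite -e => /le_lt_trans/(_ hs); rewrite ltxx.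
rewrite /= leNgt; apply/negP => r0.
have r0' : 0 < (- complex.Re L)%:C%C :> C by rewrite ltcR oppr_gt0.
have [s []] := near _ r0'; rewrite lecE => /andP[_ /= res] hs.
have := le_lt_trans (normc_ge_Re (L - s)) hs.
rewrite ltcR raddfB/= ltNge => /negP; apply.
by rewrite distrC; apply: le_trans (ler_norm _); rewrite lerDr.
Qed.

(** Positivity of a matrix of multiplication operators is checked at each
    coordinate; it survives the passage to the limit over finite sets. *)
Lemma sum_inner_ge0 (I : Type) (r : seq I) (F G : I -> H) :
  (forall y, 0 <= \sum_(k <- r) F k y * (G k y)^*) ->
  0 <= \sum_(k <- r) l2_inner (F k) (G k).
Proof.
move=> h; apply: nonneg_limit => e e0.
have /(@cvgrPdist_lt _ C^o) hL := @sum_inner_cvg _ r F G.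
have [A _ hA] := hL _ e0.
exists (\sum_(k <- r) \sum_(y <- A) F k y * (G k y)^*); split.
  by rewrite exchange_big; apply: sumr_ge0.
have /= := hA A (fsubset_refl _).
by rewrite (eq_bigr _ (fun k _ => partial_sumE _ A)).
Qed.

Lemma mulop_ge0 u (bu : bounded_fun u) xi :
  (forall y, 0 <= u y) -> 0 <= l2_inner (mulop bu xi) xi.
Proof.
move=> u0; have := @sum_inner_ge0 _ [:: tt] (fun _ => mulop bu xi) (fun _ => xi).
rewrite big_seq1; apply => y; rewrite big_seq1 mulopE -mulrA -normCK.
by rewrite mulr_ge0// exprn_ge0.
Qed.

Lemma mulop_adjoint u v (bu : bounded_fun u) (bv : bounded_fun v) :
  (forall y, v y = (u y)^*) -> is_adjoint (mulop bu) (mulop bv).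
Proof.
move=> uv xi eta.
have e : (fun y => mulop bu xi y * (eta y)^*)
  = (fun y => xi y * (mulop bv eta y)^*).
  by apply/funext => y; rewrite !mulopE uv rmorphM/= conjCK mulrCA mulrA.
by rewrite /l2_inner e.
Qed.

End Multiplication.

Section PullBack.
Variables (R : realType) (Gamma : groupType) (X : compact_gamma_space Gamma).
Variables (T : gset Gamma) (p : T -> X).
Hypothesis p_equiv : forall t y, p (gs_act T t y) = cgs_act X t (p y).
Local Notation C := R[i].
Local Notation H := (l2 R T).
Local Notation CX := (cfun_gamma_operator_system R X).
Local Notation BT := (gss_system (full_space R T)).

Lemma pullback_bounded (f : CX) : bounded_fun (fun y => (f : Cfun R X) (p y)).
Proof.
have [M M0 fM] := cfun_bounded (@cgs_compact _ X) f.
by exists M; split=> // y; exact: fM.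
Qed.

Definition pullback (f : CX) : BT := @gss_mk _ _ _ (full_space R T) _
  (mulop_bounded (pullback_bounded f)).

Lemma pullbackE f xi y : pullback f xi y = (f : Cfun R X) (p y) * xi y.
Proof. by []. Qed.

Lemma pullback_morphism : gamma_morphism pullback.
Proof.
split; first split=> [a f g||n A A0 xi].
- apply: gss_eqP; apply/funext => xi; apply/l2P => y.
  by rewrite pullbackE /= mulrDl -mulrA.
- by apply: gss_eqP; apply/funext => xi; apply/l2P => y; rewrite pullbackE mul1r.
- rewrite /mxform pair_bigA /=; apply: (@sum_inner_ge0 _ _ T
    _ _ (fun k => entries (map_mx pullback A) k.1 k.2 (xi k.2))
      (fun k => xi k.1)) => y.
  have := A0 (p y) (\col_i xi i y); rewrite -/(sform _ _ _) sformE pair_bigA /=.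
  rewrite (eq_bigr (fun k => entries (map_mx pullback A) k.1 k.2 (xi k.2) y *
    (xi k.1 y)^*))//.
  by move=> k _; rewrite /entries !mxE pullbackE; ring.
move=> t f; apply: gss_eqP; apply/funext => xi; apply/l2P => y.
rewrite gss_actE pullbackE shiftE pullbackE shiftE invgK p_equiv.
by rewrite gs_actKV.
Qed.

(** A vector supported at a point [y] recovers the scalar matrix at [p y] from
    the matrix of multiplication operators. *)
Lemma pullback_inclusion : (forall x, exists y, p y = x) ->
  gamma_inclusion pullback.
Proof.
move=> psurj; have [[lp p1 pp] pe] := pullback_morphism; split=> //;
  split=> // n A.
split=> [|A0 x v]; first exact: pp.
have [y yx] := psurj x; have := A0 (fun i => v i 0 *: l2_delta R y).
rewrite -/(sform _ _ _) sformE /mxform.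
rewrite (eq_bigr (fun i => \sum_j (v i 0)^* * cfun_eval A x i j * v j 0))// => i
  _.
apply: eq_bigr => j _; rewrite /entries !mxE innerZr inner_delta pullbackE l2ZE
  /= eqxx mulr1 yx.
by rewrite mulrA.
Qed.

End PullBack.

(** * Extremal disconnectedness of the boundary *)

Section Expectations.
Variables (R : realType) (Gamma : groupType) (X : compact_gamma_space Gamma).
Variables (T : gset Gamma).
Local Notation C := R[i].
Local Notation H := (l2 R T).
Local Notation CX := (cfun_gamma_operator_system R X).
Local Notation BT := (gss_system (full_space R T)).
Variable (Phi : BT -> CX).
Hypothesis PhiP : gamma_morphism Phi.

Definition at_point (y : X) (v : BT) : C := (Phi v : Cfun R X) y.

Lemma at_pointD y v w : at_point y (v + w) = at_point y v + at_point y w.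
Proof. by rewrite /at_point; case: PhiP => -[lP _ _] _; rewrite (linD lP). Qed.
Lemma at_pointN y v : at_point y (- v) = - at_point y v.
Proof. by rewrite /at_point; case: PhiP => -[lP _ _] _; rewrite (linN lP). Qed.
Lemma at_pointB y v w : at_point y (v - w) = at_point y v - at_point y w.
Proof. by rewrite at_pointD at_pointN. Qed.
Lemma at_pointZ y (a : C) v : at_point y (a *: v) = a * at_point y v.
Proof. by rewrite /at_point; case: PhiP => -[lP _ _] _; rewrite (linZ lP). Qed.
Lemma at_point_ge0 y (v : BT) : (forall xi, 0 <= l2_inner (gss_fun v xi) xi) ->
  0 <= at_point y v.
Proof.
move=> v0; case: PhiP => -[_ _ pP] _.
have A0 : gss_pos (const_mx v : 'M[gss_elt (full_space R T)]_1).
  by move=> xi; rewrite /mxform !big_ord1 /entries mxE.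
have := pP _ _ A0 y (const_mx 1); rewrite -/(sform _ _ _) sformE !big_ord1 !mxE.
by rewrite conjC1 mul1r mulr1.
Qed.

End Expectations.

Section ExtremallyDisconnected.
Variables (R : realType) (Gamma : groupType) (X : compact_gamma_space Gamma).
Local Notation C := R[i].
Local Notation CX := (cfun_gamma_operator_system R X).

Lemma cgs_closed_point (z : X) : closed [set z].
Proof.
apply: accessible_closed_set1; apply: hausdorff_accessible.
exact: (@cgs_hausdorff _ X).
Qed.

Lemma urysohn_cfun (A B : set X) : closed A -> closed B -> A `&` B = set0 ->
  exists f : Cfun R X, [/\ forall z, 0 <= f z <= 1, forall z, A z -> f z = 0 &
    forall z, B z -> f z = 1].
Proof.
move=> clA clB AB.
have nX : normal_space X by exact: compact_normal (@cgs_hausdorff _ X)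
  (@cgs_compact _ X).
have /(@uniform_separatorP _ R)[f [cf f01 fA fB]] :=
  normal_uniform_separator nX clA clB AB.
have cg : continuous (fun z => (f z)%:C%C : C^o).
  move=> z; have /cvgrPdist_lt hf := cf z.
  apply/(@cvgrPdist_lt _ C^o) => e e0.
  have eE : e = (complex.Re e)%:C%C by rewrite RRe_real// ger0_real// ltW.
  have e0' : 0 < complex.Re e by rewrite -ltcR -eE.
  apply: filterS (hf _ e0') => w.
  rewrite -rmorphB/= eE -ltcR; apply: le_lt_trans.
  by rewrite normc_def/= expr0n addr0 sqrtr_sqr.
exists (mkcts cg); split=> z.
- have : range f (f z) by exists z.
  by move=> /f01; rewrite /= in_itv/= => /andP[h0 h1]; rewrite !lecR h0 h1.
- move=> Az; have /fA/= e : (f @` A) (f z) by exists z.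
  by rewrite -[LHS]/((f z)%:C%C) e.
- move=> Bz; have /fB/= e : (f @` B) (f z) by exists z.
  by rewrite -[LHS]/((f z)%:C%C) e.
Qed.

Definition space_gset : gset Gamma := Gset (@cgs_act1 _ X) (@cgs_actM _ X).
Local Notation BX := (gss_system (full_space R space_gset)).
Local Notation embed := (@pullback R Gamma X space_gset id).

Definition indic (U : set X) (z : X) : C := (z \in U)%:R.

Lemma indic_bounded U : @bounded_fun R Gamma space_gset (indic U).
Proof. by exists 1; split=> // z; rewrite /indic; case: (_ \in _);
  rewrite ?normr1 ?normr0. Qed.

Definition projection U : BX :=
  @gss_mk _ _ _ (full_space R space_gset) _ (mulop_bounded (indic_bounded U)).

Hypothesis hX : hamana_boundary R X.

(** Injectivity extends the identity of [C(X)] to a positive map [P] on the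
    bounded operators. By positivity [P] of the projection onto [U] lies above the
    continuous functions below the indicator of [U] and below those above it, so
    Urysohn's lemma identifies it with the indicator of the closure of [U], which
    is therefore continuous. *)
Lemma closure_open (U : set X) : open U -> open (closure U).
Proof.
move=> oU; case: hX => injX _.
have idm : gamma_morphism (id : CX -> CX).
  split; last by move=> t f.
  split; [by move=> a u v|by []|move=> n A A0].
  by rewrite map_mx_id.
have emi : gamma_inclusion embed.
  by apply: pullback_inclusion => // x; exists x.
have [P Pm PE] := injX _ _ _ _ emi idm.
pose g : Cfun R X := P (projection U).
have le1 (f : Cfun R X) z : (forall z, f z <= indic U z) -> f z <= g z.
  move=> fU; rewrite -subr_ge0.
  have := @at_point_ge0 _ _ _ _ P Pm z (projection U - embed f) _.
  rewrite (at_pointB Pm) {2}/at_point PE; apply => xi.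
  have bu : @bounded_fun R Gamma space_gset (fun z => indic U z - f z).
    have [M1 [M10 h1]] := indic_bounded U;
      have [M2 M20 h2] := cfun_bounded (@cgs_compact _ X) f.
    exists (M1 + M2); split=> [|w]; first exact: addr_ge0.
    by apply: le_trans (ler_normB _ _) _; apply: lerD.
  have := mulop_ge0 bu xi; rewrite (_ : mulop bu xi
    = gss_fun (projection U - embed f) xi).
    by apply => w; rewrite subr_ge0.
  by apply/l2P => w; rewrite mulopE mulrBl.
have le2 (f : Cfun R X) z : (forall z, indic U z <= f z) -> g z <= f z.
  move=> fU; rewrite -subr_ge0.
  have := @at_point_ge0 _ _ _ _ P Pm z (embed f - projection U) _.
  rewrite (at_pointB Pm) {1}/at_point PE; apply => xi.
  have bu : @bounded_fun R Gamma space_gset (fun z => f z - indic U z).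
    have [M1 [M10 h1]] := indic_bounded U;
      have [M2 M20 h2] := cfun_bounded (@cgs_compact _ X) f.
    exists (M2 + M1); split=> [|w]; first exact: addr_ge0.
    by apply: le_trans (ler_normB _ _) _; apply: lerD.
  have := mulop_ge0 bu xi; rewrite (_ : mulop bu xi
    = gss_fun (embed f - projection U) xi).
    by apply => w; rewrite subr_ge0.
  by apply/l2P => w; rewrite mulopE mulrBl.
have g1 z : U z -> g z = 1.
  move=> Uz; apply/eqP; rewrite eq_le; apply/andP; split.
    apply: (le2 (cfun_cst X 1)) => w; rewrite /indic /=.
    by case: (_ \in _).
  have disj : (~` U) `&` [set z] = set0 by apply/disjoints_subset => w /= nUw
    wz; rewrite wz in nUw.
  have [f [f01 f0 f1]] := urysohn_cfun (open_closedC oU) (@cgs_closed_point z)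
    disj.
  rewrite -(f1 z)//; apply: le1 => w; rewrite /indic;
    have [wU|nwU] := pselect (U w).
    by rewrite mem_set//; case/andP: (f01 w).
  by rewrite memNset//= f0.
have g0 z : ~ closure U z -> g z = 0.
  move=> nUz.
  have disj : [set z] `&` closure U = set0 by apply/disjoints_subset => w /= ->.
  have [f [f01 f0 f1]] := urysohn_cfun (@cgs_closed_point z)
    (@closed_closure _ U) disj.
  apply/eqP; rewrite eq_le; apply/andP; split.
    rewrite -(f0 z)//; apply: le2 => w; rewrite /indic;
      have [wU|nwU] := pselect (U w).
      by rewrite mem_set// f1//; exact: subset_closure.
    by rewrite memNset//=; case/andP: (f01 w).
  apply: (le1 (cfun_cst X 0)) => w; rewrite /indic /=.
  by case: (_ \in _).
have clC (a : C) : open [set z : C^o | z != a].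
  rewrite (_ : [set _ | _] = ~` [set a]); last by apply/seteqP;
    split => z /= /eqP.
  apply: closed_openC; apply: accessible_closed_set1; apply: hausdorff_accessible.
  exact: norm_hausdorff.
have cg : continuous g by move=> z; exact: cts_fun.
rewrite (_ : closure U = g @^-1` [set z : C^o | z != 0]).
  by apply: open_comp => // z _; exact: cg.
apply/seteqP; split=> z /=; last by move=> gz; apply: contrapT => /g0 e;
  rewrite e eqxx in gz.
move=> Uz; suff -> : g z = 1 by rewrite oner_eq0.
apply: contrapT => /eqP gz1.
have oV : open (g @^-1` [set z : C^o | z != 1]) by apply: open_comp => // w _;
  exact: cg.
have [w [Uw]] := Uz _ (open_nbhs_nbhs (conj oV gz1)).
by rewrite /= g1// eqxx.
Qed.

End ExtremallyDisconnected.

(** * Fixed points of homeomorphisms *)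

(** Frolik's argument. Let [U] be a maximal open set disjoint from its image;
    it is also closed, because disjoint open sets have disjoint closures. The
    points moved by [h] are then covered by [U], its image and its preimage. *)
Lemma fixed_points_open (X : topologicalType) (h h' : X -> X) :
    hausdorff_space X -> (forall U : set X, open U -> open (closure U)) ->
    continuous h -> continuous h' -> cancel h h' -> cancel h' h ->
  open [set z | h z = z].
Proof.
move=> hX ed ch ch' hK h'K.
have oh A : open A -> open (h @^-1` A) by move=> oA; apply: open_comp => // z _;
  exact: ch.
have oh' A : open A -> open (h' @^-1` A) by move=> oA;
  apply: open_comp => // z _; exact: ch'.
pose P (U : set X) := open U /\ forall z, U z -> ~ U (h z).
have [F FP Ftot|U [[oU Uh] Umax]] := @Zorn_bigcup X P.
  split=> [|z [A FA Az] [B FB Bz]].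
    by apply: bigcup_open => A /FP[].
  have [AB|BA] := Ftot _ _ FA FB.
    by have [_ /(_ z (AB _ Az))] := FP _ FB; apply.
  by have [_ /(_ z Az)] := FP _ FA; apply; exact: BA.
have clU : closure U = U.
  apply: contrapT => cU; apply: (Umax (closure U)).
    split; first exact: subset_closure.
    by move=> cUU; apply: cU; apply/seteqP; split=> //; exact: subset_closure.
  split=> [|z cz chz]; first exact: ed.
  have [w [Uw chw]] := cz _ (open_nbhs_nbhs (conj (oh _ (ed _ oU)) chz)).
  have Uhw : U (h' (h w)) by rewrite hK.
  have [v [Uv Uhv]] := chw _ (open_nbhs_nbhs (conj (oh' _ oU) Uhw)).
  by apply: (Uh _ Uhv); rewrite h'K.
have cU : closed U by rewrite -clU; exact: closed_closure.
pose W := U `|` (h @^-1` U `|` h' @^-1` U).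
have cW : closed W.
  apply: closedU => //; apply: closedU.
    by move: (oh _ (closed_openC cU)); rewrite -openC.
  by move: (oh' _ (closed_openC cU)); rewrite -openC.
rewrite (_ : [set z | h z = z] = ~` W); first exact: closed_openC.
apply/seteqP; split=> z /=.
  move=> hz; have h'z : h' z = z by rewrite -{1}hz hK.
  have nU : ~ U z by move=> Uz; apply: (Uh _ Uz); rewrite hz.
  by rewrite /W /= hz h'z => -[//|[|]].
move=> nWz; apply: contrapT => hz.
have [[A B] /= [zA hzB] [oA oB AB]] : exists2 AB :
  set X * set X, (z \in AB.1 /\ h z \in AB.2) &
    [/\ open AB.1, open AB.2 & AB.1 `&` AB.2 = set0].
  have zhz : z != h z by apply/eqP => e; apply: hz.
  move: hX; rewrite open_hausdorff => /(_ _ _ zhz)[AB h1 [oA oB /eqP AB0]].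
  by exists AB.
(* [V] could be added to [U], contradicting maximality. *)
pose V := A `&` (h @^-1` B `&` ~` W).
have Vz : V z by split; [exact: set_mem|split=> //; exact: set_mem hzB].
apply: (Umax (U `|` V)).
  split; first by move=> w; left.
  by move=> /(_ z (or_intror Vz)) Uz; apply: nWz; left.
split.
  by apply: openU => //; apply: openI => //; apply: openI;
    [exact: oh|exact: closed_openC].
move=> w [Uw|[Aw [Bhw nWw]]] [Uhw|[Ahw [_ nWhw]]].
- exact: (Uh _ Uw).
- by apply: nWhw; right; right; rewrite /= hK.
- by apply: nWw; right; left.
- by have : (A `&` B) (h w) by []; rewrite AB.
Qed.

(** * States restricting to a point evaluation *)

Lemma affine_ge0_eq0 (R : realType) (d u : R[i]) :
  (forall r : R[i], r \is Num.real -> 0 <= d + r * u) -> u = 0.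
Proof.
move=> h; have dR : d \is Num.real.
  by have := h 0 (real0 _); rewrite mul0r addr0 => /ger0_real.
have uR : u \is Num.real.
  have := h 1 (real1 _); rewrite mul1r => /ger0_real.
  by rewrite -{2}(addKr d u) => ?; rewrite realD// realN.
apply/eqP; apply: contraT => u0.
have rR : - (d + 1) / u \is Num.real by rewrite realM ?realV ?realN ?realD ?real1.
have := h _ rR; rewrite mulfVK// opprD addrA subrr add0r oppr_ge0.
by rewrite ler10.
Qed.

Section FullAlgebra.
Variables (R : realType) (Gamma : groupType) (T : gset Gamma).
Local Notation C := R[i].
Local Notation H := (l2 R T).
Local Notation BT := (gss_elt (full_space R T)).
Implicit Types (v w a c : BT).

Definition full_op (f : H -> H) (bf : bounded_operator f) : BT :=
  @gss_mk _ _ _ (full_space R T) f bf.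

Definition opmul v w : BT := full_op (bounded_comp (gss_boundedP v)
  (gss_boundedP w)).

Lemma opmulE v w xi : opmul v w xi = v (w xi). Proof. by []. Qed.

Lemma opmulDl v v' w : opmul (v + v') w = opmul v w + opmul v' w.
Proof. exact: gss_eqP. Qed.

Lemma opmulZl (z : C) v w : opmul (z *: v) w = z *: opmul v w.
Proof. exact: gss_eqP. Qed.

Lemma opmulDr v w w' : opmul v (w + w') = opmul v w + opmul v w'.
Proof. by apply: gss_eqP; apply/funext => xi;
  exact: (linD (gss_linear v) (w xi) (w' xi)). Qed.

Lemma opmulZr (z : C) v w : opmul v (z *: w) = z *: opmul v w.
Proof. by apply: gss_eqP; apply/funext => xi;
  exact: (linZ (gss_linear v) z (w xi)). Qed.

Lemma opmul_star_ge0 v xi : 0 <= l2_inner (opmul (gss_star v) v xi) xi.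
Proof. by rewrite opmulE -inner_conj -(gss_starP v) inner_conj inner_ge0. Qed.

End FullAlgebra.

Section ValuesOnShifts.
Variables (R : realType) (Gamma : groupType) (X : compact_gamma_space Gamma).
Variables (T : gset Gamma) (p : T -> X).
Hypothesis p_equiv : forall t y, p (gs_act T t y) = cgs_act X t (p y).
Hypothesis p_inj : injective p.
Local Notation C := R[i].
Local Notation H := (l2 R T).
Local Notation CX := (cfun_gamma_operator_system R X).
Local Notation BT := (gss_system (full_space R T)).
Variable (Phi : BT -> CX).
Hypothesis PhiP : gamma_morphism Phi.

(** The Cauchy-Schwarz inequality for the state [at_point Phi y], in the case
    where its right-hand side vanishes. *)
Lemma at_point_null y (a c : BT) : at_point Phi y (opmul (gss_star c) c) = 0 ->
  at_point Phi y (opmul (gss_star c) a) = 0 /\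
  at_point Phi y (opmul (gss_star a) c) = 0.
Proof.
move=> c0; set q := at_point _ _ _; set r := at_point _ _ _.
pose d := at_point Phi y (opmul (gss_star a) a).
have key (z : C) : 0 <= d + (z * r + z^* * q).
  have := at_point_ge0 PhiP y (opmul_star_ge0 (a + z *: c)).
  rewrite gss_starD gss_starZ !opmulDl !opmulDr !opmulZl !opmulZr.
  rewrite !(at_pointD PhiP) !(at_pointZ PhiP) c0 !mulr0 addr0 -/q -/r -/d.
  by rewrite addrA.
have e1 : r + q = 0.
  apply: (@affine_ge0_eq0 _ d) => s sR; rewrite mulrDr.
  by have := key s; rewrite conj_Creal.
have e2 : 'i * (r - q) = 0.
  apply: (@affine_ge0_eq0 _ d) => s sR.
  have := key ('i * s); rewrite rmorphM/= conjCi conj_Creal//.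
  by rewrite (_ : 'i * s * r + - 'i * s * q = s * ('i * (r - q))); last by ring.
move/eqP: e2; rewrite mulf_eq0 (negPf (neq0Ci _)) subr_eq0 => /eqP rq.
move/eqP: e1; rewrite rq -mulr2n mulrn_eq0/= => /eqP q0.
by rewrite q0.
Qed.

Local Notation pb := (@pullback R Gamma X T p).
Hypothesis PhiK : forall f : CX, Phi (pb f) = f.

Lemma at_point_pullback y (f : CX) : at_point Phi y (pb f) = (f : Cfun R X) y.
Proof. by rewrite /at_point PhiK. Qed.

(** Multiplication by [f] composed with its adjoint is multiplication by
    [|f|^2], and [Phi] sends it to a function vanishing at [y]. *)
Lemma at_point_vanishing y (f : CX) (a : BT) : (f : Cfun R X) y = 0 ->
  at_point Phi y (opmul (pb f) a) = 0 /\ at_point Phi y (opmul a (pb f)) = 0.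
Proof.
move=> fy.
have starE (g : CX) : gss_star (pb g : gss_elt (full_space R T))
  = pb (cfun_conj (g : Cfun R X) : CX).
  by apply: gss_starE; apply: mulop_adjoint.
have null (g : CX) : (g : Cfun R X) y = 0 ->
  at_point Phi y (opmul (gss_star (pb g : gss_elt (full_space R T))) (pb g)) = 0.
  move=> gy; rewrite starE; pose g2 : CX := cfun_conj (g : Cfun R X).
  have cg2 : continuous (fun z => (g2 : Cfun R X) z * (g : Cfun R X) z : C^o).
    by move=> z; apply: cvgM; exact: cts_fun.
  rewrite (_ : opmul _ _ = pb (mkcts cg2 : CX)).
    by rewrite at_point_pullback -[LHS]/((g2 : Cfun R X) y * (g : Cfun R X) y)
      gy mulr0.
  by apply: gss_eqP; apply/funext => xi; apply/l2P => z;
    rewrite opmulE !pullbackE mulrA.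
split.
  have := (at_point_null a (null (cfun_conj (f : Cfun R X) : CX) _)).1.
  by rewrite starE cfun_starK; apply; rewrite cfun_conjE fy conjC0.
by have := (at_point_null (gss_star (a : gss_elt (full_space R T)))
  (null f fy)).2; rewrite gss_starK.
Qed.

(** The state at [y] only sees [a] near [y]. *)
Lemma at_point_localize y (f : Cfun R X) (a : BT) : f y = 1 ->
  at_point Phi y a = at_point Phi y (opmul (pb f) a).
Proof.
move=> fy; have f0 : (cfun_cst X 1 - f : Cfun R X) y = 0.
  by rewrite cfunDE cfunNE fy subrr.
have [e _] := at_point_vanishing a f0.
rewrite -[LHS]subr0 -e -(at_pointB PhiP); congr at_point.
apply: gss_eqP; apply/funext => xi; apply/l2P => z.
rewrite -[LHS]/(gss_fun a xi z - (1 - f (p z)) * gss_fun a xi z).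
by rewrite -[RHS]/(f (p z) * gss_fun a xi z); ring.
Qed.

Definition shift_op t : BT := full_op (shift_bounded R T t).

(** Take [f] equal to 1 at [y] and 0 at [t y]. The value at the translation
    operator [u] of [t] is its value at [f u = u (f o t)], and [f o t] vanishes at
    [y]. *)
Lemma at_point_shift_moved t y : cgs_act X t (p y) <> p y ->
  at_point Phi (p y) (shift_op t) = 0.
Proof.
move=> ty.
have disj : [set cgs_act X t (p y)] `&` [set p y] = set0.
  by apply/disjoints_subset => w /= ->.
have [f [_ f0 f1]] := urysohn_cfun R (@cgs_closed_point _ X _)
  (@cgs_closed_point _ X _) disj.
rewrite (at_point_localize (shift_op t) (f1 _ erefl)).
pose g : CX := cfun_act t^-1%g (f : CX).
have gy : (g : Cfun R X) (p y) = 0 by rewrite /g cfun_actE invgK f0.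
have [_ e2] := at_point_vanishing (shift_op t) gy.
rewrite -[RHS]e2; congr at_point; apply: gss_eqP; apply/funext => xi;
  apply/l2P => z.
rewrite -[LHS]/(f (p z) * shift t xi z) -[RHS]/(shift t (pb g xi) z) !shiftE
  pullbackE.
by rewrite /g cfun_actE invgK -p_equiv gs_actKV.
Qed.

(** Take [f] equal to 1 at [y] and supported in [U]. With [u] the translation
    operator of [t], the operators [f u] and [f] are equal. *)
Lemma at_point_shift_fixed t y (U : set X) : open U -> U (p y) ->
  (forall z, U z -> cgs_act X t z = z) ->
  at_point Phi (p y) (shift_op t) = 1.
Proof.
move=> oU Uy Ut.
have disj : (~` U) `&` [set p y] = set0.
  by apply/disjoints_subset => w /= nUw wz; rewrite wz in nUw.
have [f [_ f0 f1]] := urysohn_cfun R (open_closedC oU) (@cgs_closed_point _ X _)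
  disj.
rewrite (at_point_localize (shift_op t) (f1 _ erefl)).
rewrite (_ : opmul _ _ = pb f) ?at_point_pullback ?f1//.
apply: gss_eqP; apply/funext => xi; apply/l2P => z.
rewrite -[LHS]/(f (p z) * shift t xi z) pullbackE shiftE.
have [Uz|nUz] := pselect (U (p z)); last by rewrite f0// !mul0r.
congr (_ * xi _); apply: (can_inj (gs_actK t)).
by rewrite gs_actKV; apply: p_inj; rewrite p_equiv Ut.
Qed.

End ValuesOnShifts.

(** * Ideals not containing the identity *)

Section Neumann.
Variables (R : realType) (T : choiceType).
Local Notation C := R[i].
Local Notation H := (l2 R T).
Variables (A I : set (H -> H)).
Hypotheses (A1 : A id) (AD : forall f g, A f -> A g -> A (f + g)).
Hypotheses (Ab : A `<=` @bounded_operator R T) (hI : closed_ideal A I).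

Lemma ideal_sub f : I f -> A f. Proof. by case: hI => + _ _ _ _; apply. Qed.
Lemma ideal0 : I 0. Proof. by case: hI => _ [? _ _] _ _ _. Qed.
Lemma idealD f g : I f -> I g -> I (f + g).
Proof. by case: hI => _ [_ + _] _ _ _; exact. Qed.
Lemma idealZ a f : I f -> I (a *: f).
Proof. by case: hI => _ [_ _ +] _ _ _; exact. Qed.
Lemma idealN f : I f -> I (- f).
Proof. by rewrite -scaleN1r; exact: idealZ. Qed.
Lemma idealMl a f : A a -> I f -> I (a \o f).
Proof. by case: hI => _ _ + _ _; exact. Qed.
Lemma idealMr a f : A a -> I f -> I (f \o a).
Proof. by case: hI => _ _ _ + _; exact. Qed.
Lemma ideal_closed f : A f -> norm_closure I f -> I f.
Proof. by case: hI => _ _ _ _ + Af cf; apply. Qed.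

Lemma ideal_full : I id -> I = A.
Proof.
move=> I1; apply/seteqP; split=> [f|f Af]; first exact: ideal_sub.
exact: (@idealMl f id).
Qed.

Lemma exp_small (q e : R) : 0 <= q < 1 -> 0 < e -> exists n, q ^+ n <= e.
Proof.
move=> /andP[q0 q1] e0.
have : (fun n => q ^+ n) @ \oo --> (0 : R) by apply: cvg_expr; rewrite ger0_norm.
move=> /cvgrPdist_le/(_ _ e0)[n _ /(_ n (leqnn n))].
by rewrite /= sub0r normrN normrX ger0_norm// => h; exists n.
Qed.

(** [1 - (1 - b)^n] lies in [I] and tends to 1. *)
Lemma ideal_neumann (b : H -> H) (q : R) : I b -> 0 <= q < 1 ->
  norm_le (id - b) q -> I id.
Proof.
move=> Ib q01 bq; have [lb _] := Ab (ideal_sub Ib).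
have q0 : 0 <= q by case/andP: q01.
apply: ideal_closed => //; split=> [|e e0]; first exact: bounded_id.
have [n qn] := exp_small q01 e0.
suff [g Ig gn] : exists2 g, I g & norm_le (id - g) (q ^+ n).
  by exists g => // xi; exact: norm_le_trans qn gn xi.
elim: n {qn} => [|n [g Ig gn]].
  by exists 0; [exact: ideal0|rewrite subr0 expr0; exact: norm_le_id].
have [lg _] := Ab (ideal_sub Ig).
exists (g \o (id + - b) + b).
  apply: idealD => //; apply: idealMr => //.
  by apply: AD => //; apply: ideal_sub; exact: idealN.
rewrite exprSr (_ : id - _ = (id - g) \o (id - b)).
  by apply: norm_le_comp => //; exact: exprn_ge0.
apply/funext => xi; rewrite !fctE /= opprD addrA addrAC.
by rewrite -[in LHS]/(idfun xi) /=.
Qed.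

(** Expanding the square shows that [1 - s u b] has norm less than 1 for small
    positive [s]. *)
Lemma ideal_coercive (b : H -> H) (u : C) (d : R) : I b -> 0 < d ->
    (forall xi, d * nsq xi <= complex.Re (u * l2_inner (b xi) xi)) -> I id.
Proof.
move=> Ib d0 h; have Iub : I (u *: b) by exact: idealZ.
have [M M0 ubM] := bounded_norm_le (Ab (ideal_sub Iub)).
have h' xi : d * nsq xi <= complex.Re (l2_inner ((u *: b) xi) xi).
  by rewrite fctE innerZl.
pose N := M + d; have N0 : 0 < N by rewrite ltr_wpDl.
have ubN : norm_le (u *: b) N by apply: norm_le_trans ubM; rewrite lerDl ltW.
(* This [s] minimizes the bound [1 - 2 s d + s^2 N^2] of the squared norm. *)
pose s := d / N ^+ 2.
have s0 : 0 < s by rewrite divr_gt0// exprn_gt0.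
have r01 : 0 <= 1 - (d / N) ^+ 2 < 1.
  rewrite subr_ge0 gtrBl exprn_gt0 ?divr_gt0// andbT expr_le1//;
    last by rewrite divr_ge0// ltW.
  by rewrite ler_pdivrMr// mul1r lerDr.
have /andP[r0 r1] := r01.
apply: (@ideal_neumann (s%:C%C *: (u *: b)) (Num.sqrt (1 - (d / N) ^+ 2))).
- exact: idealZ.
- by rewrite sqrtr_ge0 -[ltRHS]sqrtr1 ltr_sqrt.
move=> xi; rewrite -(@ler_pXn2r _ 2) ?nnegrE ?mulr_ge0 ?sqrtr_ge0 ?l2_norm_ge0//.
rewrite exprMn !l2_norm_sq sqr_sqrtr//.
have nsqE v : nsq (xi - s%:C%C *: v) =
    nsq xi - 2 * s * complex.Re (l2_inner v xi) + s ^+ 2 * nsq v.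
  have nE w : nsq w = complex.Re (l2_inner w w) by rewrite inner_nsq.
  rewrite nE innerBl !innerBr !innerZl !innerZr -[l2_inner xi v]inner_conj
    !inner_nsq.
  rewrite conj_Creal; last by apply: ger0_real; rewrite lecR ltW.
  by case: (l2_inner v xi) => x y; rewrite /=; simpc => /=; ring.
rewrite -[X in nsq X <= _]/(xi - s%:C%C *: ((u *: b) xi)) nsqE.
have hv : nsq ((u *: b) xi) <= N ^+ 2 * nsq xi.
  rewrite -!l2_norm_sq -exprMn ler_pXn2r ?nnegrE ?l2_norm_ge0 ?mulr_ge0
    ?l2_norm_ge0 ?(ltW N0)//.
have e1 : s ^+ 2 * (N ^+ 2 * nsq xi) = (d / N) ^+ 2 * nsq xi.
  by rewrite /s; field; rewrite gt_eqF.
have e2 : 2 * s * (d * nsq xi) = 2 * ((d / N) ^+ 2 * nsq xi).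
  by rewrite /s; field; rewrite gt_eqF.
have i1 := ler_wpM2l (exprn_ge0 2 (ltW s0)) hv.
have i2 : 2 * s * (d * nsq xi) <= 2 * s * complex.Re (l2_inner ((u *: b) xi) xi).
  by apply: ler_wpM2l; [rewrite mulr_ge0// ltW|exact: h'].
rewrite e1 in i1; rewrite e2 in i2; rewrite mulrBl mul1r.
move: i1 i2; set X := _ * nsq xi; lra.
Qed.

(** If [c] is not a nonnegative real number, then for some [u] among 1, [i] and
    [-i] the number [- u c] has positive real part while that of [u] is
    nonnegative. As [w] is positive, [u b = u w - u c] is then coercive. *)
Lemma ideal_scalar_ge0 (w b : H -> H) (c : C) : ~ I id -> I b ->
  w = c *: id + b -> (forall xi, 0 <= l2_inner (w xi) xi) -> 0 <= c.
Proof.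
move=> nI Ib wE w0.
have bE xi : l2_inner (b xi) xi = l2_inner (w xi) xi - c * (nsq xi)%:C%C.
  by rewrite wE fctE innerDl innerZl inner_nsq addrAC subrr add0r.
have wR xi : exists s : R, 0 <= s /\ l2_inner (w xi) xi = s%:C%C.
  have := w0 xi; case: (l2_inner _ _) => x y;
    rewrite lecE /= => /andP[/eqP -> x0].
  by exists x.
apply: contrapT => nc; apply: nI.
case: c nc bE {wE} => c1 c2 nc bE.
have [c10|c10] := ltP c1 0.
  apply: (@ideal_coercive b 1 (- c1)) => //; first by rewrite oppr_gt0.
  move=> xi; rewrite mul1r bE; have [s [s0 ->]] := wR xi.
  by rewrite /=; simpc; rewrite /= lerDr.
have [c20|c20|c20] := ltgtP c2 0.
- apply: (@ideal_coercive b (- 'i) (- c2)) => //; first by rewrite oppr_gt0.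
  move=> xi; rewrite bE -complexiE; have [s [s0 ->]] := wR xi.
  by rewrite /=; simpc => /=; rewrite le_eqVlt; apply/orP; left; apply/eqP; ring.
- apply: (@ideal_coercive b 'i c2) => //.
  move=> xi; rewrite bE -complexiE; have [s [s0 ->]] := wR xi.
  by rewrite /=; simpc => /=; rewrite le_eqVlt; apply/orP; left; apply/eqP; ring.
- by exfalso; apply: nc; rewrite lecE /= c20 eqxx.
Qed.

End Neumann.

(** * The operator system attached to a proper ideal *)

Section IdealSystem.
Variables (R : realType) (Gamma : groupType) (X : compact_gamma_space Gamma).
Variable T : gset Gamma.
Local Notation C := R[i].
Local Notation H := (l2 R T).
Local Notation CX := (cfun_gamma_operator_system R X).
Variables (A I : set (H -> H)).
Hypotheses (A1 : A id) (AD : forall f g, A f -> A g -> A (f + g)).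
Hypotheses (Ab : A `<=` @bounded_operator R T) (hI : closed_ideal A I).
Hypotheses (Ashift : forall t, A (shift t)) (nI : ~ I id).

(** Restricting to the elements whose adjoint lies in [I] makes the scalars
    plus this part self-adjoint. It contains [a^* a] for every [a] in [I]. *)
Definition symmetric_ideal (b : H -> H) :=
  I b /\ exists2 b', is_adjoint b b' & I b'.
Local Notation J := symmetric_ideal.

Definition unitized (f : H -> H) := exists c : C, J (f - c *: id).

Lemma symmetric_ideal0 : J 0.
Proof. by split; [exact: ideal0 hI|exists 0;
  [exact: adjoint0|exact: ideal0 hI]]. Qed.
Lemma symmetric_idealD f g : J f -> J g -> J (f + g).
Proof.
move=> [If [f' ff If']] [Ig [g' gg Ig']]; split; first exact: (idealD hI).
by exists (f' + g'); [exact: adjointD|exact: (idealD hI)].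
Qed.
Lemma symmetric_idealZ a f : J f -> J (a *: f).
Proof.
move=> [If [f' ff If']]; split; first exact: (idealZ hI).
by exists (a^* *: f'); [exact: adjointZ|exact: (idealZ hI)].
Qed.
Lemma symmetric_ideal_adjoint f g : J f -> is_adjoint f g -> J g.
Proof.
move=> [If [f' ff If']] fg; rewrite -(adjoint_uniq ff fg); split=> //.
by exists f => //; exact: adjoint_sym.
Qed.
Lemma symmetric_ideal_conj t f : J f -> J (shift t \o f \o shift t^-1%g).
Proof.
have K g : I g -> I (shift t \o g \o shift t^-1%g).
  by move=> Ig; apply: (idealMr hI) => //; apply: (idealMl hI).
move=> [If [f' ff If']]; split; first exact: K.
exists (shift t \o f' \o shift t^-1%g); last exact: K.
move=> xi eta; rewrite /= shift_adjoint ff.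
exact: (adjoint_sym (shift_adjoint t)).
Qed.

Lemma unitizedD f g c d : J (f - c *: id) -> J (g - d *: id) ->
  J (f + g - (c + d) *: id).
Proof. by move=> /symmetric_idealD h /h; rewrite scalerDl opprD addrACA. Qed.

Lemma unitizedZ a f c : J (f - c *: id) -> J (a *: f - (a * c) *: id).
Proof. by move=> /(symmetric_idealZ a); rewrite scalerBr scalerA. Qed.

Lemma unitized_adj f g c : J (f - c *: id) -> is_adjoint f g -> J (g - c^* *: id).
Proof.
move=> Jf fg; apply: symmetric_ideal_adjoint Jf _; apply: adjointD => //;
  apply: adjointN.
exact: adjointZ.
Qed.

Lemma unitized_conj t f c : J (f - c *: id) ->
  J ((shift t \o f \o shift t^-1%g) - c *: id).
Proof.
move=> /(symmetric_ideal_conj t); congr J; apply/funext => xi; rewrite !fctE /=.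
have [ls _] := shift_bounded R T t.
rewrite (linB ls) (linZ ls); congr (_ - _ *: _).
by rewrite -[LHS]/((shift t \o shift t^-1%g) xi) -shiftM mulgV shift1.
Qed.

Lemma unitized_bounded f : unitized f -> bounded_operator f.
Proof.
move=> [c [If _]]; rewrite -(subrK (c *: id) f); apply: boundedD.
  by apply: Ab; exact: (ideal_sub hI).
by apply: boundedZ; exact: bounded_id.
Qed.

Lemma unitized_subspace : operator_subspace unitized.
Proof.
split=> [|f g [c Jf] [d Jg]|a f [c Jf]].
- by exists 0; rewrite scale0r subr0; exact: symmetric_ideal0.
- by exists (c + d); exact: (unitizedD Jf Jg).
- by exists (a * c); exact: (unitizedZ a Jf).
Qed.

Lemma unitized1 : unitized id.
Proof. by exists 1; rewrite scale1r subrr; exact: symmetric_ideal0. Qed.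

Lemma unitized_adjoint f g : unitized f -> is_adjoint f g -> unitized g.
Proof. by move=> [c Jf] fg; exists c^*; exact: (unitized_adj Jf fg). Qed.

Lemma unitized_conjugate t f : unitized f ->
  unitized (shift t \o f \o shift t^-1%g).
Proof. by move=> [c Jf]; exists c; exact: (unitized_conj t Jf). Qed.

Definition unitized_space : gamma_star_space R T := GammaStarSpace
  unitized_bounded unitized_subspace unitized1 unitized_adjoint
    unitized_conjugate.
Local Notation SJ := (gss_system unitized_space).

(** A nonzero scalar in [I] would put the identity in [I]. *)
Lemma unitized_uniq f c d : J (f - c *: id) -> J (f - d *: id) -> c = d.
Proof.
move=> [Ic _] [Id _]; apply/eqP; apply: contraT => cd; exfalso; apply: nI.
have : I ((f - d *: id) - (f - c *: id)).
  by apply: (idealD hI) => //; exact: (idealN hI).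
rewrite opprD addrACA subrr add0r opprK addrC -scalerBl.
have cd0 : c - d != 0 by rewrite subr_eq0.
by move=> /(idealZ hI (c - d)^-1); rewrite scalerA mulVf// scale1r.
Qed.

Definition coef (v : gss_elt unitized_space) : C :=
  xget 0 [set c | J (gss_fun v - c *: id)].

Lemma coefP v : J (gss_fun v - coef v *: id).
Proof. exact: (xgetPex 0 (gssP v)). Qed.

Lemma coefE v c : J (gss_fun v - c *: id) -> coef v = c.
Proof. exact: unitized_uniq (coefP v). Qed.

Lemma coefD v w : coef (v + w) = coef v + coef w.
Proof. by apply: coefE; rewrite gssDE; exact: (unitizedD (coefP v) (coefP w)).
  Qed.
Lemma coefZ a v : coef (a *: v) = a * coef v.
Proof. by apply: coefE; rewrite gssZE; exact: (unitizedZ a (coefP v)). Qed.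
Lemma coef0 : coef 0 = 0.
Proof. by rewrite -(scale0r 0) coefZ mul0r. Qed.
Lemma coef_sum (K : Type) (r : seq K) (P : pred K) F :
  coef (\sum_(k <- r | P k) F k) = \sum_(k <- r | P k) coef (F k).
Proof. by apply: (big_morph coef) => [u v|]; [exact: coefD|exact: coef0]. Qed.

Lemma coef_ge0 v : (forall xi, 0 <= l2_inner (gss_fun v xi) xi) -> 0 <= coef v.
Proof.
apply: (@ideal_scalar_ge0 _ _ A I A1 AD Ab hI _ (gss_fun v - coef v *: id)) => //.
  by case: (coefP v).
by rewrite addrC subrK.
Qed.

Definition coef_map (v : SJ) : CX := cfun_cst X (coef v).

(** Compressing a positive matrix by a vector [u] reduces positivity of the
    matrix of coefficients to the scalar case. *)
Lemma coef_morphism : gamma_morphism coef_map.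
Proof.
split; first split=> [a v w||n M M0 x u].
- by apply/continuousEP => x; rewrite /= coefD coefZ.
- apply/continuousEP => x /=; apply: coefE.
  by rewrite scale1r subrr; exact: symmetric_ideal0.
- rewrite -/(sform _ _ _) sformE.
  have /(_ _ u) cM := gss_pos_compress (S := unitized_space) _ M0.
  rewrite (_ : \sum_i _ = coef (compress u (M : 'M[gss_elt unitized_space]_n) 0
    0)).
    apply: coef_ge0 => xi; have := cM (fun _ => xi).
    by rewrite /mxform !big_ord1.
  rewrite mxE coef_sum; apply: eq_bigr => i _; rewrite coef_sum.
  by apply: eq_bigr => j _; rewrite coefZ !mxE mulrAC.
move=> t v; apply/continuousEP => x; rewrite cfun_actE /=.
by apply: coefE; exact: (unitized_conj t (coefP v)).
Qed.

Local Notation BT := (gss_system (full_space R T)).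

Definition unitized_incl (v : SJ) : BT := full_op
  (gss_boundedP (v : gss_elt unitized_space)).

Lemma unitized_inclP : gamma_inclusion unitized_incl.
Proof.
split; last by move=> t v; exact: gss_eqP.
split=> [a v w||n M]; [exact: gss_eqP|exact: gss_eqP|].
have e xi : mxform (entries (map_mx unitized_incl M :
  'M[gss_elt (full_space R T)]_n)) xi xi =
    mxform (entries (M : 'M[gss_elt unitized_space]_n)) xi xi.
  by apply: eq_bigr => i _; apply: eq_bigr => j _; rewrite /entries mxE.
by split=> M0 xi; [rewrite e|rewrite -e]; exact: M0.
Qed.

(** Gamma-injectivity extends [coef_map] to all bounded operators, and the
    elements of [J] have coefficient 0. *)
Lemma ideal_annihilator : gamma_injective CX ->
  exists2 Phi : BT -> CX, gamma_morphism Phi &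
    forall b (bb : bounded_operator b), J b -> Phi (full_op bb) = cfun_cst X 0.
Proof.
move=> inj; have [Phi PhiP PhiE] := inj _ _ _ _ unitized_inclP coef_morphism.
exists Phi => // b bb Jb.
have Ub : unitized b by exists 0; rewrite scale0r subr0.
have -> : full_op bb = unitized_incl (gss_mk (S := unitized_space) Ub) by exact:
  gss_eqP.
rewrite PhiE /coef_map (@coefE _ 0)//.
by rewrite scale0r subr0.
Qed.

End IdealSystem.

(** * The orbit representation *)

Section Agreement.
Variables (R : realType) (Gamma : groupType) (K : gset Gamma).
Local Notation C := R[i].
Local Notation H := (l2 R K).
Local Notation A := (cstar_generated (range (@shift R Gamma K))).

Lemma shift_algebra_cstar : cstar_subalgebra A.
Proof.
by apply: cstar_generated_cstar => _ [t _ <-]; exact: shift_bounded.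
Qed.

Lemma shift_algebra_shift t : A (shift t).
Proof. by move=> B [_ SB]; apply: SB; exists t. Qed.

Lemma shift_algebra1 : A id.
Proof. by rewrite -(@shift1 R Gamma K); exact: shift_algebra_shift. Qed.

Definition positive_functional (om : (H -> H) -> C) :=
  [/\ forall f g, A f -> A g -> om (f + g) = om f + om g,
      forall a f, A f -> om (a *: f) = a * om f &
      forall f g, A f -> is_adjoint f g -> 0 <= om (g \o f)].

(** Both functionals are bounded and the span of the translations is dense. *)
Lemma positive_functional_eq (om1 om2 : (H -> H) -> C) :
  positive_functional om1 -> positive_functional om2 ->
  (forall t, om1 (shift t) = om2 (shift t)) ->
  forall f, A f -> om1 f = om2 f.
Proof.
move=> [D1 Z1 p1] [D2 Z2 p2] e f Af; have cA := shift_algebra_cstar.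
have [K1 K10 b1] := positive_functional_bounded cA shift_algebra1 D1 Z1 p1.
have [K2 K20 b2] := positive_functional_bounded cA shift_algebra1 D2 Z2 p2.
have span g : shift_span g -> A g /\ om1 g = om2 g.
  elim=> [|c t h _ [Ah eh]].
    by split; [exact: cstar0|rewrite -(scale0r id) Z1 ?Z2 ?mul0r//;
      exact: shift_algebra1].
  have As := shift_algebra_shift t; have Acs := cstarZ cA c As.
  by split; [exact: (cstarD cA)|rewrite D1// D2// Z1// Z2// e eh].
have [_ cf] := shift_generated Af.
apply/eqP; rewrite -subr_eq0 -normr_eq0 -abs_reE (inj_eq (@complexI R)).
rewrite eq_le abs_re_ge0 andbT; apply: (@le_geometric _ (K1 + K2)) => n;
  rewrite addr0.
have n0 : 0 < 2 ^- n :> R by rewrite invr_gt0 exprn_gt0.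
have [g sg fg] := cf _ n0; have [Ag eg] := span _ sg.
have Ad : A (f - g) by exact: (cstarB cA).
have -> : om1 f - om2 f = om1 (f - g) - om2 (f - g).
  have E (om : (H -> H) -> C) : (forall f g, A f -> A g -> om (f + g)
    = om f + om g) ->
      om f = om (f - g) + om g by move=> D; rewrite -D// subrK.
  by rewrite (E _ D1) (E _ D2) eg; ring.
rewrite -lecR abs_reE mulrDl rmorphD/=; apply: le_trans (ler_normB _ _) _.
by apply: lerD; [exact: b1|exact: b2].
Qed.

End Agreement.

Section Orbit.
Variables (R : realType) (Gamma : groupType) (X : compact_gamma_space Gamma).
Variable x : X.

Lemma orbit_act1 (y : cgs_orbit x) : orbit_act 1%g y = y.
Proof. by apply: val_inj; exact: cgs_act1. Qed.

Lemma orbit_actM s t (y : cgs_orbit x) :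
  orbit_act (s * t)%g y = orbit_act s (orbit_act t y).
Proof. by apply: val_inj; exact: cgs_actM. Qed.

Definition orbit_gset : gset Gamma := Gset orbit_act1 orbit_actM.

Definition cross_act (s : Gamma) (p : Gamma * X) : Gamma * X := (s * p.1, p.2)%g.

Lemma cross_act1 p : cross_act 1%g p = p.
Proof. by case: p => a y; rewrite /cross_act mul1g. Qed.

Lemma cross_actM s t p : cross_act (s * t)%g p = cross_act s (cross_act t p).
Proof. by rewrite /cross_act mulgA. Qed.

Definition cross_gset : gset Gamma := Gset cross_act1 cross_actM.

Lemma cross_shiftE : @cross_shift R Gamma X = @shift R Gamma cross_gset.
Proof. by apply/funext => s; apply/funext => xi; exact: l2P. Qed.

End Orbit.

Section OrbitRepresentation.
Variables (R : realType) (Gamma : groupType) (X : compact_gamma_space Gamma).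
Variable x : X.
Hypothesis hX : hamana_boundary R X.
Local Notation C := R[i].
Local Notation T := (orbit_gset x).
Local Notation K := (l2 R (cross_gset X)).
Local Notation H := (l2 R T).
Local Notation CX := (cfun_gamma_operator_system R X).
Local Notation BT := (gss_system (full_space R T)).
Local Notation point := (\val : cgs_orbit x -> X).

Lemma fixed_open t : open [set z : X | cgs_act X t z = z].
Proof.
apply: (@fixed_points_open X (cgs_act X t) (cgs_act X t^-1%g)).
- exact: (@cgs_hausdorff _ X).
- exact: closure_open hX.
- exact: cgs_act_continuous.
- exact: cgs_act_continuous.
- by move=> z; rewrite -cgs_actM mulVg cgs_act1.
- by move=> z; rewrite -cgs_actM mulgV cgs_act1.
Qed.

(** The dichotomy between moved points and interior fixed points is complete
    because fixed point sets are open. *)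
Lemma at_point_shift (Phi : BT -> CX) : gamma_morphism Phi ->
  forall t (y : T), at_point Phi (point y) (shift_op R T t) =
    l2_inner (shift t (l2_delta R y)) (l2_delta R y).
Proof.
move=> PhiP t y.
have p_equiv s (z : T) : point (gs_act T s z) = cgs_act X s (point z) by [].
have PhiK (f : CX) : Phi (@pullback R Gamma X T point f) = f.
  have [_ rig] := hX; apply: (rig (fun f => Phi (@pullback R Gamma X T point f))).
  have [[lp p1 pp] pe] := @pullback_morphism R Gamma X T point p_equiv.
  have [[lP P1 Pp] Pe] := PhiP.
  split; last by move=> s g; rewrite pe Pe.
  split=> [a g h||n M M0].
  - by rewrite lp lP.
  - by rewrite p1 P1.
  - rewrite (_ : map_mx _ M = map_mx Phi (map_mx (@pullback R Gamma X T point)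
    M)).
      by apply: Pp; exact: pp.
    by apply/matrixP => i j; rewrite !mxE.
rewrite shift_delta inner_delta /=.
have [ty|ty] := pselect (cgs_act X t (point y) = point y).
  rewrite (at_point_shift_fixed p_equiv val_inj PhiP PhiK (fixed_open t) ty)//.
  by case: eqP => // ny; exfalso; apply: ny; exact: val_inj.
rewrite (at_point_shift_moved p_equiv PhiP PhiK ty).
by case: eqP => // e; exfalso; apply: ty; rewrite -[LHS]/(point (orbit_act t y))
  -e.
Qed.

Variable pi : (K -> K) -> (H -> H).
Local Notation A0 := (cstar_generated (range (@shift R Gamma (cross_gset X)))).
Hypotheses (pib : forall f, A0 f -> bounded_operator (pi f))
  (piD : forall f g, A0 f -> A0 g -> pi (f + g) = pi f + pi g)
  (piZ : forall (a : C) f, A0 f -> pi (a *: f) = a *: pi f)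
  (piM : forall f g, A0 f -> A0 g -> pi (f \o g) = pi f \o pi g)
  (pi_adj : forall f g, A0 f -> is_adjoint f g -> is_adjoint (pi f) (pi g))
  (pi_shift : forall t, pi (shift t) = shift t).
Local Notation A := (pi @` A0).

(** As functions of [f], both sides are positive functionals, so it is enough to
    compare them on translations. *)
Lemma image_state (Phi : BT -> CX) : gamma_morphism Phi ->
  forall f (Af : A0 f) (y : T),
  at_point Phi (point y) (full_op (pib Af)) =
    l2_inner (pi f (l2_delta R y)) (l2_delta R y).
Proof.
move=> PhiP f Af y; have cA := @shift_algebra_cstar R Gamma (cross_gset X).
pose om1 (g : K -> K) : C :=
  if pselect (A0 g) is left Ag then at_point Phi (point y) (full_op (pib Ag))
    else 0.
have om1E g (bg : bounded_operator (pi g)) : A0 g -> om1 g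
  = at_point Phi (point y) (full_op bg).
  move=> Ag; rewrite /om1; case: pselect => // Ag'.
  by congr at_point; exact: gss_eqP.
pose om2 (g : K -> K) : C := l2_inner (pi g (l2_delta R y)) (l2_delta R y).
rewrite -(om1E _ (pib Af) Af) -/(om2 f).
apply: (positive_functional_eq (om1 := om1) (om2 := om2)) Af.
- split=> [g h Ag Ah|a g Ag|g h Ag gh].
  + rewrite (om1E _ (pib (cstarD cA Ag Ah)) (cstarD cA Ag Ah)).
    rewrite (om1E _ (pib Ag) Ag) (om1E _ (pib Ah) Ah) -(at_pointD PhiP).
    by congr at_point; apply: gss_eqP; exact: piD.
  + rewrite (om1E _ (pib (cstarZ cA a Ag)) (cstarZ cA a Ag)) (om1E _ (pib Ag) Ag).
    by rewrite -(at_pointZ PhiP); congr at_point; apply: gss_eqP; exact: piZ.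
  + have Ah := cstar_adjoint cA Ag gh; have Ahg := cstarM cA Ah Ag.
    rewrite (om1E _ (pib Ahg) Ahg); apply: (at_point_ge0 PhiP) => xi.
    rewrite -[gss_fun _ xi]/(pi (h \o g) xi) piM//=.
    by rewrite (adjoint_sym (pi_adj Ag gh)) inner_ge0.
- split=> [g h Ag Ah|a g Ag|g h Ag gh].
  + by rewrite /om2 piD// innerDl.
  + by rewrite /om2 piZ// innerZl.
  + have Ah := cstar_adjoint cA Ag gh.
    by rewrite /om2 piM//= (adjoint_sym (pi_adj Ag gh)) inner_ge0.
- move=> t; have At := @shift_algebra_shift R Gamma (cross_gset X) t.
  have e : full_op (pib At) = shift_op R T t by apply: gss_eqP; exact: pi_shift.
  by rewrite (om1E _ (pib At) At) e /om2 pi_shift (at_point_shift PhiP).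
Qed.

(** For [a] in [I], [Phi] vanishes on [a^* a], while its value there at a point of
    the orbit is the squared norm of [a] at the corresponding basis vector. *)
Lemma image_simple : simple_algebra A.
Proof.
move=> I hI; have cA := @shift_algebra_cstar R Gamma (cross_gset X).
have A1 : A id.
  exists id; first exact: shift_algebra1.
  by rewrite -[X in pi X](@shift1 R Gamma (cross_gset X)) pi_shift shift1.
have AD f g : A f -> A g -> A (f + g).
  by move=> [f0 Af <-] [g0 Ag <-]; exists (f0 + g0);
    [exact: (cstarD cA)|exact: piD].
have Ab : A `<=` @bounded_operator R T by move=> _ [f Af <-]; exact: pib.
have As t : A (shift t) by exists (shift t);
  [exact: shift_algebra_shift|exact: pi_shift].
have [I1|nI] := pselect (I id); first by right; exact: (ideal_full hI).
left; apply/seteqP; split=> [a Ia|_ ->]; last exact: (ideal0 hI).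
have [Phi PhiP Phi0] := ideal_annihilator A1 AD Ab hI As nI hX.1.
have Aa := ideal_sub hI Ia; have [f Af fa] := Aa.
have [g fg] := adjoint_exists (cstar_bounded cA Af).
have Ag := cstar_adjoint cA Af fg; have Agf := cstarM cA Ag Af.
have Jgf : symmetric_ideal I (pi (g \o f)).
  have Igf : I (pi (g \o f)).
    by rewrite piM// fa; apply: (idealMl hI) => //; exists g.
  split=> //; exists (pi (g \o f)) => //; apply: pi_adj => //.
  by apply: adjoint_comp => //; exact: adjoint_sym.
have a0 (y : T) : a (l2_delta R y) = 0.
  apply: inner_eq0; have := image_state PhiP Agf y.
  rewrite /at_point Phi0//= piM//= (adjoint_sym (pi_adj Af fg)) fa => <-.
  by [].
apply: bounded_delta; [exact: Ab|exact: bounded0|exact: a0].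
Qed.

End OrbitRepresentation.

Theorem corollary8p5 (R : realType) (Gamma : groupType)
    (Gamma_countable : countable [set: Gamma])
    (X : compact_gamma_space Gamma) (hX : hamana_boundary R X) (x : X)
    (pi : (l2 R (Gamma * X)%type -> l2 R (Gamma * X)%type) ->
          (l2 R (cgs_orbit x) -> l2 R (cgs_orbit x)))
    (pi_x : is_orbit_representation x pi) :
  simple_algebra (pi @` reduced_group_algebra R X).
Proof.
have [[pib piD piZ piM pi_adj] _ pi_shift] := pi_x.
have sub : reduced_group_algebra R X `<=` reduced_crossed_product R X.
  by move=> f hf B [cB sB]; apply: hf; split=> // g gs; apply: sB; right.
have At t : reduced_group_algebra R X (cross_shift t).
  by move=> B [_ SB]; apply: SB; exists t.
move: sub At; rewrite /reduced_group_algebra cross_shiftE => sub At.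
apply: (@image_simple R Gamma X x hX pi).
- by move=> f /sub; exact: pib.
- by move=> f g /sub Af /sub; exact: piD.
- by move=> a f /sub; exact: piZ.
- by move=> f g /sub Af /sub; exact: piM.
- by move=> f g /sub; exact: pi_adj.
move=> t; rewrite -cross_shiftE; apply: (@bounded_delta R (orbit_gset x)).
- by apply: pib; apply: sub; rewrite cross_shiftE; exact: At.
- exact: shift_bounded.
by move=> y; rewrite pi_shift shift_delta.
Qed.
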